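(* Let $D\subset\mathbb{R}^d$ be a bounded domain such that the classical Dirichlet problem on $D$ has a solution for every continuous boundary data. Let $f:\partial D\to[0,\infty]$ be a non-negative Borel measurable function and assume that $H_Df$ is not identically $+\infty$ on $D$. Then $H_Df$ is the unique harmonic function on $D$ which converges to $f$ controlled by some real-valued non-negative superharmonic function on $D$. More precisely, there exists a non-negative Borel measurable function $g$ on $\partial D$ such that $k:=H_Dg$ is real-valued on $D$ and $H_Df$ converges to $f$ controlled by $k$.
   Context: $(X(t))_{t\ge0}$ under $\mathbb{P}^x$ is $d$-dimensional Brownian motion started at $x$, $\mathbb{E}^x$ the corresponding expectation, and $\tau_D=\inf\{t>0: X(t)\notin D\}$. For a Borel function $f$ on $\partial D$ bounded below, $H_Df(x):=\mathbb{E}^x f(X(\tau_D))$, $x\in D$. The classical Dirichlet problem with continuous boundary data $\varphi$ asks for a harmonic $h$ on $D$ with $\lim_{D\ni x\to y}h(x)=\varphi(y)$ for all $y\in\partial D$. Controlled convergence: for $f:\partial D\to\overline{\mathbb{R}}$ and $h,k:D\to\mathbb{R}$ with $k\ge0$, $h$ converges to $f$ controlled by $k$ if for every $A\subset D$ and $y\in\partial D\cap\overline{A}$: (1) if $\limsup_{A\ni x\to y}k(x)<\infty$ then $f(y)\in\mathbb{R}$ and $f(y)=\lim_{A\ni x\to y}h(x)$; (2) if $\lim_{A\ni x\to y}k(x)=\infty$ then $\lim_{A\ni x\to y}\frac{h(x)}{1+k(x)}=0$. *)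

(* Defs.v *)
From HB Require Import structures.
From mathcomp Require Import all_boot all_order all_algebra.
From mathcomp Require Import all_classical all_reals all_analysis.
From mathcomp Require Import measurable_realfun.
Set Implicit Arguments. Unset Strict Implicit. Unset Printing Implicit Defensive.
Import Order.TTheory GRing.Theory Num.Theory.
Import numFieldNormedType.Exports.
Local Open Scope classical_set_scope.
Local Open Scope ring_scope.

Section Defs.
Variables (R : realType) (d : nat).
Local Notation V := 'rV[R]_d.

(** Euclidean inner product and norm on R^d = 'rV[R]_d.  (The library norm on
    'rV is the sup-norm; it induces the same topology, but balls for
    superharmonicity must be Euclidean.) *)
Definition dotR (u v : V) : R := \sum_(i < d) u ord0 i * v ord0 i.
Definition enorm (u : V) : R := Num.sqrt (dotR u u).
Definition eball (a : V) (r : R) : set V := [set x | enorm (x - a) < r].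
Definition ecball (a : V) (r : R) : set V := [set x | enorm (x - a) <= r].
Definition esphere (a : V) (r : R) : set V := [set x | enorm (x - a) = r].

Definition evec (i : 'I_d) : V := delta_mx ord0 i.

Definition partial (i : 'I_d) (h : V -> R) : V -> R :=
  fun x => 'D_(evec i) h x.

Definition bounded_domain (D : set V) : Prop :=
  D !=set0 /\ open D /\ connected D /\ exists M : R, forall x, D x -> enorm x <= M.

Definition bdry (D : set V) : set V := closure D `\` interior D.

Definition harmonic_on (h : V -> R) (D : set V) : Prop :=
  forall x, D x ->
    [/\ {for x, continuous h},
        (forall i, derivable h x (evec i) /\ {for x, continuous (partial i h)}),
        (forall i j, derivable (partial i h) x (evec j) /\
                     {for x, continuous (partial j (partial i h))}) &
        \sum_(i < d) partial i (partial i h) x = 0].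

Definition lsc_on (u : V -> R) (D : set V) : Prop :=
  forall x, D x -> forall c : R, c < u x -> \forall y \near x, c < u y.

Definition superharmonic_on (u : V -> R) (D : set V) : Prop :=
  lsc_on u D /\
  forall (a : V) (r : R), 0 < r -> ecball a r `<=` D ->
    forall h : V -> R,
      {within ecball a r, continuous h} -> harmonic_on h (eball a r) ->
      (forall y, esphere a r y -> h y <= u y) ->
      forall y, eball a r y -> h y <= u y.

Definition dirichlet_solvable (D : set V) : Prop :=
  forall phi : V -> R, {within bdry D, continuous phi} ->
    exists h : V -> R, harmonic_on h D /\
      forall y, bdry D y -> h x @[x --> within D (nbhs y)] --> phi y.

Definition borelRd : set (set V) := <<s open >>.

(** f (given on all of R^d, only its values on bdry D matter) is Borel
    measurable on bdry D *)
Definition borel_on (A : set V) (f : V -> \bar R) : Prop :=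
  forall B : set (\bar R), measurable B -> borelRd (A `&` f @^-1` B).

Definition controlled_conv (D : set V) (f : V -> \bar R) (h k : V -> R) : Prop :=
  forall (A : set V) (y : V), A `<=` D -> bdry D y -> closure A y ->
    ((exists M : R, \forall x \near within A (nbhs y), k x <= M) ->
       f y \is a fin_num /\ h x @[x --> within A (nbhs y)] --> fine (f y)) /\
    (k x @[x --> within A (nbhs y)] --> +oo ->
       (h x / (1 + k x)) @[x --> within A (nbhs y)] --> 0).

End Defs.

Section BM.
Variables (R : realType) (d : nat) (dO : measure_display) (Omega : measurableType dO).
Local Notation V := 'rV[R]_d.

Definition nat_filtration (X : R -> Omega -> V) (s : R) : set (set Omega) :=
  <<s [set A | exists r i (B : set R), 0 <= r <= s /\ measurable B /\
               A = (fun w => X r w ord0 i) @^-1` B] >>.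

(** X is, under P, a d-dimensional Brownian motion started at x:
    X(0) = x a.s., every path is continuous on [0,oo), each X(t) is a random
    vector, and for 0 <= s < t the increment X(t)-X(s) is independent of F_s
    with law N(0,(t-s)I) (expressed through its characteristic function
    conditioned on events of F_s). *)
Definition is_brownian (P : probability Omega R) (X : R -> Omega -> V) (x : V)
  : Prop :=
  [/\ P [set w | X 0 w = x] = 1%E,
      (forall w, {within [set t | 0 <= t], continuous (fun t => X t w)}),
      (forall t (i : 'I_d), measurable_fun setT (fun w => X t w ord0 i)) &
      (forall s t, 0 <= s -> s < t -> forall A, nat_filtration X s A ->
        forall u : V,
        (\int[P]_(w in A) (cos (dotR u (X t w - X s w)))%:E
           = (expR (- (dotR u u * (t - s)) / 2))%:E * P A)%E /\
        (\int[P]_(w in A) (sin (dotR u (X t w - X s w)))%:E = 0)%E)].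

Definition exit_time (D : set V) (X : R -> Omega -> V) (w : Omega) : R :=
  inf [set t | 0 < t /\ ~ D (X t w)].

Definition HD (P : V -> probability Omega R) (X : R -> Omega -> V)
    (D : set V) (f : V -> \bar R) (x : V) : \bar R :=
  (\int[P x]_w f (X (exit_time D X w) w))%E.

End BM.

(* Main.v *)
Require Import Defs.
From HB Require Import structures.
From mathcomp Require Import all_boot all_order all_algebra.
From mathcomp Require Import all_classical all_reals all_analysis.
From mathcomp Require Import measurable_realfun.
From mathcomp Require Import ring lra.
Set Implicit Arguments. Unset Strict Implicit. Unset Printing Implicit Defensive.
Import Order.TTheory GRing.Theory Num.Theory.
Import numFieldNormedType.Exports.
Local Open Scope classical_set_scope.
Local Open Scope ring_scope.

(* Ito's formula is replaced by a discrete telescoping: if [u] is harmonic on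
   [D], the mean of [u(X(s + del)) - u(X(s))] over an event of the past of [s]
   on which [X(s)] keeps away from the boundary is [o(del)], because the
   second-order Taylor terms add up to the Laplacian.  Summing over a grid up to
   the first grid time outside a closed subset of [D], refining the grid and
   exhausting [D] gives [E^x phi(X(tau_D)) = h(x)] for the Dirichlet solution [h]
   with continuous data [phi].

   Call countable sums of nonnegative continuous functions good.  By a
   monotone class argument, if [f >= 0] is Borel and [H_D f(x1)] is finite, there
   are continuous [phi_n] and good [v_n] with [|f - phi_n| <= v_n] on the boundary
   and [H_D v_n(x1)] as small as desired.  Harnack's inequality then makes
   [H_D phi_n] converge to [H_D f] locally uniformly, so [H_D f] is harmonic.
   The control function is [k = H_D g] with [g = \sum_n (n + 1) v_n]: in [D],
   [|H_D f - H_D phi_n| <= H_D v_n <= k / (n + 1)], and at the boundary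
   [|f - phi_n| <= v_n <= liminf H_D v_n <= liminf k / (n + 1)].

   For uniqueness, if [h1] and [h2] converge to [f] controlled by [k1 = k] and
   [k2], then [+-(h1 - h2) + eps (k1 + k2)] has nonnegative lower limits at the
   boundary, and the minimum principle applies. *)

(** * Harmonic functions through second differences *)

(** Harmonic functions enter as classical solutions of Laplace's equation, and the interior theory
    rests on explicit barriers and the weak maximum principle rather than on Poisson integrals:
    gradient bounds, limits and Harnack's inequality all come from there.

    The approximation of [f] asks for a small [H_D v_n] at the single point [x1]. Two properties of
    good functions make this enough: Harnack's inequality carries smallness from [x1] to
    neighbourhoods of all points of [D], and the lower limits of [H_D v] at a boundary point [y] are
    at least [v y]. Both survive countable sums but not differences. Hence the errors [v_n] are kept
    in a cone of good functions, and [|f - phi_n| <= v_n] is split into [f <= phi_n + v_n] and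
    [phi_n <= f + v_n]. This form also makes sense where [f] is infinite: there [v_n] is infinite
    too, and the control function blows up. *)

Section Basics.
Variables (R : realType) (d : nat).
Local Notation V := 'rV[R]_d.
Local Notation e i := (evec R i).
Implicit Types (i : 'I_d) (x y z v : V) (h : V -> R) (D : set V).

Lemma coord_le_norm x i : `|x ord0 i| <= `|x|.
Proof.
rewrite [leRHS]/Num.Def.normr /= mx_normrE.
exact: (le_bigmax 0 (fun ij : 'I_1 * 'I_d => `|x ij.1 ij.2|) (ord0 : 'I_1, i)).
Qed.

Lemma norm_le_coord x (B : R) :
  0 <= B -> (forall i, `|x ord0 i| <= B) -> `|x| <= B.
Proof.
move=> B0 xB; rewrite [leLHS]/Num.Def.normr /= mx_normrE; apply/bigmax_leP; split => //.
by move=> [i j] _ /=; rewrite ord1.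
Qed.

Lemma evecE i j : (e i) ord0 j = (i == j)%:R.
Proof. by rewrite mxE eqxx eq_sym. Qed.

Lemma norm_evec i : `|e i| = 1.
Proof.
apply/le_anti/andP; split.
  by apply: norm_le_coord => // j; rewrite evecE; case: eqP; rewrite ?normr1 ?normr0.
by have := coord_le_norm (e i) i; rewrite evecE eqxx normr1.
Qed.

Lemma norm_evecZ s i : `|s *: e i| = `|s|.
Proof. by rewrite normrZ norm_evec mulr1. Qed.

Lemma continuous_atP h x : {for x, continuous h} <->
  forall eps : R, 0 < eps -> exists2 del : R, 0 < del &
    forall y, `|y - x| < del -> `|h y - h x| < eps.
Proof.
split => [/cvgrPdist_lt H eps e0|H].
  have /nbhs_normP[r /= r0 Hr] := H _ e0; exists r => // y yx.
  by rewrite distrC; apply: Hr; rewrite /ball_ /= distrC.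
have : h @ nbhs x --> h x; last by [].
apply/(@cvgrPdist_lt _ _ _ (nbhs x)) => eps e0; have [r r0 Hr] := H _ e0.
apply/(@nbhs_normP _ V); exists r => //= y; rewrite /ball_ /= distrC => yx.
by rewrite distrC; apply: Hr.
Qed.

Lemma openP D : open D <->
  forall x, D x -> exists2 r : R, 0 < r & forall y, `|y - x| <= r -> D y.
Proof.
split=> [oD x Dx|H].
  have /nbhs_normP[r /= r0 Hr] := open_nbhs_nbhs (conj oD Dx).
  exists (r / 2); first by rewrite divr_gt0.
  move=> y yx; apply: Hr; rewrite /ball_ /= distrC (le_lt_trans yx) //.
  by rewrite ltr_pdivrMr // ltr_pMr // ltr1n.
rewrite openE => x Dx; have [r r0 Hr] := H _ Dx.
change (nbhs x D); apply/(@nbhs_normP _ V); exists r => //= y.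
by rewrite /ball_ /= distrC => /ltW; apply: Hr.
Qed.

Lemma is_derive_along h x i s0 : derivable h (x + s0 *: e i) (e i) ->
  is_derive s0 1 (fun s => h (x + s *: e i)) (partial i h (x + s0 *: e i)).
Proof.
have E : (fun t : R => t^-1 *: (((fun s => h (x + s *: e i)) \o shift s0) (t *: 1)
      - h (x + s0 *: e i))) =
  (fun t : R => t^-1 *: ((h \o shift (x + s0 *: e i)) (t *: e i) -
      h (x + s0 *: e i))).
  apply/funext => t /=; congr (_ *: (h _ - _)).
  by rewrite [t *: 1]mulr1 scalerDl addrCA.
move=> H; apply: DeriveDef.
  by rewrite /derivable E.
by rewrite /partial /derive E.
Qed.

Lemma derivable_along h x i : derivable h x (e i) ->
  is_derive (0 : R) 1 (fun s => h (x + s *: e i)) (partial i h x).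
Proof.
by have := @is_derive_along h x i 0; rewrite scale0r addr0.
Qed.

Lemma is_derive_epsP (g : R -> R) (a c : R) : is_derive a 1 g c <->
  forall eps : R, 0 < eps -> exists2 del : R, 0 < del &
    forall t, `|t| < del -> `|g (a + t) - g a - c * t| <= eps * `|t|.
Proof.
split=> [[dg <-] eps e0|H].
  have /cvgrPdist_le /(_ _ e0) /nbhs_normP[r /= r0 Hr] := dg.
  exists r => // t tr; have [->|t0] := eqVneq t 0.
    by rewrite addr0 subrr mulr0 subr0 normr0 mulr0.
  have := Hr t; rewrite /ball_ /= sub0r normrN => /(_ tr t0).
  rewrite -/(derive g a 1) [t%:A]mulr1 [_ *: _]mulrC.
  rewrite -ler_pdivrMr ?normr_gt0 // -normfV -normrM distrC addrC [t + a]addrC.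
  by rewrite [(_ - 'D_1 g a * t) / t]mulrBl mulfK // addrC.
have cv : (fun t : R => t^-1 *: ((g \o shift a) (t *: 1) - g a)) @ 0^' --> c.
  apply/cvgrPdist_le => eps e0; have [r r0 Hr] := H _ e0.
  apply/nbhs_normP; exists r => //= t; rewrite /ball_ /= sub0r normrN => tr t0.
  have := Hr _ tr.
  rewrite [t%:A]mulr1 [_ *: _]mulrC -ler_pdivrMr ?normr_gt0 // -normfV -normrM.
  by rewrite distrC [t + a]addrC [(_ - c * t) / t]mulrBl mulfK.
split; last exact/cvg_lim.
by apply/cvg_ex; exists c.
Qed.

Lemma MVT_le (g dg : R -> R) (a b B : R) : a <= b ->
  (forall t, a <= t <= b -> is_derive t 1 g (dg t)) ->
  (forall t, a <= t <= b -> `|dg t| <= B) -> `|g b - g a| <= B * (b - a).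
Proof.
move=> ab gd dB.
have [||c] := @MVT_segment R g dg a b ab.
- move=> t; rewrite in_itv /= => /andP[t1 t2].
  by apply: gd; rewrite !ltW.
- apply: derivable_within_continuous => t; rewrite in_itv /= => tab.
  by have [] := gd _ tab.
rewrite in_itv /= => cab ->; rewrite normrM [`|b - a|]ger0_norm ?subr_ge0 //.
by rewrite ler_wpM2r ?subr_ge0 // dB.
Qed.

(** The even function [G t = g t + g (- t) - c * t ^+ 2] has derivative
    [dg t - dg (- t) - 2 * c * t], of size at most [eps * t] for small [t >= 0] because [dg] has
    derivative [c] at 0. The mean value inequality for [G] concludes. *)
Lemma second_difference (g dg : R -> R) (r c : R) : 0 < r ->
  (forall t : R, `|t| < r -> is_derive t 1 g (dg t)) -> is_derive (0 : R) 1 dg c ->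
  forall eps : R, 0 < eps -> exists2 del : R, 0 < del & forall s : R, 0 <= s < del ->
    `|g s + g (- s) - 2 * g 0 - c * s ^+ 2| <= eps * s ^+ 2.
Proof.
move=> r0 gd /is_derive_epsP dd eps e0.
have [|q q0 Hq] := dd (eps / 2); first by rewrite divr_gt0.
exists (Num.min r q); first by rewrite lt_min r0.
move=> s /andP[s0]; rewrite lt_min => /andP[sr sq].
pose G t := g t + g (- t) - c * t ^+ 2.
pose dG t := dg t - dg (- t) - c * (2 * t).
have -> : g s + g (- s) - 2 * g 0 - c * s ^+ 2 = G s - G 0.
  by rewrite /G oppr0 expr0n /= mulr0 subr0; ring.
have -> : eps * s ^+ 2 = (eps * s) * (s - 0) by rewrite subr0; ring.
apply: (@MVT_le G dG) => // t /andP[t0 ts].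
  have tr : `|t| < r by rewrite ger0_norm // (le_lt_trans ts).
  have d1 := gd _ tr; have d2 := gd (- t); rewrite normrN in d2.
  have {}d2 := d2 tr.
  have d3 : is_derive t 1 (fun t => g (- t)) (- dg (- t)).
    have := @is_derive1_comp R g (-%R) t _ _ d2 _.
    by move=> /(_ (-1) _) []; rewrite mulrN1.
  apply: is_derive_eq; rewrite /dG /GRing.scale /=; ring.
have tq : `|t| < q by rewrite ger0_norm // (le_lt_trans ts).
have h1 := Hq _ tq; have h2 := Hq (- t); rewrite normrN in h2; have {}h2 := h2 tq.
rewrite /dG !add0r in h1 h2 *.
have -> : dg t - dg (- t) - c * (2 * t) = (dg t - dg 0 - c * t) - (dg (- t) - dg 0 - c * (- t)) by ring.
rewrite (le_trans (ler_normB _ _)) //.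
have ta : `|t| = t by rewrite ger0_norm.
rewrite ta in h1 h2; have : eps * t <= eps * s by rewrite ler_wpM2l // ltW.
lra.
Qed.

(** The discrete Laplacian of step [s] multiplied by [s ^+ 2]; without the division it makes sense
    for [s = 0]. *)
Definition lap (s : R) h x : R :=
  \sum_(i < d) (h (x + s *: e i) + h (x - s *: e i) - 2 * h x).

(* Continuous functions annihilated by the infinitesimal second differences:
   unlike [harmonic_on], visibly stable under linear combinations, translations
   and reflections, and enough for the maximum principle. *)
Definition wharm h D := forall x, D x -> {for x, continuous h} /\
  forall eps : R, 0 < eps -> exists2 del : R, 0 < del & forall s : R, 0 <= s < del ->
    `|lap s h x| <= eps * s ^+ 2.

Lemma harmonic_wharm h D : open D -> harmonic_on h D -> wharm h D.
Proof.
move=> /openP oD hD x Dx; have [hc hd hdd h0] := hD _ Dx; split=> // eps e0.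
have [r r0 Dr] := oD _ Dx.
have H i : exists2 del : R, 0 < del & forall s : R, 0 <= s < del ->
    `|h (x + s *: e i) + h (x - s *: e i) - 2 * h x -
      partial i (partial i h) x * s ^+ 2| <= (eps / d.+1%:R) * s ^+ 2.
  have [|||del d0 Hdel] := @second_difference (fun s => h (x + s *: e i))
    (fun s => partial i h (x + s *: e i)) r (partial i (partial i h) x) r0 _ _
    (eps / d.+1%:R).
  - move=> t tr; apply: is_derive_along.
    have [|_ H _ _] := hD (x + t *: e i).
      by apply: Dr; rewrite addrAC subrr add0r norm_evecZ ltW.
    by have [] := H i.
  - by apply: derivable_along; have [] := hdd i i.
  - by rewrite divr_gt0.
  exists del => // s /Hdel; by rewrite scaleNr scale0r addr0.
pose del i := s2val (cid2 (H i)).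
(* The neutral value 1 of the minimum keeps the radius positive even for an empty family. *)
exists (\big[Num.min/1]_i del i).
  apply/bigmin_gtP; split => // i _; exact: (s2valP (cid2 (H i))).
move=> s /andP[s0 /bigmin_gtP[_ sdel]].
have -> : lap s h x = \sum_(i < d) (h (x + s *: e i) + h (x - s *: e i) - 2 * h x -
      partial i (partial i h) x * s ^+ 2).
  by rewrite big_split /= -/(lap s h x) sumrN -mulr_suml h0 mul0r subr0.
rewrite (le_trans (ler_norm_sum _ _ _)) //.
apply: (@le_trans _ _ (\sum_(i < d) (eps / d.+1%:R) * s ^+ 2)).
  apply: ler_sum => i _; apply: (s2valP' (cid2 (H i))); rewrite s0 /=; exact: sdel.
rewrite -mulr_suml ler_wpM2r ?sqr_ge0 // sumr_const card_ord.
by rewrite -[_ *+ d]mulr_natr mulrAC ler_pdivrMr // ler_wpM2l ?(ltW e0) // ler_nat.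
Qed.

End Basics.

(** * Weak maximum principle and an estimate of odd parts *)

Section Estimates.
Variables (R : realType) (d : nat).
Local Notation V := 'rV[R]_d.
Local Notation e i := (evec R i).
Implicit Types (i : 'I_d) (x y z v : V) (h u w : V -> R) (D C : set V).

Lemma within_continuous C w :
  (forall x, C x -> {for x, continuous w}) -> {within C, continuous w}.
Proof. by move=> H; apply: continuous_in_subspaceT => x; rewrite inE => /H. Qed.

Lemma continuous_forB h u x : {for x, continuous h} -> {for x, continuous u} ->
  {for x, continuous (fun y => h y - u y)}.
Proof. exact: continuousB. Qed.

Lemma continuous_forD h u x : {for x, continuous h} -> {for x, continuous u} ->
  {for x, continuous (fun y => h y + u y)}.
Proof. exact: continuousD. Qed.

Lemma wharmW h D D' : D' `<=` D -> wharm h D -> wharm h D'.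
Proof. by move=> DD hD x /DD /hD. Qed.

Lemma lap_comb (a b s : R) h u x :
  lap s (fun y => a * h y + b * u y) x = a * lap s h x + b * lap s u x.
Proof.
rewrite /lap !mulr_sumr -big_split; apply: eq_bigr => i _ /=; ring.
Qed.

Lemma wharm_comb (a b : R) h u D : wharm h D -> wharm u D ->
  wharm (fun y => a * h y + b * u y) D.
Proof.
move=> hD uD x Dx; have [hc hl] := hD _ Dx; have [uc ul] := uD _ Dx; split.
  by apply: continuousD; apply: continuousM => //; exact: cst_continuous.
move=> eps e0; pose K := `|a| + `|b| + 1.
have K0 : 0 < K by rewrite /K; have := normr_ge0 a; have := normr_ge0 b; lra.
have [|p p0 Hp] := hl (eps / K); first by rewrite divr_gt0.
have [|q q0 Hq] := ul (eps / K); first by rewrite divr_gt0.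
exists (Num.min p q); first by rewrite lt_min p0.
move=> s /andP[s0]; rewrite lt_min => /andP[sp sq].
have {}Hp := Hp s; have {}Hq := Hq s; rewrite s0 sp sq in Hp Hq.
rewrite lap_comb (le_trans (ler_normD _ _)) // !normrM.
apply: (@le_trans _ _ (`|a| * (eps / K * s ^+ 2) + `|b| * (eps / K * s ^+ 2))).
  by rewrite lerD // ler_wpM2l // ?Hp ?Hq.
rewrite -mulrDl mulrA ler_wpM2r ?sqr_ge0 // mulrA ler_pdivrMr // mulrC.
by rewrite ler_wpM2l ?ltW // /K; lra.
Qed.

Lemma wharmN h D : wharm h D -> wharm (fun y => - h y) D.
Proof.
move=> hD; have -> : (fun y => - h y) = (fun y => (-1) * h y + 0 * h y).
  by apply/funext => y; ring.
exact: wharm_comb.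
Qed.

Lemma wharmB h u D : wharm h D -> wharm u D -> wharm (fun y => h y - u y) D.
Proof.
move=> hD uD; have -> : (fun y => h y - u y) = (fun y => 1 * h y + (-1) * u y).
  by apply/funext => y; ring.
exact: wharm_comb.
Qed.

Lemma wharm_shift h D v : wharm h D -> wharm (fun y => h (y + v)) [set y | D (y + v)].
Proof.
move=> hD x /= /hD[/continuous_atP hc hl]; split.
  apply/continuous_atP => eps e0; have [r r0 Hr] := hc _ e0; exists r => // y yx.
  by apply: Hr; rewrite opprD addrACA subrr addr0.
move=> eps /hl[r r0 Hr]; exists r => // s /Hr; congr (`|_| <= _).
by apply: eq_bigr => i _; rewrite !(addrAC _ v).
Qed.

(** At an interior maximum point every term of [lap] is nonpositive for small steps, against the
    second alternative, so [w <= 0] at a maximum point. In the applications the strict sign of [lap]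
    comes from an added quadratic term or from a strictly subharmonic barrier. *)
Lemma weak_max C w : compact C -> {within C, continuous w} ->
  (forall x, C x -> w x <= 0 \/
    (exists2 r : R, 0 < r & forall y, `|y - x| <= r -> C y) /\
    (exists2 del : R, 0 < del & forall s : R, 0 < s < del -> 0 < lap s w x)) ->
  forall x, C x -> w x <= 0.
Proof.
move=> cC cw H x Cx.
have [|p] := @EVT_max_rV R d w C _ cC cw; first by exists x.
rewrite inE => Cp pmax; apply: (le_trans (pmax _ _)); first by rewrite inE.
have [//|[[r r0 Hr] [q q0 Hq]]] := H _ Cp.
pose s := Num.min r (q / 2).
have s0 : 0 < s by rewrite lt_min r0 divr_gt0.
have sr : s <= r by rewrite ge_min lexx.
have sq : s < q.
  by rewrite (@le_lt_trans _ _ (q / 2)) // ?ge_min ?lexx ?orbT // ltr_pdivrMr // ltr_pMr // ltr1n.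
have := Hq s; rewrite s0 sq => /(_ isT); rewrite ltNge => /negP[].
apply: sumr_le0 => i _.
have h1 : w (p + s *: e i) <= w p.
  apply: pmax; rewrite inE; apply: Hr.
  by rewrite addrAC subrr add0r norm_evecZ gtr0_norm.
have h2 : w (p - s *: e i) <= w p.
  apply: pmax; rewrite inE; apply: Hr.
  by rewrite addrAC subrr add0r normrN norm_evecZ gtr0_norm.
lra.
Qed.

Definition quad (c b : 'I_d -> R) x : R :=
  \sum_(i < d) (c i * (x ord0 i) ^+ 2 + b i * x ord0 i).

Lemma lap_quad (c b : 'I_d -> R) (s : R) x :
  lap s (quad c b) x = 2 * (\sum_(i < d) c i) * s ^+ 2.
Proof.
rewrite /lap [in RHS]mulr_sumr mulr_suml; apply: eq_bigr => k _.
rewrite /quad -big_split mulr_sumr -sumrB /= (bigD1 k) //= big1 ?addr0.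
  rewrite !mxE /= eqxx /=; ring.
by move=> i ik; rewrite !mxE /= (negbTE ik) /=; ring.
Qed.

Lemma continuous_quad c b x : {for x, continuous (quad c b)}.
Proof.
have -> : quad c b = \sum_(i < d) (fun x : V => c i * (x ord0 i) ^+ 2 + b i * x ord0 i).
  by apply/funext => y; rewrite fct_sumE.
elim/big_ind : _ => [|f g cf cg|i _]; first exact: (@cst_continuous V R 0 x).
  exact: continuousD.
apply: continuousD; apply: continuousM; try exact: cst_continuous; last exact: coord_continuous.
by apply: continuousM; exact: coord_continuous.
Qed.

Lemma normball_closed x (r : R) : closed [set y : V | `|y - x| <= r].
Proof.
rewrite -openC; apply/openP => y /= /negP; rewrite -ltNge => ry.
exists ((`|y - x| - r) / 2); first by rewrite divr_gt0 ?subr_gt0.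
move=> z zy; apply/negP; rewrite -ltNge.
have := ler_normD (y - z) (z - x); rewrite addrA subrK [`|y - z|]distrC.
lra.
Qed.

Lemma normball_compact x (r : R) : compact [set y : V | `|y - x| <= r].
Proof.
apply: bounded_closed_compact; last exact: normball_closed.
exists (r + `|x|); split; first exact: num_real.
move=> M rM y /= yx; have := ler_normD (y - x) x; rewrite subrK; lra.
Qed.

(* The half-cube barrier [|x'|^2 + x_n (d r - (d - 1) x_n)] is harmonic; it
   dominates on the boundary the odd part of [u] in the n-th variable. *)
Lemma axis_estimate0 u D i (r M : R) : 0 < r ->
  (forall y, `|y| <= r -> D y) -> wharm u D -> (forall y, `|y| <= r -> `|u y| <= M) ->
  forall s : R, 0 <= s <= r -> u (s *: e i) - u (- (s *: e i)) <= 2 * d%:R * M / r * s.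
Proof.
move=> r0 rD uD uM s /andP[s0 sr].
have M0 : 0 <= M by apply: le_trans (normr_ge0 _) (uM 0 _); rewrite normr0 ltW.
(* Reflection in the hyperplane where the [i]-th coordinate is 0; the odd part [u - u \o rho]
   vanishes there and has small second differences. *)
pose rho y := y - (2 * y ord0 i) *: e i.
have rhoE y j : (rho y) ord0 j = if j == i then - y ord0 j else y ord0 j.
  rewrite !mxE /=; case: eqP => [->|_] /=; ring.
have rhon y : `|rho y| <= `|y|.
  apply: norm_le_coord => // j; rewrite rhoE.
  by case: ifP; rewrite ?normrN => _; exact: coord_le_norm.
have rhoB y z : rho y - rho z = rho (y - z).
  by apply/rowP => j; rewrite !mxE /=; ring.
have lap_rho t y : lap t (fun y => u (rho y)) y = lap t u (rho y).
  apply: eq_bigr => j _.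
  have rhoD (a : R) : rho (y + a *: e j) = rho y + (if j == i then - a else a) *: e j.
    apply/rowP => l; rewrite !mxE /=.
    by case: (eqVneq j i) => [->|ji] /=; ring.
  rewrite -scaleNr !rhoD; case: ifP => _; rewrite ?opprK !scaleNr ?opprK //.
  by rewrite [u (rho y - _) + _]addrC.
(* On the part of the boundary where [|y| = r] the barrier is at least [r ^+ 2], so [K] times it is
   at least [2 * M], a bound for [u - u \o rho]. *)
pose K := 2 * M / r ^+ 2.
(* The coefficients of the squares have sum 0, hence the barrier is harmonic. *)
pose c0 (j : 'I_d) : R := if j == i then 1 - d%:R else 1.
pose b0 (j : 'I_d) : R := if j == i then d%:R * r else 0.
have sumc0 : \sum_j c0 j = 0.
  rewrite (bigD1 i) //= /c0 eqxx (eq_bigr (fun=> 1)); last by move=> j /negbTE ->.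
  rewrite sumr_const cardC1 card_ord -subn1 natrB; first ring.
  by rewrite (leq_trans _ (ltn_ord i)).
have quad0 y : quad c0 b0 y = \sum_(j < d | j != i) (y ord0 j) ^+ 2 +
    y ord0 i * (d%:R * r - (d%:R - 1) * y ord0 i).
  rewrite /quad (bigD1 i) //= /c0 /b0 eqxx addrC; congr (_ + _); last ring.
  by apply: eq_bigr => j /negbTE ->; ring.
have d1 : 1 <= d%:R :> R by rewrite ler1n (leq_trans _ (ltn_ord i)).
pose C := [set y : V | `|y| <= r /\ 0 <= y ord0 i].
have qge0 y : C y -> 0 <= quad c0 b0 y.
  move=> [yr y0]; rewrite quad0; apply: addr_ge0.
    by apply: sumr_ge0 => j _; exact: sqr_ge0.
  have yi : y ord0 i <= r by apply: le_trans (ler_norm _) (le_trans (coord_le_norm _ _) yr).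
  apply: mulr_ge0 => //; nra.
have Cc : compact C.
  apply: bounded_closed_compact.
    exists r; split; first exact: num_real.
    by move=> a ra y [yr _] /=; rewrite (le_trans yr) // ltW.
  have -> : C = [set y : V | `|y - 0| <= r] `&` (fun y : V => y ord0 i) @^-1` [set t | 0 <= t].
    by apply/seteqP; split => y /=; rewrite subr0.
  apply: closedI; first exact: normball_closed.
  by apply: closed_comp; [move=> y _; exact: coord_continuous|exact: closed_ge].
(* The perturbation [eta * (y_i ^+ 2 - r ^+ 2)] is nonpositive on the cube and makes the second
   differences of [w] positive; it disappears as [eta] tends to 0. *)
have key eta : 0 < eta -> u (s *: e i) - u (- (s *: e i)) <= K * quad c0 b0 (s *: e i) + eta * r ^+ 2.
  move=> eta0.
  pose ce j := (if j == i then eta else 0) - K * c0 j.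
  pose w y := u y - u (rho y) + quad ce (fun j => - K * b0 j) y - eta * r ^+ 2.
  have wE y : w y = u y - u (rho y) - K * quad c0 b0 y + eta * ((y ord0 i) ^+ 2 - r ^+ 2).
    rewrite /w -!addrA; congr (_ + (_ + _)).
    rewrite mulrBr addrA; congr (_ - _); rewrite /quad mulr_sumr (bigD1 i) //= [in RHS](bigD1 i) //=.
    rewrite /ce eqxx.
    rewrite (eq_bigr (fun j => - (K * (c0 j * (y ord0 j) ^+ 2 + b0 j * y ord0 j)))); last first.
      by move=> j /negbTE ->; ring.
    rewrite sumrN; ring.
  suff : w (s *: e i) <= 0.
    have -> : w (s *: e i) = u (s *: e i) - u (- (s *: e i)) - K * quad c0 b0 (s *: e i) + eta * (s ^+ 2 - r ^+ 2).
      rewrite wE; congr (_ - u _ - _ + eta * (_ ^+ 2 - _)); last first.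
        by rewrite !mxE /= eqxx mulr1.
      by apply/rowP => j; rewrite rhoE !mxE /=; case: eqP => _ /=; ring.
    have : 0 <= eta * s ^+ 2 by rewrite mulr_ge0 ?sqr_ge0 // ltW.
    lra.
  apply: (weak_max Cc).
  - apply: within_continuous => y [yr _]; apply: continuous_forB; last exact: cst_continuous.
    apply: continuous_forD; last exact: continuous_quad.
    apply: continuous_forB; first by have [] := uD _ (rD _ yr).
    have [|/continuous_atP uc _] := uD (rho y).
      by apply: rD; exact: le_trans (rhon _) yr.
    apply/continuous_atP => eps /uc[q q0 Hq]; exists q => // z zy.
    by apply: Hq; rewrite rhoB (le_lt_trans (rhon _)).
  - move=> y Cy; have [yr y0] := Cy.
    have [yi0|yi0] := eqVneq (y ord0 i) 0.
      left; rewrite wE; have -> : rho y = y.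
        apply/rowP => j; rewrite rhoE; case: eqP => // ->; by rewrite yi0 oppr0.
      rewrite subrr yi0 expr0n /= add0r sub0r.
      have := qge0 _ Cy; have : 0 <= K by rewrite /K divr_ge0 ?sqr_ge0 // mulr_ge0.
      have : 0 <= eta * r ^+ 2 by rewrite mulr_ge0 ?sqr_ge0 // ltW.
      nra.
    have [ylt|yge] := ltP `|y| r.
      right; split.
        exists (Num.min (r - `|y|) (y ord0 i)).
          by rewrite lt_min subr_gt0 ylt lt_neqAle eq_sym yi0.
        move=> z; rewrite le_min => /andP[z1 z2]; split.
          have := ler_normD (z - y) y; rewrite subrK; lra.
        have := coord_le_norm (z - y) i; rewrite !mxE.
        have := ler_norm (y ord0 i - z ord0 i); rewrite distrC; lra.
      have [uc ul] := uD _ (rD _ yr).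
      have [|ucr ulr] := uD (rho y); first by apply: rD; exact: le_trans (rhon _) yr.
      have [|p p0 Hp] := ul (eta / 2); first by rewrite divr_gt0.
      have [|q q0 Hq] := ulr (eta / 2); first by rewrite divr_gt0.
      exists (Num.min p q); first by rewrite lt_min p0.
      move=> t /andP[t0]; rewrite lt_min => /andP[tp tq].
      have -> : lap t w y = lap t u y - lap t u (rho y) + 2 * eta * t ^+ 2.
        rewrite -lap_rho.
        have -> : 2 * eta * t ^+ 2 = lap t (quad ce (fun j => - K * b0 j)) y.
          rewrite lap_quad; congr (2 * _ * _); rewrite /ce sumrB -mulr_sumr sumc0 mulr0 subr0.
          by rewrite -big_mkcond /= big_pred1_eq.
        rewrite /lap -sumrB -big_split; apply: eq_bigr => j _ /=; rewrite /w; ring.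
      have := Hp t; have := Hq t; rewrite (ltW t0) tp tq => /(_ isT) h1 /(_ isT) h2.
      have := ler_norm (lap t u (rho y)); have := ler_norm (- lap t u y); rewrite normrN.
      have : 0 < eta * t ^+ 2 by rewrite mulr_gt0 // exprn_gt0.
      lra.
    left; rewrite wE.
    have yer : `|y| = r by apply/le_anti; rewrite yr yge.
    (* Either [y] is on the face [y_i = r], where the second term of the barrier equals [r ^+ 2], or
       on a face [|y_j| = r] with [j != i], where one of the squares does. *)
    have qr : r ^+ 2 <= quad c0 b0 y.
      have yi : y ord0 i <= r by apply: le_trans (ler_norm _) (le_trans (coord_le_norm _ _) yr).
      have [[a j]] : exists k, `|y| = `|y k.1 k.2|.
        by apply: mx_norm_neq0; change (`|y| != 0); rewrite yer gt_eqF.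
      rewrite ord1 /= yer => yj.
      rewrite quad0; have [ji|ji] := eqVneq j i.
        have -> : y ord0 i = r by rewrite -ji yj ger0_norm // ji.
        have -> : r * (d%:R * r - (d%:R - 1) * r) = r ^+ 2 by ring.
        by rewrite lerDr; apply: sumr_ge0 => l _; exact: sqr_ge0.
      have yj2 : (y ord0 j) ^+ 2 = r ^+ 2 by rewrite yj -normrX ger0_norm ?sqr_ge0.
      rewrite (bigD1 j) //= yj2.
      have : 0 <= \sum_(j0 < d | (j0 != i) && (j0 != j)) (y ord0 j0) ^+ 2 by apply: sumr_ge0 => l _; exact: sqr_ge0.
      have : 0 <= y ord0 i * (d%:R * r - (d%:R - 1) * y ord0 i) by apply: mulr_ge0 => //; nra.
      lra.
    have K2 : 2 * M <= K * quad c0 b0 y.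
      rewrite /K mulrAC ler_pdivlMr ?exprn_gt0 //.
      by rewrite ler_wpM2l // mulr_ge0.
    have h1 := uM _ yr; have h2 := uM _ (le_trans (rhon _) yr).
    have := ler_norm (u y); have := ler_norm (- u (rho y)); rewrite normrN.
    have : eta * ((y ord0 i) ^+ 2 - r ^+ 2) <= 0.
      rewrite pmulr_rle0 // subr_le0 ler_pXn2r ?nnegrE ?(ltW r0) //.
      by apply: le_trans (ler_norm _) (le_trans (coord_le_norm _ _) yr).
    lra.
  - split; first by rewrite norm_evecZ ger0_norm.
    by rewrite !mxE /= eqxx mulr1.
have -> : 2 * d%:R * M / r * s = K * (s * (d%:R * r)).
  by rewrite /K; field; rewrite gt_eqF.
apply: (@le_trans _ _ (K * quad c0 b0 (s *: e i))).
  apply/ler_addgt0Pr => eps eps0; have := key (eps / r ^+ 2).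
  rewrite divr_gt0 ?exprn_gt0 // => /(_ isT); rewrite divfK //.
  by rewrite gt_eqF // exprn_gt0.
rewrite ler_wpM2l //; first by rewrite /K divr_ge0 ?sqr_ge0 // mulr_ge0.
rewrite quad0 big1 ?add0r.
  by rewrite !mxE /= eqxx mulr1 ler_wpM2l // gerBl mulr_ge0 // subr_ge0.
by move=> j ji; rewrite !mxE /= (negbTE ji) mulr0 expr0n.
Qed.

End Estimates.

(** * Interior estimates and limits of harmonic functions *)

Section Lipschitz.
Variables (R : realType) (d : nat).
Local Notation V := 'rV[R]_d.
Local Notation e i := (evec R i).
Implicit Types (i : 'I_d) (x y z v : V) (h u w F : V -> R) (D C : set V).

Lemma axis_estimate u D x0 i (r M : R) : 0 < r ->
  (forall y, `|y - x0| <= r -> D y) -> wharm u D ->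
  (forall y, `|y - x0| <= r -> `|u y| <= M) ->
  forall s : R, 0 <= s <= r ->
  `|u (x0 + s *: e i) - u (x0 - s *: e i)| <= 2 * d%:R * M / r * s.
Proof.
move=> r0 rD uD uM s sr.
have H f : wharm f D -> (forall y, `|y - x0| <= r -> `|f y| <= M) ->
    f (x0 + s *: e i) - f (x0 - s *: e i) <= 2 * d%:R * M / r * s.
  move=> fD fM.
  have := @axis_estimate0 R d (fun y => f (y + x0)) [set y | D (y + x0)] i r M r0.
  rewrite [x0 + _]addrC [x0 - _]addrC; apply => //.
  - by move=> y yr /=; apply: rD; rewrite addrK.
  - exact: wharm_shift.
  - by move=> y yr; apply: fM; rewrite addrK.
rewrite ler_norml H // andbT lerNl opprB.
have := H (fun y => - u y) (wharmN uD).
by rewrite opprK addrC; apply => y yr; rewrite normrN uM.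
Qed.

(** The coordinates of [y] are replaced by those of [z] one after the other; balls of the sup-norm
    are cubes, so the intermediate points [m k] stay inside. *)
Lemma axis_lipschitz F x0 (rho L : R) : 0 <= L ->
  (forall i y (a : R), `|y - x0| <= rho -> `|y + a *: e i - x0| <= rho ->
    `|F (y + a *: e i) - F y| <= L * `|a|) ->
  forall y z, `|y - x0| <= rho -> `|z - x0| <= rho ->
    `|F z - F y| <= d%:R * L * `|z - y|.
Proof.
move=> L0 FL y z yr zr.
pose m (k : nat) : V := \row_i (if (i < k)%N then z ord0 i else y ord0 i).
have m0 : m 0%N = y by apply/rowP => i; rewrite mxE.
have md : m d = z by apply/rowP => i; rewrite mxE ltn_ord.
have mS (k : 'I_d) : m k.+1 = m k + (z ord0 k - y ord0 k) *: e k.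
  apply/rowP => i; rewrite !mxE /= ltnS leq_eqVlt.
  have [->|ik] := eqVneq i k; first by rewrite eqxx ltnn /=; ring.
  by rewrite -(inj_eq val_inj) /= in ik; rewrite (negbTE ik) /=; case: ifP => _; ring.
have mr k : `|m k - x0| <= rho.
  apply: norm_le_coord => [|i]; first exact: le_trans (normr_ge0 _) yr.
  rewrite !mxE; case: ifP => _.
    by have := coord_le_norm (z - x0) i; rewrite !mxE => /le_trans; apply.
  by have := coord_le_norm (y - x0) i; rewrite !mxE => /le_trans; apply.
rewrite -md -m0 -(telescope_sumr (fun k => F (m k))) // big_mkord.
rewrite (le_trans (ler_norm_sum _ _ _)) //.
apply: (@le_trans _ _ (\sum_(k < d) L * `|z - y|)); last first.
  by rewrite sumr_const card_ord m0 md -mulrA mulr_natl.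
apply: ler_sum => k _; rewrite mS; apply: le_trans (FL _ _ _ _ _) _.
- exact: mr.
- by rewrite -mS mr.
- by rewrite ler_wpM2l //; have := coord_le_norm (z - y) k; rewrite !mxE.
Qed.

(** [d] coordinate moves, each with the factor [2 * d] of [axis_estimate]. *)
Definition lipc : R := 2 * d%:R ^+ 2.

Lemma lipc_ge0 : 0 <= lipc. Proof. by rewrite mulr_ge0 // exprn_ge0. Qed.

(** Two points on a line parallel to an axis are symmetric about their midpoint [c], and the cube of
    radius [r / 2] around [c] lies in the original one, so [axis_estimate] applies at [c]. *)
Lemma wharm_lipschitz u D x0 (r M : R) : 0 < r ->
  (forall y, `|y - x0| <= r -> D y) -> wharm u D ->
  (forall y, `|y - x0| <= r -> `|u y| <= M) ->
  forall y z, `|y - x0| <= r / 2 -> `|z - x0| <= r / 2 ->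
    `|u z - u y| <= lipc * M / r * `|z - y|.
Proof.
move=> r0 rD uD uM y z yr zr.
have M0 : 0 <= M by apply: le_trans (normr_ge0 _) (uM x0 _); rewrite subrr normr0 ltW.
have r20 : 0 < r / 2 by rewrite divr_gt0.
have -> : lipc * M / r = d%:R * (2 * d%:R * M / r) by rewrite /lipc; ring.
apply: (axis_lipschitz (x0 := x0) (rho := r / 2)) => //.
  by rewrite divr_ge0 ?mulr_ge0 // ltW.
move=> i {}y a {}yr {zr} yar.
wlog a0 : y a yr yar / 0 <= a.
  move=> H; have [|/ltW a0] := leP 0 a; first exact: H.
  have := H (y + a *: e i) (- a); rewrite scaleNr addrK normrN oppr_ge0.
  by move=> /(_ yar yr a0); rewrite distrC.
pose c := y + (a / 2) *: e i.
have E1 : y + a *: e i = c + (a / 2) *: e i.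
  by rewrite /c -addrA -scalerDl -splitr.
have E2 : y = c - (a / 2) *: e i by rewrite /c addrK.
have cr : `|c - x0| <= r / 2.
  have -> : c - x0 = 2^-1 *: (y - x0) + 2^-1 *: (y + a *: e i - x0).
    by apply/rowP => j; rewrite !mxE; field.
  rewrite (le_trans (ler_normD _ _)) // !normrZ ger0_norm ?invr_ge0 //.
  apply: (@le_trans _ _ (2^-1 * (r / 2) + 2^-1 * (r / 2))); last by lra.
  by apply: lerD; rewrite ler_wpM2l // invr_ge0.
have ar : `|a| <= r.
  have -> : `|a| = `|(y + a *: e i - x0) - (y - x0)|.
    by rewrite opprB addrA subrK addrAC subrr add0r norm_evecZ.
  rewrite (le_trans (ler_normB _ _)) //; lra.
rewrite ger0_norm // in ar.
have := @axis_estimate u D c i (r / 2) M r20 _ uD _ (a / 2).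
rewrite -E1 -E2 [`|a|]ger0_norm //.
have -> : 2 * d%:R * M / (r / 2) * (a / 2) = 2 * d%:R * M / r * a by field; rewrite gt_eqF.
have cb v : `|v - c| <= r / 2 -> `|v - x0| <= r.
  by move=> vc; have := ler_normD (v - c) (c - x0); rewrite addrA subrK; lra.
apply.
- by move=> v /cb; apply: rD.
- by move=> v /cb; apply: uM.
- by apply/andP; split; lra.
Qed.

Lemma wharm_diff u D v : wharm u D ->
  wharm (fun y => u (y + v) - u y) (D `&` [set y | D (y + v)]).
Proof.
move=> uD; apply: wharmB; first by apply: wharmW (wharm_shift (v := v) uD) => y [].
by apply: wharmW uD => y [].
Qed.

Lemma diff_bound u D x0 (r M : R) v : 0 < r ->
  (forall y, `|y - x0| <= r -> D y) -> wharm u D ->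
  (forall y, `|y - x0| <= r -> `|u y| <= M) -> `|v| <= r / 4 ->
  forall y, `|y - x0| <= r / 4 -> `|u (y + v) - u y| <= lipc * M / r * `|v|.
Proof.
move=> r0 rD uD uM vr y yr.
have := @wharm_lipschitz u D x0 r M r0 rD uD uM y (y + v).
rewrite [y + v - y]addrAC subrr add0r; apply; first lra.
rewrite addrAC (le_trans (ler_normD _ _)) //; lra.
Qed.

(** Three gradient estimates on cubes of radii [r], [r / 4] and [r / 16] give [4 * 16 * lipc ^+ 3];
    two such terms on each of [d] axes, divided by the 4 that [lap_double] displays, leave the
    factor 32. *)
Definition lap_const : R := 32 * d%:R * lipc ^+ 3.

(** Along an axis the combination [lap (2 * t) - 4 * lap t] is a fourth difference of [u], that is,
    a sum of two first differences of the second difference [u2]. Differences of [wharm] functions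
    are [wharm], so each summand is bounded by three successive gradient estimates. *)
Lemma lap_double u D x0 (r M : R) : 0 < r ->
  (forall y, `|y - x0| <= r -> D y) -> wharm u D ->
  (forall y, `|y - x0| <= r -> `|u y| <= M) ->
  forall t : R, 0 <= t <= r / 64 ->
  `|lap (2 * t) u x0 - 4 * lap t u x0| <= lap_const * 4 * M / r ^+ 3 * t ^+ 3.
Proof.
move=> r0 rD uD uM t /andP[t0 tr].
rewrite /lap mulr_sumr -sumrB (le_trans (ler_norm_sum _ _ _)) //.
have -> : lap_const * 4 * M / r ^+ 3 * t ^+ 3 =
    \sum_(i < d) (2 * (64 * lipc ^+ 3 * M / r ^+ 3 * t ^+ 3)).
  by rewrite sumr_const card_ord -[RHS]mulr_natr /lap_const; ring.
apply: ler_sum => i _.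
have nt : `|t *: e i| = t by rewrite norm_evecZ ger0_norm.
pose v := t *: e i.
pose u1 y := u (y + v) - u y; pose u2 y := u1 (y + v) - u1 y.
pose D1 := D `&` [set y | D (y + v)].
pose D2 := D1 `&` [set y | D1 (y + v)].
have shiftb y (a b : R) : t <= b - a -> `|y - x0| <= a -> `|y + v - x0| <= b.
  by move=> tab ya; rewrite addrAC (le_trans (ler_normD _ _)) // nt; lra.
have rD1 y : `|y - x0| <= r / 4 -> D1 y.
  by move=> yr; split; apply: rD; [|apply: (shiftb _ (r / 4))]; lra.
have rD2 y : `|y - x0| <= r / 16 -> D2 y.
  by move=> yr; split; apply: rD1; [|apply: (shiftb _ (r / 16))]; lra.
have u1D : wharm u1 D1 by exact: wharm_diff.
have u2D : wharm u2 D2 by exact: wharm_diff.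
have r40 : 0 < r / 4 by lra.
have r160 : 0 < r / 16 by lra.
have u1M y : `|y - x0| <= r / 4 -> `|u1 y| <= lipc * M / r * t.
  have <- : lipc * M / r * `|v| = lipc * M / r * t by rewrite nt.
  by apply: (diff_bound r0 rD uD uM); rewrite nt; lra.
have u2M y : `|y - x0| <= r / 16 -> `|u2 y| <= lipc * (lipc * M / r * t) / (r / 4) * t.
  move=> yr; have -> : lipc * (lipc * M / r * t) / (r / 4) * t = lipc * (lipc * M / r * t) / (r / 4) * `|v| by rewrite nt.
  by apply: (diff_bound r40 rD1 u1D u1M); rewrite ?nt; lra.
have L := wharm_lipschitz r160 rD2 u2D u2M.
have -> : u (x0 + (2 * t) *: e i) + u (x0 - (2 * t) *: e i) - 2 * u x0 -
    4 * (u (x0 + t *: e i) + u (x0 - t *: e i) - 2 * u x0) =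
    (u2 x0 - u2 (x0 - v)) + (u2 (x0 - v - v) - u2 (x0 - v)).
  have E2 : (2 * t) *: e i = v + v by rewrite -scalerDl; congr (_ *: _); ring.
  rewrite /u2 /u1 E2 -/v !subrK opprD !addrA; ring.
have b0 : `|x0 - x0| <= r / 16 / 2 by rewrite subrr normr0; lra.
have b1 : `|x0 - v - x0| <= r / 16 / 2 by rewrite addrAC subrr add0r normrN nt; lra.
have b2 : `|x0 - v - v - x0| <= r / 16 / 2.
  have -> : x0 - v - v - x0 = - (v + v) by apply/rowP => j; rewrite !mxE; ring.
  rewrite normrN (le_trans (ler_normD _ _)) // nt; lra.
have h1 := L _ _ b1 b0; have h2 := L _ _ b1 b2.
rewrite subKr nt in h1.
rewrite [x0 - v - v - _]addrAC subrr add0r normrN nt in h2.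
rewrite (le_trans (ler_normD _ _)) //.
have -> : 2 * (64 * lipc ^+ 3 * M / r ^+ 3 * t ^+ 3) =
   2 * (lipc * (lipc * (lipc * M / r * t) / (r / 4) * t) / (r / 16) * t).
  by field; rewrite gt_eqF.
lra.
Qed.

(** When the step is halved repeatedly, the errors of [lap_double] form a geometric series, whence
    the factor [1 - 2 ^- n], and [4 ^+ n * lap (t / 2 ^+ n)] tends to 0 by [wharm]. The bound
    depends on [u] only through [M], which lets [wharm] pass to limits. *)
Lemma lap_bound u D x0 (r M : R) : 0 < r ->
  (forall y, `|y - x0| <= r -> D y) -> wharm u D ->
  (forall y, `|y - x0| <= r -> `|u y| <= M) ->
  forall t : R, 0 <= t <= r / 64 ->
  `|lap t u x0| <= lap_const * M / r ^+ 3 * t ^+ 3.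
Proof.
move=> r0 rD uD uM t /andP[t0 tr].
have H n : `|lap t u x0| <= 4 ^+ n * `|lap (t / 2 ^+ n) u x0| +
    lap_const * M / r ^+ 3 * t ^+ 3 * (1 - 2 ^- n).
  elim: n => [|n IH]; first by rewrite expr0 invr1 subrr mulr0 addr0 mul1r mulr1.
  apply: le_trans IH _.
  have p0 : 0 < 2 ^+ n :> R by rewrite exprn_gt0.
  pose s := t / 2 ^+ n.+1.
  have s0 : 0 <= s by rewrite /s divr_ge0 // exprn_ge0.
  have sr : s <= r / 64.
    by rewrite (le_trans _ tr) // ler_pdivrMr ?exprn_gt0 // ler_peMr // exprn_ege1 // ler1n.
  have := @lap_double u D x0 r M r0 rD uD uM s; rewrite s0 sr => /(_ isT).
  have -> : 2 * s = t / 2 ^+ n by rewrite /s exprS; field; rewrite gt_eqF.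
  rewrite -/s => h.
  have h2 : `|lap (t / 2 ^+ n) u x0| <= 4 * `|lap s u x0| + lap_const * 4 * M / r ^+ 3 * s ^+ 3.
    have := ler_normD (lap (t / 2 ^+ n) u x0 - 4 * lap s u x0) (4 * lap s u x0).
    by rewrite subrK normrM (ger0_norm (ler0n _ 4)); lra.
  rewrite -(ler_pM2l (exprn_gt0 n (ltr0n R 4))) in h2.
  have -> : 4 ^+ n.+1 * `|lap s u x0| + lap_const * M / r ^+ 3 * t ^+ 3 * (1 - 2 ^- n.+1) =
    4 ^+ n * (4 * `|lap s u x0| + lap_const * 4 * M / r ^+ 3 * s ^+ 3) +
    lap_const * M / r ^+ 3 * t ^+ 3 * (1 - 2 ^- n); last by rewrite lerD2r.
  rewrite [4 ^+ n.+1]exprS.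
  have -> : 4 ^+ n = 2 ^+ n * 2 ^+ n :> R by rewrite -exprMn; congr (_ ^+ n); ring.
  by rewrite /s [2 ^+ n.+1]exprS; field; rewrite ?gt_eqF.
apply/ler_addgt0Pl => eps e0.
have Dx0 : D x0 by apply: rD; rewrite subrr normr0 ltW.
have [_ ul] := uD _ Dx0.
have [|q q0 Hq] := ul (eps / (t ^+ 2 + 1)).
  by rewrite divr_gt0 // ltr_wpDl // exprn_ge0.
have [n nq] : exists n : nat, t / 2 ^+ n < q.
  have [|n] := ltr_add_invr (y := 0) (x := q / (t + 1)).
    by rewrite divr_gt0 // ltr_wpDl.
  rewrite add0r => hn; exists n.
  rewrite ltr_pdivrMr ?exprn_gt0 //.
  rewrite ltr_pdivlMr ?ltr_wpDl // in hn.
  have p1 : (n.+1%:R : R) <= 2 ^+ n by rewrite -natrX ler_nat ltn_expl.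
  have : n.+1%:R^-1 * (t + 1) * n.+1%:R < q * n.+1%:R by rewrite ltr_pM2r.
  rewrite mulrAC mulVf ?pnatr_eq0 // mul1r => h3.
  have : q * n.+1%:R <= q * 2 ^+ n by rewrite ler_pM2l.
  lra.
apply: (le_trans (H n)); apply: lerD.
  have := Hq (t / 2 ^+ n); rewrite nq divr_ge0 ?exprn_ge0 // => /(_ isT) h.
  have p4 : 0 < 4 ^+ n :> R by rewrite exprn_gt0.
  have h2 : 4 ^+ n * `|lap (t / 2 ^+ n) u x0| <= eps / (t ^+ 2 + 1) * t ^+ 2.
    have -> : eps / (t ^+ 2 + 1) * t ^+ 2 = 4 ^+ n * (eps / (t ^+ 2 + 1) * (t / 2 ^+ n) ^+ 2).
      have -> : 4 ^+ n = 2 ^+ n * 2 ^+ n :> R by rewrite -exprMn; congr (_ ^+ n); ring.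
      field; rewrite ?gt_eqF // ?exprn_gt0 // ltr_wpDl // exprn_ge0 //.
    by rewrite ler_pM2l.
  rewrite (le_trans h2) // -mulrA ler_piMr ?ltW //.
  by rewrite mulrC ltr_pdivrMr ?ltr_wpDl ?exprn_ge0 // mul1r ltrDl.
apply: ler_piMr; last by rewrite gerBl invr_ge0 exprn_ge0.
have M0 : 0 <= M by apply: le_trans (normr_ge0 _) (uM x0 _); rewrite subrr normr0 ltW.
by rewrite mulr_ge0 ?divr_ge0 ?mulr_ge0 ?exprn_ge0 ?lipc_ge0 // ltW.
Qed.

End Lipschitz.

(** * Limits and derivatives of harmonic functions *)

Section Limits.
Variables (R : realType) (d : nat).
Local Notation V := 'rV[R]_d.
Local Notation e i := (evec R i).
Implicit Types (i : 'I_d) (x y z v : V) (h u w f : V -> R) (D C : set V).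

Lemma cvg_seqP (u : nat -> R) (l : R) : (u n @[n --> \oo] --> l) <->
  forall eps : R, 0 < eps -> exists N, forall n, (N <= n)%N -> `|u n - l| < eps.
Proof.
split => [/cvgrPdist_lt H eps /H[N _ HN]|H].
  by exists N => n /HN; rewrite /= distrC.
apply/cvgrPdist_lt => eps /H[N HN]; exists N => // n /= /HN.
by rewrite distrC.
Qed.

Lemma cvg_norm_le (u : nat -> R) (l B : R) :
  u n @[n --> \oo] --> l -> (forall n, `|u n| <= B) -> `|l| <= B.
Proof.
move=> /cvg_seqP ul uB; apply/ler_addgt0Pr => eps /ul[N /(_ N (leqnn _))].
by have := ler_normD (l - u N) (u N); rewrite subrK distrC; have := uB N; lra.
Qed.

Lemma cvg_dist_le (u v : nat -> R) (l m B : R) :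
  u n @[n --> \oo] --> l -> v n @[n --> \oo] --> m ->
  (forall n, `|u n - v n| <= B) -> `|l - m| <= B.
Proof. by move=> ul vm; apply: cvg_norm_le; exact: cvgB. Qed.

Lemma is_derive_of_quadratic (g : R -> R) (a c L del : R) : 0 < del ->
  (forall t, `|t| <= del -> `|g (a + t) - g a - c * t| <= L * t ^+ 2) ->
  is_derive a 1 g c.
Proof.
move=> del0 H; apply/is_derive_epsP => eps e0.
have L1 : 0 < `|L| + 1 by rewrite ltr_wpDl.
exists (Num.min del (eps / (`|L| + 1))); first by rewrite lt_min del0 divr_gt0.
move=> t; rewrite lt_min => /andP[/ltW tdel teps].
apply: (le_trans (H _ tdel)); have -> : t ^+ 2 = `|t| * `|t| by rewrite -normrM -expr2 ger0_norm ?sqr_ge0.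
rewrite mulrA.
rewrite ler_wpM2r //; rewrite ltr_pdivlMr // in teps.
have := ler_norm L; have := normr_ge0 t.
nra.
Qed.

Lemma derivable_of_along h x i c : is_derive (0 : R) 1 (fun s => h (x + s *: e i)) c ->
  derivable h x (e i) /\ partial i h x = c.
Proof.
have E : (fun t : R => t^-1 *: (((fun s => h (x + s *: e i)) \o shift (0 : R)) (t *: (1 : R))
      - h (x + 0 *: e i))) =
  (fun t : R => t^-1 *: ((h \o shift x) (t *: e i) - h x)).
  apply/funext => t /=; rewrite scale0r !addr0; congr (_ *: (h _ - _)).
  by rewrite [t *: 1]mulr1 addrC.
by move=> [dh <-]; split; rewrite /partial /derivable /derive -E.
Qed.

(** The Lipschitz bound and [lap_bound] involve the functions only through [M], so pointwise
    convergence of a bounded sequence is enough. *)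
Lemma wharm_limit (h_ : nat -> V -> R) h D x0 (r M : R) : 0 < r ->
  (forall y, `|y - x0| <= r -> D y) -> (forall n, wharm (h_ n) D) ->
  (forall n y, `|y - x0| <= r -> `|h_ n y| <= M) ->
  (forall y, `|y - x0| <= r -> h_ n y @[n --> \oo] --> h y) ->
  {for x0, continuous h} /\
  forall eps : R, 0 < eps -> exists2 del : R, 0 < del & forall s : R, 0 <= s < del ->
    `|lap s h x0| <= eps * s ^+ 2.
Proof.
move=> r0 rD hD hM hh.
have M0 : 0 <= M by apply: le_trans (normr_ge0 _) (hM 0%N x0 _); rewrite subrr normr0 ltW.
split.
  pose K := lipc R d * M / r.
  have K0 : 0 <= K by rewrite /K divr_ge0 ?mulr_ge0 ?lipc_ge0 // ltW.
  apply/continuous_atP => eps e0.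
  have K1 : 0 < K + 1 by rewrite ltr_wpDl.
  exists (Num.min (r / 2) (eps / (K + 1))); first by rewrite lt_min !divr_gt0.
  move=> y; rewrite lt_min => /andP[/ltW yr ye].
  have x0r : `|x0 - x0| <= r / 2 by rewrite subrr normr0 divr_ge0 // ltW.
  apply: (@le_lt_trans _ _ (K * `|y - x0|)).
    apply: (cvg_dist_le (hh y _) (hh x0 _)); try lra.
    by move=> n; exact: (wharm_lipschitz r0 rD (hD n) (hM n) x0r yr).
  rewrite ltr_pdivlMr // in ye; have := normr_ge0 (y - x0); nra.
move=> eps e0; pose K := lap_const R d * M / r ^+ 3.
have K0 : 0 <= K.
  have l0 : 0 <= lap_const R d by rewrite /lap_const mulr_ge0 ?mulr_ge0 ?exprn_ge0 ?lipc_ge0.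
  by rewrite /K divr_ge0 ?exprn_ge0 ?(ltW r0) // mulr_ge0.
have K1 : 0 < K + 1 by rewrite ltr_wpDl.
exists (Num.min (r / 64) (eps / (K + 1))); first by rewrite lt_min !divr_gt0.
move=> s /andP[s0]; rewrite lt_min => /andP[sr se].
apply: (@le_trans _ _ (K * s ^+ 3)).
  apply: (@cvg_norm_le (fun n => lap s (h_ n) x0)); last first.
    by move=> n; apply: (lap_bound r0 rD (hD n) (hM n)); rewrite s0 ltW.
  apply: cvg_big => [|i _]; first exact: add_continuous.
  have sr2 : s <= r by lra.
  apply: cvgB; last by apply: cvgM; [exact: cvg_cst|apply: hh; rewrite subrr normr0 ltW].
  by apply: cvgD; apply: hh; rewrite addrAC subrr add0r ?normrN norm_evecZ ger0_norm.
rewrite exprS mulrA ler_wpM2r ?sqr_ge0 //; rewrite ltr_pdivlMr // in se; nra.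
Qed.

(** Difference quotients of [u] are again [wharm], are bounded by the gradient estimate and converge
    to the partial derivative, so [wharm_limit] applies to them. *)
Lemma wharm_partial u D i : open D -> wharm u D ->
  (forall x, D x -> derivable u x (e i)) ->
  forall x0 (r M : R), 0 < r -> (forall y, `|y - x0| <= r -> D y) ->
  (forall y, `|y - x0| <= r -> `|u y| <= M) ->
  (forall y, `|y - x0| <= r / 4 -> `|partial i u y| <= lipc R d * M / r) /\
  wharm (partial i u) D.
Proof.
move=> /openP oD uD du.
have key x0 (r M : R) : 0 < r -> (forall y, `|y - x0| <= r -> D y) ->
  (forall y, `|y - x0| <= r -> `|u y| <= M) ->
  exists h_ : nat -> V -> R,
   [/\ forall n, wharm (h_ n) [set y | `|y - x0| <= r / 4],
    forall n y, `|y - x0| <= r / 4 -> `|h_ n y| <= lipc R d * M / r &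
    forall y, `|y - x0| <= r / 4 -> h_ n y @[n --> \oo] --> partial i u y].
  move=> r0 rD uM.
  pose s n : R := r / 4 * n.+1%:R^-1.
  have s0 n : 0 < s n by rewrite /s mulr_gt0 // divr_gt0.
  have sr n : s n <= r / 4.
    by rewrite /s ler_piMr ?divr_ge0 ?(ltW r0) // invf_le1 // ler1n.
  have sv n : `|s n *: e i| = s n by rewrite norm_evecZ gtr0_norm.
  exists (fun n y => (s n)^-1 * (u (y + s n *: e i) - u y)); split.
  - move=> n; have -> : (fun y => (s n)^-1 * (u (y + s n *: e i) - u y)) =
      (fun y => (s n)^-1 * (u (y + s n *: e i) - u y) + 0 * (u (y + s n *: e i) - u y)).
      by apply/funext => y; rewrite mul0r addr0.
    apply: (@wharmW _ _ _ (D `&` [set y | D (y + s n *: e i)])).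
      move=> y /= yr; split; apply: rD; first lra.
      by rewrite addrAC (le_trans (ler_normD _ _)) // sv; have := sr n; lra.
    by apply: wharm_comb; exact: wharm_diff.
  - move=> n y yr; rewrite normrM gtr0_norm ?invr_gt0 // mulrC ler_pdivrMr //.
    rewrite -[X in _ * X]sv; apply: (diff_bound r0 rD uD uM) => //.
    by rewrite sv.
  - move=> y yr; have Dy : D y by apply: rD; lra.
    have /is_derive_epsP H := derivable_along (du y Dy).
    apply/cvg_seqP => eps e0; have [|q q0 Hq] := H (eps / 2); first by rewrite divr_gt0.
    have [|N] := ltr_add_invr (y := 0) (x := q / (r / 4)).
      by rewrite divr_gt0 // divr_gt0.
    rewrite add0r ltr_pdivlMr ?divr_gt0 // mulrC => hN.
    exists N => n Nn; have sq : s n < q.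
      apply: le_lt_trans hN; rewrite /s ler_wpM2l ?divr_ge0 // ?(ltW r0) //.
      by rewrite lef_pV2 ?posrE // ler_nat.
    have := Hq (s n); rewrite gtr0_norm // add0r scale0r addr0 => /(_ sq) h.
    have -> : (s n)^-1 * (u (y + s n *: e i) - u y) - partial i u y =
      (u (y + s n *: e i) - u y - partial i u y * s n) / s n.
      by field; rewrite gt_eqF.
    rewrite normrM normfV (gtr0_norm (s0 n)) ltr_pdivrMr //.
    by apply: le_lt_trans h _; rewrite ltr_pM2r //; lra.
move=> x0 r M r0 rD uM; split.
  have [h_ [h1 h2 h3]] := key _ _ _ r0 rD uM.
  by move=> y yr; apply: (cvg_norm_le (h3 y yr)) => n; exact: h2.
(* [wharm] concerns every point of [D], so a new ball with a bound for [u] is taken around [x], from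
   continuity. *)
move=> x Dx; have [q q0 qD] := oD _ Dx.
have [/continuous_atP uc _] := uD _ Dx.
have [p p0 Hp] := uc _ ltr01.
pose t := Num.min q (p / 2).
have t0 : 0 < t by rewrite lt_min q0 divr_gt0.
have tD y : `|y - x| <= t -> D y by rewrite le_min => /andP[/qD].
have uB y : `|y - x| <= t -> `|u y| <= `|u x| + 1.
  rewrite le_min => /andP[_ yp].
  have := Hp y; have := ler_normD (u y - u x) (u x); rewrite subrK.
  have : `|y - x| < p by lra.
  by move=> h1 h2 /(_ h1); lra.
have [h_ [h1 h2 h3]] := key _ _ _ t0 tD uB.
have t40 : 0 < t / 4 by rewrite divr_gt0.
exact: (wharm_limit t40 _ h1 h2 h3).
Qed.

(** The common constant [L] gives a Taylor remainder [L * s ^+ 2] uniform in [n]. For a fixed small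
    [s] the difference quotients at [x] converge, which forces the derivatives at [x] to be Cauchy;
    their limit then satisfies the same Taylor estimate for [f]. *)
Lemma derivable_limit (f_ : nat -> V -> R) f x i (r L : R) : 0 < r ->
  (forall n y, `|y - x| <= r -> derivable (f_ n) y (e i)) ->
  (forall n y, `|y - x| <= r -> `|partial i (f_ n) y - partial i (f_ n) x| <= L * `|y - x|) ->
  (forall y, `|y - x| <= r -> f_ n y @[n --> \oo] --> f y) ->
  derivable f x (e i) /\ partial i (f_ n) x @[n --> \oo] --> partial i f x.
Proof.
move=> r0 df fL ff.
have xr : `|x - x| <= r by rewrite subrr normr0 ltW.
have L0 : 0 <= L.
  have := fL 0%N (x + r *: e i); rewrite addrAC subrr add0r norm_evecZ gtr0_norm //.
  move=> /(_ (lexx _)) /(le_trans (normr_ge0 _)); by rewrite pmulr_lge0.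
have taylor n (s : R) : `|s| <= r ->
    `|f_ n (x + s *: e i) - f_ n x - partial i (f_ n) x * s| <= L * s ^+ 2.
  move=> sr.
  pose g t := f_ n (x + (t * s) *: e i) - partial i (f_ n) x * (t * s).
  pose dg t := (partial i (f_ n) (x + (t * s) *: e i) - partial i (f_ n) x) * s.
  have -> : f_ n (x + s *: e i) - f_ n x - partial i (f_ n) x * s = g 1 - g 0.
    by rewrite /g mul0r mul1r scale0r addr0; ring.
  have -> : L * s ^+ 2 = L * s ^+ 2 * (1 - 0) by rewrite subr0 mulr1.
  have ts t : 0 <= t <= 1 -> `|t * s| <= r /\ `|t * s| <= `|s|.
    move=> /andP[t0 t1]; have : `|t * s| <= `|s|.
      by rewrite normrM ger0_norm // ler_piMl.
    by move=> h; split=> //; apply: le_trans h sr.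
  apply: (@MVT_le _ g dg) => // t t01; have [h1 h2] := ts _ t01.
    have d1 : is_derive (t * s) 1 (fun a => f_ n (x + a *: e i)) (partial i (f_ n) (x + (t * s) *: e i)).
      by apply: is_derive_along; apply: df; rewrite addrAC subrr add0r norm_evecZ.
    have d2 : is_derive t (1 : R) (fun t => t * s) s.
      by apply: is_derive_eq; rewrite /GRing.scale /=; ring.
    have d3 := @is_derive1_comp R (fun a => f_ n (x + a *: e i)) (fun t => t * s) t _ _ d1 d2.
    have d4 : is_derive t 1 (fun t => f_ n (x + (t * s) *: e i)) (partial i (f_ n) (x + (t * s) *: e i) * s) by exact: d3.
    by apply: is_derive_eq; rewrite /dg /GRing.scale /=; ring.
  rewrite /dg normrM; have := fL n (x + (t * s) *: e i).
  rewrite addrAC subrr add0r norm_evecZ => /(_ h1) h3.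
  have -> : s ^+ 2 = `|s| * `|s| by rewrite -normrM -expr2 ger0_norm ?sqr_ge0.
  rewrite mulrA ler_wpM2r // (le_trans h3) // ler_wpM2l //.
have cau : cauchy ((fun n => partial i (f_ n) x) @ \oo).
  apply: cauchy_exP => eps e0.
  (* Small enough that the remainder [L * s ^+ 2] is at most a quarter of [eps * s]. *)
  pose s := Num.min r (eps / (4 * (L + 1))).
  have L1 : 0 < 4 * (L + 1) by rewrite mulr_gt0 // ltr_wpDl.
  have s0 : 0 < s by rewrite lt_min r0 divr_gt0.
  have sr : s <= r by rewrite ge_min lexx.
  have se : s * (4 * (L + 1)) <= eps by rewrite -ler_pdivlMr // ge_min lexx orbT.
  have sn : `|s| = s by rewrite gtr0_norm.
  have xsr : `|x + s *: e i - x| <= r by rewrite addrAC subrr add0r norm_evecZ sn.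
  have [|N1 HN1] := (cvg_seqP _ _).1 (ff _ xsr) (s * eps / 8).
    by rewrite divr_gt0 // mulr_gt0.
  have [|N2 HN2] := (cvg_seqP _ _).1 (ff x xr) (s * eps / 8).
    by rewrite divr_gt0 // mulr_gt0.
  pose N := maxn N1 N2.
  have B n : (N <= n)%N -> `|f (x + s *: e i) - f x - partial i (f_ n) x * s| <= L * s ^+ 2 + s * eps / 4.
    rewrite geq_max => /andP[/HN1 h1 /HN2 h2].
    have := taylor n s; rewrite sn => /(_ sr) h3.
    have -> : f (x + s *: e i) - f x - partial i (f_ n) x * s =
      (f_ n (x + s *: e i) - f_ n x - partial i (f_ n) x * s) + (f_ n x - f x) -
      (f_ n (x + s *: e i) - f (x + s *: e i)) by ring.
    have := ler_normB (f_ n (x + s *: e i) - f_ n x - partial i (f_ n) x * s + (f_ n x - f x)) (f_ n (x + s *: e i) - f (x + s *: e i)).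
    have := ler_normD (f_ n (x + s *: e i) - f_ n x - partial i (f_ n) x * s) (f_ n x - f x).
    lra.
  exists (partial i (f_ N) x); exists N => // m /= Nm.
  rewrite /ball /= /ball_ /=.
  have h1 := B _ (leqnn N); have h2 := B _ Nm.
  have h3 := ler_normB (f (x + s *: e i) - f x - partial i (f_ m) x * s) (f (x + s *: e i) - f x - partial i (f_ N) x * s).
  have E : f (x + s *: e i) - f x - partial i (f_ m) x * s - (f (x + s *: e i) - f x - partial i (f_ N) x * s) = (partial i (f_ N) x - partial i (f_ m) x) * s by ring.
  rewrite E normrM sn in h3.
  rewrite -(ltr_pM2r s0).
  have : L * s ^+ 2 + s * eps / 4 <= s * eps / 2 - s ^+ 2 by nra.
  have : 0 < s ^+ 2 by rewrite exprn_gt0.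
  nra.
have /cauchy_cvgP /cvg_ex[G /= HG] := cau.
have [d1 d2] : derivable f x (e i) /\ partial i f x = G.
  apply: derivable_of_along; apply: (@is_derive_of_quadratic _ _ _ L r) => // t tr.
  rewrite add0r scale0r addr0.
  apply: (@cvg_norm_le (fun n => f_ n (x + t *: e i) - f_ n x - partial i (f_ n) x * t)).
    apply: cvgB; last by apply: cvgM => //; exact: cvg_cst.
    by apply: cvgB; apply: ff => //; rewrite addrAC subrr add0r norm_evecZ.
  by move=> n; apply: taylor.
by rewrite d2.
Qed.

Definition locally_bounded (f_ : nat -> V -> R) D := forall x, D x ->
  exists2 r : R, 0 < r & exists M : R, forall n y, `|y - x| <= r -> D y /\ `|f_ n y| <= M.

(** The conclusions supply the same hypotheses for the sequence of partial derivatives, so that the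
    lemma can be iterated to reach second derivatives. *)
Lemma limit_step (f_ : nat -> V -> R) f D i : open D ->
  (forall n, wharm (f_ n) D) -> locally_bounded f_ D ->
  (forall n x, D x -> derivable (f_ n) x (e i)) ->
  (forall x, D x -> f_ n x @[n --> \oo] --> f x) ->
  [/\ forall x, D x -> derivable f x (e i),
      forall x, D x -> partial i (f_ n) x @[n --> \oo] --> partial i f x,
      forall n, wharm (partial i (f_ n)) D & locally_bounded (fun n => partial i (f_ n)) D].
Proof.
move=> oD fD fB df ff.
have W n : wharm (partial i (f_ n)) D.
  move=> x Dx; have [r r0 [M HM]] := fB _ Dx.
  have [||_ W] := @wharm_partial (f_ n) D i oD (fD n) (df n) x r M r0; last exact: W.
    by move=> y /(HM 0%N)[].
  by move=> y /(HM n)[].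
have B : locally_bounded (fun n => partial i (f_ n)) D.
  move=> x Dx; have [r r0 [M HM]] := fB _ Dx.
  exists (r / 4); first by rewrite divr_gt0.
  exists (lipc R d * M / r) => n y yr.
  have [||H _] := @wharm_partial (f_ n) D i oD (fD n) (df n) x r M r0.
    by move=> z /(HM 0%N)[].
    by move=> z /(HM n)[].
  split; last exact: H.
  have [|//] := HM 0%N y; lra.
have K x : D x -> derivable f x (e i) /\ partial i (f_ n) x @[n --> \oo] --> partial i f x.
  move=> Dx; have [r r0 [M HM]] := B _ Dx.
  have r20 : 0 < r / 2 by rewrite divr_gt0.
  have rD y : `|y - x| <= r -> D y by move=> /(HM 0%N)[].
  apply: (@derivable_limit f_ f x i (r / 2) (lipc R d * M / r)) => //.
  - by move=> n y yr; apply: df; apply: rD; lra.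
  - move=> n y yr; apply: (wharm_lipschitz r0 rD (W n)) => //.
      by move=> z /(HM n)[].
    by rewrite subrr normr0 ltW.
  - by move=> y yr; apply: ff; apply: rD; lra.
by split => // x Dx; have [] := K x Dx.
Qed.

Lemma limit_continuous (f_ : nat -> V -> R) f D :
  (forall n, wharm (f_ n) D) -> locally_bounded f_ D ->
  (forall x, D x -> f_ n x @[n --> \oo] --> f x) ->
  forall x, D x -> {for x, continuous f}.
Proof.
move=> fD fB ff x Dx; have [r r0 [M HM]] := fB _ Dx.
have rD y : `|y - x| <= r -> D y by move=> /(HM 0%N)[].
have [] := @wharm_limit f_ f D x r M r0 rD fD; last by [].
  by move=> n y /(HM n)[].
by move=> y /rD; exact: ff.
Qed.

Lemma harmonic_limit (h_ : nat -> V -> R) h D : open D ->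
  (forall n, harmonic_on (h_ n) D) -> locally_bounded h_ D ->
  (forall x, D x -> h_ n x @[n --> \oo] --> h x) -> harmonic_on h D.
Proof.
move=> oD hD hB hh.
have W n : wharm (h_ n) D by exact: harmonic_wharm.
have S1 i := @limit_step h_ h D i oD W hB (fun n x Dx => let: And4 _ H _ _ := hD n x Dx in (H i).1) hh.
have S2 i j : [/\ forall x, D x -> derivable (partial i h) x (e j),
      forall x, D x -> partial j (partial i (h_ n)) x @[n --> \oo] --> partial j (partial i h) x,
      forall n, wharm (partial j (partial i (h_ n))) D & locally_bounded (fun n => partial j (partial i (h_ n))) D].
  have [a1 a2 a3 a4] := S1 i.
  apply: (@limit_step (fun n => partial i (h_ n)) (partial i h) D j oD a3 a4 _ a2).
  by move=> n x Dx; have [_ _ H _] := hD n x Dx; have [] := H i j.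
move=> x Dx; split.
- exact: (limit_continuous W hB hh).
- move=> i; have [a1 a2 a3 a4] := S1 i; split; first exact: a1.
  exact: (limit_continuous a3 a4 a2).
- move=> i j; have [a1 a2 a3 a4] := S2 i j; split; first exact: a1.
  exact: (limit_continuous a3 a4 a2).
- apply: (@cvg_unique _ _ ((fun n => \sum_(i < d) partial i (partial i (h_ n)) x) @ \oo)) => //.
    apply: cvg_big => [|i _]; first exact: add_continuous.
    by have [_ H _ _] := S2 i i; exact: H.
  have -> : (fun n => \sum_(i < d) partial i (partial i (h_ n)) x) = (fun=> 0).
    by apply/funext => n; have [_ _ _] := hD n x Dx.
  exact: cvg_cst.
Qed.

End Limits.

(** * Harnack's inequality *)

Section Harnack.
Variables (R : realType) (d : nat).
Hypothesis d0 : (0 < d)%N.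
Local Notation V := 'rV[R]_d.
Local Notation e i := (evec R i).
Implicit Types (i : 'I_d) (x y z v p : V) (h u w f : V -> R) (D C : set V).

(** The coefficient [m ^+ 2 / 4] does not exceed the true one, [m * (m + 1) / 2], which leaves room
    for an induction: each step multiplies by [1 - h + h ^+ 2 / 2], a lower bound of
    [(1 + h)^-1]. *)
Lemma invX_ge (m : nat) (h : R) : `|h| <= m.+2%:R^-1 ->
  1 - m%:R * h + m%:R ^+ 2 / 4 * h ^+ 2 <= (1 + h) ^- m.
Proof.
move=> hm.
have h2 : `|h| <= 1 / 2.
  by apply: le_trans hm _; rewrite mul1r lef_pV2 ?posrE // ler_nat.
have /andP[hl hu] : - (1 / 2) <= h <= 1 / 2 by rewrite -ler_norml.
have h1 : 0 < 1 + h by lra.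
have base : 1 - h + h ^+ 2 / 2 <= (1 + h)^-1.
  rewrite -[leRHS]mul1r ler_pdivlMr //.
  have -> : (1 - h + h ^+ 2 / 2) * (1 + h) = 1 - h ^+ 2 * (1 - h) / 2 by field.
  by rewrite gerBl divr_ge0 // mulr_ge0 ?sqr_ge0 //; lra.
have b0 : 0 <= 1 - h + h ^+ 2 / 2 by have := sqr_ge0 h; lra.
rewrite -exprVn; apply: (@le_trans _ _ ((1 - h + h ^+ 2 / 2) ^+ m)); last first.
  by apply: lerXn2r => //; rewrite nnegrE // invr_ge0 ltW.
elim: m hm => [|m IH] hm; first by rewrite expr0; lra.
have {}IH : 1 - m%:R * h + m%:R ^+ 2 / 4 * h ^+ 2 <= (1 - h + h ^+ 2 / 2) ^+ m.
  by apply: IH; apply: le_trans hm _; rewrite lef_pV2 ?posrE // ler_nat.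
rewrite [(1 - h + _) ^+ _]exprSr; apply: (@le_trans _ _ ((1 - m%:R * h + m%:R ^+ 2 / 4 * h ^+ 2) * (1 - h + h ^+ 2 / 2))); last by rewrite ler_wpM2r.
have m0 : 0 <= m%:R :> R by [].
have hm1 : `|h| * (m%:R + 2) <= 1.
  rewrite -ler_pdivlMr; last by lra.
  by rewrite mul1r (le_trans hm) // -natrD lef_pV2 ?posrE // ler_nat addn2.
have hh : h <= `|h| by exact: ler_norm.
have h20 : 0 <= h ^+ 2 by exact: sqr_ge0.
rewrite -[m.+1%:R]natr1.
set a := m%:R in m0 hm1 *.
rewrite -subr_ge0.
have -> : (1 - a * h + a ^+ 2 / 4 * h ^+ 2) * (1 - h + h ^+ 2 / 2) -
  (1 - (a + 1) * h + (a + 1) ^+ 2 / 4 * h ^+ 2) =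
  h ^+ 2 * (a / 2 + 1 / 4 - (a / 2 + a ^+ 2 / 4) * h + a ^+ 2 / 8 * h ^+ 2) by field.
apply: mulr_ge0 => //.
have : (a / 2 + a ^+ 2 / 4) * h <= a / 4.
  have -> : a / 2 + a ^+ 2 / 4 = a / 4 * (a + 2) by field.
  rewrite -mulrA ler_piMr ?divr_ge0 //; nra.
have : 0 <= a ^+ 2 / 8 * h ^+ 2 by rewrite mulr_ge0 // divr_ge0 ?sqr_ge0.
lra.
Qed.

Definition sqdist p x : R := \sum_(i < d) (x ord0 i - p ord0 i) ^+ 2.

Lemma sqdist_ge p x : `|x - p| ^+ 2 <= sqdist p x.
Proof.
have [->|] := eqVneq `|x - p| 0.
  by rewrite expr0n; apply: sumr_ge0 => i _; exact: sqr_ge0.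
move=> /mx_norm_neq0[[a j]]; rewrite ord1 /= => E.
have -> : `|x - p| ^+ 2 = (x ord0 j - p ord0 j) ^+ 2.
  rewrite [`|x - p|]E -normrX !mxE ger0_norm ?sqr_ge0 //.
rewrite /sqdist (bigD1 j) //= lerDl; apply: sumr_ge0 => i _; exact: sqr_ge0.
Qed.

Lemma sqdist_le p x (r : R) : `|x - p| <= r -> sqdist p x <= d%:R * r ^+ 2.
Proof.
move=> xr; rewrite -[d in leRHS]card_ord mulr_natl -sumr_const; apply: ler_sum => i _.
rewrite -[leLHS]ger0_norm ?sqr_ge0 // normrX ler_pXn2r ?nnegrE //.
  by have := coord_le_norm (x - p) i; rewrite !mxE => /le_trans; apply.
exact: le_trans xr.
Qed.

Lemma sqdistD p x i (s : R) :
  sqdist p (x + s *: e i) = sqdist p x + (s ^+ 2 + 2 * (x ord0 i - p ord0 i) * s).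
Proof.
rewrite /sqdist (bigD1 i) //= [in RHS](bigD1 i) //= !mxE /= !eqxx.
rewrite (eq_bigr (fun j => (x ord0 j - p ord0 j) ^+ 2)); first by rewrite /=; ring.
by move=> j ji; rewrite !mxE /= (negbTE ji) mulr0 addr0.
Qed.

Lemma continuous_sqdist p x : {for x, continuous (sqdist p)}.
Proof.
have -> : sqdist p = fun x => quad (fun=> 1) (fun j => - 2 * p ord0 j) x + \sum_(i < d) (p ord0 i) ^+ 2.
  apply/funext => y; rewrite /quad -big_split; apply: eq_bigr => i _ /=; ring.
apply: continuous_forD; [exact: continuous_quad|exact: cst_continuous].
Qed.

(** A quantitative form of the subharmonicity of [|x - p|^(-2m)] for [m > d]: [invX_ge] is applied
    to the relative change of [sqdist p] in each direction, and the terms of first order in [s]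
    cancel between opposite directions. *)
Lemma lap_sqdistXN p x (m : nat) : x != p ->
  exists2 del : R, 0 < del & forall s : R, 0 <= s < del ->
  sqdist p x ^- m.+1 * (2 * m%:R ^+ 2 - 2 * m%:R * d%:R) * s ^+ 2 <=
  lap s (fun y => sqdist p y ^- m) x.
Proof.
move=> xp; set q := sqdist p x.
have q0 : 0 < q.
  by apply: lt_le_trans (sqdist_ge p x); rewrite exprn_gt0 // normr_gt0 subr_eq0.
(* For [s <= 1] the change of [sqdist p] along an axis is at most [K * s]; the radius below keeps
   the relative change within the range [m.+2%:R^-1] of [invX_ge]. *)
pose K := 1 + 2 * `|x - p|.
have K0 : 0 < K by rewrite /K ltr_pwDl // mulr_ge0.
exists (Num.min 1 (q / K / m.+2%:R)); first by rewrite lt_min ltr01 !divr_gt0.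
move=> s /andP[s0]; rewrite lt_min => /andP[/ltW s1].
rewrite ltr_pdivlMr // ltr_pdivlMr // => /ltW sK.
pose hp i := (s ^+ 2 + 2 * (x ord0 i - p ord0 i) * s) / q.
pose hm i := (s ^+ 2 + 2 * (x ord0 i - p ord0 i) * - s) / q.
have hb i (t : R) : `|t| = s -> `|(s ^+ 2 + 2 * (x ord0 i - p ord0 i) * t) / q| <= m.+2%:R^-1.
  move=> ts; rewrite normrM normfV (gtr0_norm q0) ler_pdivrMr //.
  have mm : 0 < m.+2%:R :> R by [].
  rewrite -(ler_pM2r mm) [X in _ <= X]mulrAC mulVf ?gt_eqF // mul1r.
  apply: le_trans sK; rewrite [X in _ <= X]mulrAC ler_wpM2r //.
  rewrite (le_trans (ler_normD _ _)) // ger0_norm ?sqr_ge0 // !normrM ts ger0_norm //.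
  have := coord_le_norm (x - p) i; rewrite !mxE => h.
  rewrite /K mulrDr mulr1 lerD //; first by rewrite expr2 ler_piMr.
  by rewrite mulrC; rewrite ler_wpM2l // ler_wpM2l.
have E t i : sqdist p (x + t *: e i) = q * (1 + (t ^+ 2 + 2 * (x ord0 i - p ord0 i) * t) / q).
  by rewrite sqdistD -/q; field; rewrite gt_eqF.
have -> : lap s (fun y => sqdist p y ^- m) x = q ^- m * \sum_(i < d) ((1 + hp i) ^- m + (1 + hm i) ^- m - 2).
  rewrite /lap mulr_sumr; apply: eq_bigr => i _.
  rewrite -scaleNr !E -/q !exprMn !invfM sqrrN /hp /hm; ring.
have -> : q ^- m.+1 * (2 * m%:R ^+ 2 - 2 * m%:R * d%:R) * s ^+ 2 =
  q ^- m * \sum_(i < d) (- 2 * m%:R * s ^+ 2 / q + 2 * m%:R ^+ 2 * (x ord0 i - p ord0 i) ^+ 2 * s ^+ 2 / q ^+ 2).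
  rewrite big_split /= sumr_const card_ord -mulr_suml -mulr_suml -mulr_sumr -/(sqdist p x) -/q.
  rewrite exprS invfM -mulr_natr; field; rewrite gt_eqF // gt_eqF // exprn_gt0 //.
rewrite ler_wpM2l ?invr_ge0 ?exprn_ge0 ?(ltW q0) //; apply: ler_sum => i _.
have h1 := @invX_ge m (hp i) (hb i s (ger0_norm s0)).
have h2 := @invX_ge m (hm i) (hb i (- s) (eq_trans (normrN s) (ger0_norm s0))).
have -> : - 2 * m%:R * s ^+ 2 / q + 2 * m%:R ^+ 2 * (x ord0 i - p ord0 i) ^+ 2 * s ^+ 2 / q ^+ 2 =
   (1 - m%:R * hp i + m%:R ^+ 2 / 4 * hp i ^+ 2) + (1 - m%:R * hm i + m%:R ^+ 2 / 4 * hm i ^+ 2) - 2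
   - m%:R ^+ 2 / 2 * (s ^+ 2 / q) ^+ 2.
  by rewrite /hp /hm; field; rewrite gt_eqF.
have : 0 <= m%:R ^+ 2 / 2 * (s ^+ 2 / q) ^+ 2 by rewrite mulr_ge0 ?sqr_ge0 // divr_ge0 ?sqr_ge0.
lra.
Qed.

(** An exponent above [d] makes the barrier strictly subharmonic; this one gives
    [2 * m ^+ 2 - 2 * m * d = 4 * d ^+ 2]. *)
Let m := (2 * d)%N.

(** Small enough that the gradient bound [lipc * (4 ^+ m * A) / (del / 2)] lets [u] vary by at most
    [A / 2] over a distance [c * del]; the summand 4 gives [c <= 1 / 4], so that this ball lies
    where the gradient bound holds. *)
Let c : R := (4 * lipc R d * 4 ^+ m + 4)^-1.

Let c_gt0 : 0 < c.
Proof. by rewrite invr_gt0 ltr_wpDl // !mulr_ge0 ?exprn_ge0 ?lipc_ge0. Qed.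

Let cE : c * (4 * lipc R d * 4 ^+ m + 4) = 1.
Proof. by rewrite mulVf // gt_eqF // -invr_gt0. Qed.

Let c_le : c <= 1 / 4.
Proof.
have := cE; have : 0 <= c * (4 * lipc R d * 4 ^+ m).
  by rewrite mulr_ge0 ?(ltW c_gt0) // !mulr_ge0 ?exprn_ge0 ?lipc_ge0.
nra.
Qed.

(* If [u >= A / 2] on the ball of radius [c * del] around [p], comparison with a
   multiple of the barrier [|x - p|^(-2m)] bounds [u x0] from below. *)
Lemma growth u D x0 p (r del A : R) : 0 < r -> 0 < del -> 0 <= A -> del <= r ->
  (forall y, `|y - x0| <= (1 + 2 * d%:R) * r -> D y) -> wharm u D ->
  (forall y, D y -> 0 <= u y) -> `|p - x0| <= r ->
  (forall y, `|y - p| <= c * del -> A / 2 <= u y) ->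
  A / 4 * (c * del) ^+ (2 * m) / (d%:R * r ^+ 2) ^+ m <= u x0.
Proof.
move=> r0 del0 A0 delr rD uD u0 pr pA.
have d1 : 1 <= d%:R :> R by rewrite ler1n.
have cd0 : 0 < c * del by rewrite mulr_gt0.
have dr0 : 0 < d%:R * r ^+ 2 by rewrite mulr_gt0 ?exprn_gt0 // ltr0n.
pose B := A / 2 * (c * del) ^+ (2 * m).
have B0 : 0 <= B by rewrite mulr_ge0 ?divr_ge0 // exprn_ge0 // ltW.
have BE : A / 4 * (c * del) ^+ (2 * m) / (d%:R * r ^+ 2) ^+ m = B / (d%:R * r ^+ 2) ^+ m / 2.
  by rewrite /B; field; rewrite gt_eqF // exprn_gt0.
have [x0p|x0p] := leP `|x0 - p| (c * del).
  apply: le_trans (pA _ x0p); rewrite BE.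
  have : (c * del) ^+ (2 * m) / (d%:R * r ^+ 2) ^+ m <= 1.
    rewrite ler_pdivrMr ?exprn_gt0 // mul1r exprM lerXn2r ?nnegrE ?sqr_ge0 ?(ltW dr0) //.
    apply: (@le_trans _ _ (r ^+ 2)).
      rewrite ler_pXn2r ?nnegrE ?(ltW cd0) ?(ltW r0) //.
      by apply: le_trans delr; rewrite ler_piMl ?(ltW del0) //; apply: le_trans c_le _; lra.
    by rewrite ler_peMl // sqr_ge0.
  move=> h; rewrite /B -[A / 2 * _ / _]mulrA.
  have A2 : 0 <= A / 2 by rewrite divr_ge0.
  have : A / 2 * ((c * del) ^+ (2 * m) / (d%:R * r ^+ 2) ^+ m) <= A / 2 by rewrite ler_piMr.
  lra.
(* On the outer boundary [|y - x0| = (1 + 2 * d) * r] the distance to [p] is at least [2 * d * r],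
   whose square is [k]; subtracting [B * k ^- m] makes the barrier nonpositive there. *)
pose k := 4 * d%:R ^+ 2 * r ^+ 2.
have k0 : 0 < k by rewrite /k !mulr_gt0 ?exprn_gt0 // ltr0n.
pose rr := (1 + 2 * d%:R) * r.
pose C := [set y : V | `|y - x0| <= rr /\ c * del <= `|y - p|].
have qgt0 y : c * del <= `|y - p| -> 0 < sqdist p y.
  move=> yp; apply: lt_le_trans (sqdist_ge p y); rewrite exprn_gt0 //.
  exact: lt_le_trans yp.
have Cc : compact C.
  apply: bounded_closed_compact.
    exists (rr + `|x0|); split; first exact: num_real.
    move=> M rM y [/= yx _]; have := ler_normD (y - x0) x0; rewrite subrK; lra.
  have -> : C = [set y : V | `|y - x0| <= rr] `&` ~` [set y : V | `|y - p| < c * del].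
    apply/seteqP; split => y /=; rewrite -?leNgt; move=> [h1 h2]; split => //.
      by apply/negP; rewrite -leNgt.
    by rewrite leNgt; apply/negP.
  apply: closedI; first exact: normball_closed.
  apply: open_closedC; apply/openP => y /= yp.
  exists ((c * del - `|y - p|) / 2); first by rewrite divr_gt0 ?subr_gt0.
  move=> z zy; have := ler_normD (z - y) (y - p); rewrite addrA subrK; lra.
pose w y := B * (sqdist p y ^- m) - (B * k ^- m + u y).
suff : w x0 <= 0.
  rewrite /w subr_le0 BE => h.
  have qx0 : sqdist p x0 <= d%:R * r ^+ 2 by apply: sqdist_le; rewrite distrC.
  have h1 : (d%:R * r ^+ 2) ^- m <= sqdist p x0 ^- m.
    rewrite lef_pV2 ?posrE ?exprn_gt0 ?qgt0 ?(ltW x0p) //.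
    by rewrite lerXn2r ?nnegrE ?(ltW dr0) // ltW // qgt0 // ltW.
  (* As [k] is at least twice [d * r ^+ 2], the subtracted constant costs at most half of the lower
     bound at [x0]. *)
  have h2 : k ^- m <= (d%:R * r ^+ 2) ^- m / 2.
    rewrite -invfM lef_pV2 ?posrE ?exprn_gt0 ?mulr_gt0 ?exprn_gt0 ?ltr0n //.
    apply: (@le_trans _ _ ((2 * (d%:R * r ^+ 2)) ^+ m)).
      rewrite [(2 * _) ^+ m]exprMn [_ * 2]mulrC ler_wpM2r ?exprn_ge0 ?(ltW dr0) //.
      by rewrite -[X in X <= _]expr1 ler_eXn2l // ?ltr1n // /m muln_gt0.
    rewrite lerXn2r ?nnegrE ?(ltW k0) ?mulr_ge0 ?(ltW r0) //.
    rewrite /k mulrA ler_wpM2r ?sqr_ge0 //.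
    have : 0 <= d%:R * (d%:R - 1) :> R by rewrite mulr_ge0 ?subr_ge0.
    by rewrite expr2; lra.
  have h3 : B * (d%:R * r ^+ 2) ^- m <= B * sqdist p x0 ^- m by rewrite ler_wpM2l.
  have h4 : B * k ^- m <= B * ((d%:R * r ^+ 2) ^- m / 2) by rewrite ler_wpM2l.
  rewrite mulrA in h4; lra.
apply: (weak_max Cc).
- apply: within_continuous => y [yr yp]; apply: continuous_forB.
    apply: continuousM; first exact: cst_continuous.
    apply: continuousV; first by rewrite gt_eqF // exprn_gt0 // qgt0.
    by apply: (@continuous_comp _ _ _ (sqdist p) (fun t : R => t ^+ m)); [exact: continuous_sqdist|exact: exprn_continuous].
  apply: continuous_forD; first exact: cst_continuous.
  by have [] := uD _ (rD _ yr).
- move=> y [yr yp]; have qy := qgt0 _ yp.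
  have [ylt|yge] := ltP `|y - x0| rr; last first.
    left; rewrite /w subr_le0; apply: ler_wpDr; first exact: u0 (rD _ yr).
    rewrite ler_wpM2l // lef_pV2 ?posrE ?exprn_gt0 //.
    rewrite lerXn2r ?nnegrE ?(ltW k0) ?(ltW qy) //.
    apply: le_trans (sqdist_ge p y).
    have -> : k = (2 * d%:R * r) ^+ 2 by rewrite /k; ring.
    rewrite ler_pXn2r ?nnegrE ?mulr_ge0 ?(ltW r0) //.
    have := ler_normD (y - p) (p - x0); rewrite addrA subrK; rewrite /rr in yge; lra.
  have [ycd|ycd] := leP `|y - p| (c * del).
    left; rewrite /w subr_le0 addrC; apply: ler_wpDr.
      by rewrite mulr_ge0 // invr_ge0 exprn_ge0 // ltW.
    apply: le_trans (pA _ ycd).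
    rewrite ler_pdivrMr ?exprn_gt0 // /B ler_wpM2l ?divr_ge0 //.
    rewrite exprM lerXn2r ?nnegrE ?sqr_ge0 ?(ltW qy) //.
    apply: le_trans (sqdist_ge p y).
    by rewrite ler_pXn2r ?nnegrE ?(ltW cd0).
  have [Az|A1] := eqVneq A 0.
    left; rewrite /w /B Az !mul0r !add0r oppr_le0; exact: u0 (rD _ yr).
  right; split.
    exists (Num.min (rr - `|y - x0|) (`|y - p| - c * del)).
      by rewrite lt_min !subr_gt0 ylt.
    move=> z; rewrite le_min => /andP[z1 z2]; split.
      have := ler_normD (z - y) (y - x0); rewrite addrA subrK; lra.
    have := ler_normD (y - z) (z - p); rewrite addrA subrK [`|y - z|]distrC; lra.
  have B1 : 0 < B by rewrite mulr_gt0 ?exprn_gt0 // divr_gt0 // lt_neqAle eq_sym A1.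
  have ynp : y != p by rewrite -subr_eq0 -normr_gt0 (lt_le_trans cd0).
  have [del1 del10 H1] := lap_sqdistXN m ynp.
  pose E := B * (sqdist p y ^- m.+1 * (2 * m%:R ^+ 2 - 2 * m%:R * d%:R)).
  have E0 : 0 < E.
    rewrite mulr_gt0 // mulr_gt0 ?invr_gt0 ?exprn_gt0 //.
    have -> : 2 * m%:R ^+ 2 - 2 * m%:R * d%:R = 4 * d%:R ^+ 2 :> R by rewrite /m natrM; ring.
    by rewrite mulr_gt0 // exprn_gt0 // ltr0n.
  have [_ ul] := uD _ (rD _ yr).
  have [|del2 del20 H2] := ul (E / 2); first by rewrite divr_gt0.
  exists (Num.min del1 del2); first by rewrite lt_min del10.
  move=> s /andP[s0]; rewrite lt_min => /andP[sd1 sd2].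
  have -> : lap s w y = B * lap s (fun y => sqdist p y ^- m) y - lap s u y.
    rewrite /lap mulr_sumr -sumrB; apply: eq_bigr => i _; rewrite /w; ring.
  have := H1 s; have := H2 s; rewrite (ltW s0) sd1 sd2 => /(_ isT) h2 /(_ isT) h1.
  rewrite -(ler_pM2l B1) mulrA -/E in h1.
  have := ler_norm (lap s u y); have : 0 < E * s ^+ 2 by rewrite mulr_gt0 // exprn_gt0.
  lra.
- split; last exact: ltW.
  by rewrite subrr normr0 mulr_ge0 ?(ltW r0) // addr_ge0 // mulr_ge0.
Qed.

(** Obtained by eliminating [A] and [del] from [(r / 2) ^+ (2 * m) * u x <= A * del ^+ (2 * m)] and
    the conclusion of [growth]. *)
Definition harnackc : R := 4 * (2 / c) ^+ (2 * m) * d%:R ^+ m.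

Lemma harnackc_ge0 : 0 <= harnackc.
Proof. by rewrite /harnackc mulr_ge0 ?exprn_ge0 // mulr_ge0 // exprn_ge0 // divr_ge0 // ltW. Qed.

(* The point p maximizes (r - |x - x0|)^(2m) u(x): near p, u is then
   controlled by u(p), so the gradient estimate keeps u above u(p)/2 on a ball
   of radius comparable to the distance to the boundary. *)
Lemma local_harnack u D x0 (r : R) : 0 < r ->
  (forall y, `|y - x0| <= (1 + 2 * d%:R) * r -> D y) -> wharm u D ->
  (forall y, D y -> 0 <= u y) ->
  forall x, `|x - x0| <= r / 2 -> u x <= harnackc * u x0.
Proof.
move=> r0 rD uD u0 x xr.
have rD1 y : `|y - x0| <= r -> D y.
  move=> yr; apply: rD; apply: le_trans yr _; rewrite ler_peMl ?(ltW r0) //.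
  by rewrite lerDl mulr_ge0.
have x0r : `|x0 - x0| <= r by rewrite subrr normr0 ltW.
pose F y := (r - `|y - x0|) ^+ (2 * m) * u y.
have cont_dist : {within [set y | `|y - x0| <= r], continuous F}.
  apply: within_continuous => y yr.
  apply: continuousM; last by have [] := uD _ (rD1 _ yr).
  apply: (@continuous_comp _ _ _ (fun y : V => r - `|y - x0|) (fun t : R => t ^+ (2 * m))).
    apply/continuous_atP => eps eps0; exists eps => // z zy.
    have -> : r - `|z - x0| - (r - `|y - x0|) = `|y - x0| - `|z - x0| by ring.
    apply: le_lt_trans (ler_dist_dist _ _) _.
    by rewrite opprB addrA subrK distrC.
  exact: exprn_continuous.
have [|p] := EVT_max_rV _ (@normball_compact R d x0 r) cont_dist; first by exists x0.
rewrite inE /= => pr pmax.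
have {}pmax y : `|y - x0| <= r -> F y <= F p by move=> yr; apply: pmax; rewrite inE.
have ux0 : 0 <= u x0 by apply: u0; exact: rD1.
have xF : (r / 2) ^+ (2 * m) * u x <= F p.
  apply: (@le_trans _ _ (F x)); last by apply: pmax; lra.
  rewrite /F ler_wpM2r //; first by apply: u0; apply: rD1; lra.
  by rewrite lerXn2r ?nnegrE; lra.
have p2 : 0 < (r / 2) ^+ (2 * m) by rewrite exprn_gt0 // divr_gt0.
set del := r - `|p - x0|; pose A := u p.
have A0 : 0 <= A by apply: u0; exact: rD1.
(* If the maximum of [F] is attained on the boundary of the cube, it is 0, and [u x <= 0]. *)
have [del0|del0] := leP del 0.
  have {}del0 : del = 0 by apply/le_anti; rewrite del0 /del subr_ge0.
  have m0 : (2 * m == 0)%N = false by rewrite /m !muln_eq0 /= gtn_eqF.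
  have Fp : F p = 0 by rewrite /F -/del del0 expr0n m0 mul0r.
  rewrite Fp pmulr_rle0 // in xF.
  by apply: le_trans xF _; rewrite mulr_ge0 // harnackc_ge0.
have delr : del <= r by rewrite /del gerBl.
have near_p y : `|y - p| <= del / 2 -> `|y - x0| <= r.
  move=> yp; have := ler_normD (y - p) (p - x0); rewrite addrA subrK; rewrite /del in yp *; lra.
(* On this ball of half the radius the weight is at least [(del / 2) ^+ (2 * m)], so the maximality
   at [p] bounds [u] by [4 ^+ m * A]. *)
have upB y : `|y - p| <= del / 2 -> `|u y| <= 4 ^+ m * A.
  move=> yp; have yr := near_p _ yp; rewrite ger0_norm; last by apply: u0; exact: rD1.
  have := pmax _ yr; rewrite /F -/del -/A => h.
  have h2 : (del / 2) ^+ (2 * m) * u y <= del ^+ (2 * m) * A.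
    apply: le_trans h; rewrite ler_wpM2r //; first by apply: u0; exact: rD1.
    rewrite lerXn2r ?nnegrE //; first by rewrite divr_ge0 // ltW.
      by rewrite subr_ge0.
    have := ler_normD (y - p) (p - x0); rewrite addrA subrK; rewrite /del in yp *; lra.
  have E : (del / 2) ^+ (2 * m) * (4 ^+ m * A) = del ^+ (2 * m) * A.
    rewrite mulrA; congr (_ * _); rewrite [(del / 2) ^+ _]exprM [del ^+ _]exprM -exprMn; congr (_ ^+ m); by field.
  by rewrite -E ler_pM2l // exprn_gt0 // divr_gt0 in h2.
have pA y : `|y - p| <= c * del -> A / 2 <= u y.
  move=> yp; have del2 : 0 < del / 2 by rewrite divr_gt0.
  have := @wharm_lipschitz R d u D p (del / 2) (4 ^+ m * A) del2 _ uD upB p y.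
  have -> : `|y - p| <= del / 2 / 2.
    apply: le_trans yp _; have := c_le; rewrite -(ler_pM2r del0); lra.
  move=> /(_ _ _ isT) H.
  have {}H : `|u y - u p| <= lipc R d * (4 ^+ m * A) / (del / 2) * `|y - p|.
    by apply: H; [move=> z /near_p /rD1|rewrite subrr normr0 !divr_ge0 // ltW].
  have L0 := @lipc_ge0 R d.
  have : lipc R d * (4 ^+ m * A) / (del / 2) * `|y - p| <= A / 2.
    apply: (@le_trans _ _ (lipc R d * (4 ^+ m * A) / (del / 2) * (c * del))).
      by rewrite ler_wpM2l // divr_ge0 ?(ltW del2) // !mulr_ge0 // exprn_ge0.
    have -> : lipc R d * (4 ^+ m * A) / (del / 2) * (c * del) = A / 2 * (c * (4 * lipc R d * 4 ^+ m)).
      by field; rewrite gt_eqF.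
    rewrite ler_piMr ?divr_ge0 //; have := cE; have := c_gt0; lra.
  have := ler_norm (u p - u y); rewrite distrC -/A; lra.
have G := growth r0 del0 A0 delr rD uD u0 pr pA.
have dr0 : 0 < d%:R * r ^+ 2 by rewrite mulr_gt0 ?exprn_gt0 // ltr0n.
have Fp : F p = A * del ^+ (2 * m) by rewrite /F mulrC.
have h : F p * (c ^+ (2 * m) / 4 / (d%:R * r ^+ 2) ^+ m) <= u x0.
  apply: le_trans G; rewrite Fp [(c * del) ^+ _]exprMn.
  set a := c ^+ _; set b := del ^+ _; set g := (d%:R * r ^+ 2) ^+ m.
  have g0 : g != 0 by rewrite gt_eqF // exprn_gt0.
  by rewrite le_eqVlt; apply/orP; left; apply/eqP; field.
have k0 : 0 < c ^+ (2 * m) / 4 / (d%:R * r ^+ 2) ^+ m by rewrite !divr_gt0 ?exprn_gt0.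
rewrite -(ler_pM2r k0) in xF.
have {}xF := le_trans xF h.
have E : (r / 2) ^+ (2 * m) * u x * (c ^+ (2 * m) / 4 / (d%:R * r ^+ 2) ^+ m) * harnackc = u x.
  have E1 : (r / 2) ^+ (2 * m) = r ^+ (2 * m) / 2 ^+ (2 * m) by rewrite exprMn exprVn.
  have E2 : (2 / c) ^+ (2 * m) = 2 ^+ (2 * m) / c ^+ (2 * m) by rewrite exprMn exprVn.
  have E3 : (d%:R * r ^+ 2) ^+ m = d%:R ^+ m * r ^+ (2 * m) by rewrite exprMn -exprM.
  have n1 : r ^+ (2 * m) != 0 by rewrite gt_eqF // exprn_gt0.
  have n2 : 2 ^+ (2 * m) != 0 :> R by rewrite gt_eqF // exprn_gt0.
  have n3 : c ^+ (2 * m) != 0 by rewrite gt_eqF // exprn_gt0.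
  have n4 : d%:R ^+ m != 0 :> R by rewrite gt_eqF // exprn_gt0 // ltr0n.
  rewrite /harnackc E1 E2 E3; move: n1 n2 n3 n4.
  set a1 := r ^+ _; set a2 := 2 ^+ _; set a3 := c ^+ _; set a4 := d%:R ^+ _ => n1 n2 n3 n4.
  by field; rewrite n1 n2 n3 n4.
by rewrite -E mulrC ler_wpM2l // harnackc_ge0.
Qed.

(** The points of [D] where all nonnegative [wharm] functions are bounded by a common multiple of
    their value at [x0] form a set that is open and closed in [D]. The constant is uniform in [u]
    and near [x], so that it serves for infinitely many functions at once. *)
Theorem harnack D x0 : open D -> connected D -> D x0 -> forall x, D x ->
  exists r K : R, [/\ 0 < r, 0 <= K & forall y, `|y - x| <= r -> D y /\
    forall u, wharm u D -> (forall z, D z -> 0 <= u z) -> u y <= K * u x0].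
Proof.
move=> oD cD Dx0; have oD' := (openP _).1 oD.
have loc x : D x -> exists2 r : R, 0 < r & forall y z, `|y - x| <= r -> `|z - x| <= r ->
    [/\ D y, D z & forall u, wharm u D -> (forall z, D z -> 0 <= u z) -> u y <= harnackc * u z].
  move=> /oD'[r r0 rD].
  (* [local_harnack] centered at [z], with [|z - x| <= q / 4], needs the cube of radius
     [(1 + 2 * d) * q] around [z] to lie in [D]. *)
  pose q := r / (2 + 2 * d%:R).
  have d2 : 0 < 2 + 2 * d%:R :> R by rewrite ltr_wpDr // mulr_ge0.
  have q0 : 0 < q by rewrite divr_gt0.
  have qr : q * (2 + 2 * d%:R) = r by rewrite /q divfK // gt_eqF.
  have dq : 0 <= 2 * d%:R * q by rewrite !mulr_ge0 // ltW.
  exists (q / 4); first by rewrite divr_gt0.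
  move=> y z yq zq.
  split; [apply: rD; lra|apply: rD; lra|move=> u uD u0].
  apply: (@local_harnack u D z q q0 _ uD u0).
    move=> t tz; apply: rD; have := ler_normD (t - z) (z - x); rewrite addrA subrK; lra.
  have := ler_normB (y - x) (z - x); rewrite opprB addrA subrK; lra.
pose S := [set x | D x /\ exists2 K : R, 0 <= K &
   forall u, wharm u D -> (forall z, D z -> 0 <= u z) -> u x <= K * u x0].
have SD : S = D.
  apply: cD.
  - by exists x0; split => //; exists 1 => // u _ _; rewrite mul1r.
  - exists S; last by apply/seteqP; split => x; [move=> Sx; split => //; case: Sx|case].
    apply/openP => x [Dx [K K0 HK]]; have [r r0 Hr] := loc _ Dx.
    have xx : `|x - x| <= r by rewrite subrr normr0 ltW.
    exists r => // y yr; have [Dy _ Hy] := Hr _ _ yr xx.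
    split => //; exists (harnackc * K); first by rewrite mulr_ge0 // harnackc_ge0.
    move=> u uD u0; apply: le_trans (Hy u uD u0) _.
    by rewrite -mulrA ler_wpM2l ?harnackc_ge0 // HK.
  - exists (closure S); first exact: closed_closure.
    apply/seteqP; split=> [x Sx|x [Dx cS]]; first by split; [case: Sx|exact: subset_closure].
    have [r r0 Hr] := loc _ Dx.
    have [y [[Dy [K K0 HK]] yx]] : S `&` [set y | `|y - x| < r] !=set0.
      apply: cS; apply/(@nbhs_normP _ V); exists r => //= z; by rewrite /ball_ /= distrC.
    have xx : `|x - x| <= r by rewrite subrr normr0 ltW.
    split => //; exists (harnackc * K); first by rewrite mulr_ge0 // harnackc_ge0.
    have [_ _ Hy] := Hr _ _ xx (ltW yx).
    move=> u uD u0; apply: le_trans (Hy u uD u0) _.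
    by rewrite -mulrA ler_wpM2l ?harnackc_ge0 // HK.
move=> x Dx; have [r r0 Hr] := loc _ Dx.
have : S x by rewrite SD.
move=> [_ [K K0 HK]].
have xx : `|x - x| <= r by rewrite subrr normr0 ltW.
exists r, (harnackc * K); split => //; first by rewrite mulr_ge0 // harnackc_ge0.
move=> y yr; have [Dy _ Hy] := Hr _ _ yr xx; split => // u uD u0.
by apply: le_trans (Hy u uD u0) _; rewrite -mulrA ler_wpM2l ?harnackc_ge0 // HK.
Qed.

End Harnack.

(** * The minimum principle *)

Section Comparison.
Variables (R : realType) (d : nat).
Local Notation V := 'rV[R]_d.
Local Notation e i := (evec R i).
Implicit Types (i j : 'I_d) (a b x y z v p : V) (h u w f k : V -> R) (D C K : set V).

Lemma open_near D x : open D -> D x -> \forall y \near x, D y.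
Proof. by move=> oD Dx; exact: open_nbhs_nbhs (conj oD Dx). Qed.

Lemma near_ballP x (P : V -> Prop) : (\forall y \near x, P y) <->
  exists2 r : R, 0 < r & forall y, `|y - x| < r -> P y.
Proof.
split=> [/(@nbhs_normP _ V)[r /= r0 H]|[r r0 H]].
  by exists r => // y yx; apply: H; rewrite /ball_ /= distrC.
by apply/(@nbhs_normP _ V); exists r => //= y; rewrite /ball_ /= distrC => /H.
Qed.

Lemma continuous_eq_on f h D x : open D -> D x -> (forall y, D y -> f y = h y) ->
  {for x, continuous h} -> {for x, continuous f}.
Proof.
move=> /openP oD Dx fh /continuous_atP hc; apply/continuous_atP => eps /hc[q q0 Hq].
have [r r0 rD] := oD _ Dx.
exists (Num.min q r); first by rewrite lt_min q0.
move=> y; rewrite lt_min => /andP[yq /ltW yr].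
by rewrite !fh //; [apply: Hq|apply: rD].
Qed.

Lemma partial_eq_on f h D x i : open D -> D x -> (forall y, D y -> f y = h y) ->
  derivable h x (e i) -> derivable f x (e i) /\ partial i f x = partial i h x.
Proof.
move=> oD Dx fh dh.
have E : \forall y \near x, h y = f y.
  by near=> y; rewrite fh //; near: y; exact: open_near.
have := near_eq_is_derive E (derivableP dh) => -[df pf].
by split.
Unshelve. all: by end_near. Qed.

Lemma partial_comb (s t : R) h u x i : derivable h x (e i) -> derivable u x (e i) ->
  derivable (fun y => s * h y + t * u y) x (e i) /\
  partial i (fun y => s * h y + t * u y) x = s * partial i h x + t * partial i u x.
Proof.
move=> dh du; have H : is_derive x (e i) (s *: h + t *: u) (s *: 'D_(e i) h x + t *: 'D_(e i) u x).
  by apply: is_deriveD; apply: is_deriveZ; exact: derivableP.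
by have [h1 h2] := H; split.
Qed.

Lemma harmonic_comb (s t : R) h u D : open D -> harmonic_on h D -> harmonic_on u D ->
  harmonic_on (fun y => s * h y + t * u y) D.
Proof.
move=> oD hD uD.
have P1 i y : D y -> derivable (fun y => s * h y + t * u y) y (e i) /\
  partial i (fun y => s * h y + t * u y) y = s * partial i h y + t * partial i u y.
  move=> Dy; have [_ h1 _ _] := hD _ Dy; have [_ u1 _ _] := uD _ Dy.
  by apply: partial_comb; [have [] := h1 i|have [] := u1 i].
have P2 i j y : D y -> derivable (partial i (fun y => s * h y + t * u y)) y (e j) /\
  partial j (partial i (fun y => s * h y + t * u y)) y = s * partial j (partial i h) y + t * partial j (partial i u) y.
  move=> Dy; have [_ _ h2 _] := hD _ Dy; have [_ _ u2 _] := uD _ Dy.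
  have [d1 d2] := @partial_comb s t (partial i h) (partial i u) y j (h2 i j).1 (u2 i j).1.
  have [d3 d4] := @partial_eq_on (partial i (fun y => s * h y + t * u y)) _ D y j oD Dy (fun z Dz => (P1 i z Dz).2) d1.
  by split; rewrite // d4.
move=> x Dx; have [hc h1 h2 h0] := hD _ Dx; have [uc u1 u2 u0] := uD _ Dx.
have cc f g : {for x, continuous f} -> {for x, continuous g} -> {for x, continuous (fun y => s * f y + t * g y)}.
  by move=> cf cg; apply: continuousD; apply: continuousM => //; exact: cst_continuous.
split.
- exact: cc.
- move=> i; split; first by have [] := P1 i x Dx.
  apply: (continuous_eq_on oD Dx (fun z Dz => (P1 i z Dz).2)).
  by apply: cc; [have [] := h1 i|have [] := u1 i].
- move=> i j; split; first by have [] := P2 i j x Dx.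
  apply: (continuous_eq_on oD Dx (fun z Dz => (P2 i j z Dz).2)).
  by apply: cc; [have [] := h2 i j|have [] := u2 i j].
- have hp A B : A = 0 -> B = 0 -> s * A + t * B = 0 by move=> -> ->; rewrite !mulr0 addr0.
  apply: etrans (hp _ _ h0 u0).
  rewrite !mulr_sumr -big_split; apply: eq_bigr => i _ /=.
  by have [] := P2 i i x Dx.
Qed.

Lemma harmonic_affine (c : R) a D : harmonic_on (fun x => c + dotR a x) D.
Proof.
have P1 i x : derivable (fun x => c + dotR a x) x (e i) /\ partial i (fun x => c + dotR a x) x = a ord0 i.
  apply: derivable_of_along.
  have -> : (fun s : R => c + dotR a (x + s *: e i)) = (fun s : R => (c + dotR a x) + a ord0 i * s).
    apply/funext => s; rewrite -addrA; congr (_ + _); rewrite /dotR (bigD1 i) //= [in RHS](bigD1 i) //=.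
    rewrite !mxE /= eqxx mulr1 (eq_bigr (fun j => a ord0 j * x ord0 j)); first ring.
    by move=> j ji; rewrite !mxE /= (negbTE ji) mulr0 addr0.
  by apply: is_derive_eq; rewrite /GRing.scale /=; ring.
have E i : partial i (fun x => c + dotR a x) = (fun=> a ord0 i) by apply/funext => x; have [] := P1 i x.
have P0 j (t : R) x : partial j (fun=> t) x = 0 by rewrite /partial derive_cst.
move=> x Dx; split.
- apply: continuous_forD; first exact: cst_continuous.
  have -> : dotR a = quad (fun=> 0) (fun i => a ord0 i).
    by apply/funext => y; apply: eq_bigr => i _; rewrite mul0r add0r.
  exact: continuous_quad.
- by move=> i; split; [have [] := P1 i x|rewrite E; exact: cst_continuous].
- move=> i j; rewrite E; split; first exact: derivable_cst.
  have -> : partial j (fun=> a ord0 i) = (fun=> 0) by apply/funext => y.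
  exact: cst_continuous.
- by apply: big1 => i _; rewrite E.
Qed.

Lemma enorm_ge0 v : 0 <= enorm v. Proof. exact: sqrtr_ge0. Qed.

Lemma dotR_ge0 v : 0 <= dotR v v.
Proof. by apply: sumr_ge0 => i _; rewrite -expr2 sqr_ge0. Qed.

Lemma sqr_enorm v : enorm v ^+ 2 = dotR v v.
Proof. by rewrite sqr_sqrtr // dotR_ge0. Qed.

Lemma dotRB x a : dotR (x - a) (x - a) = sqdist a x.
Proof. by apply: eq_bigr => i _; rewrite !mxE -expr2. Qed.

Lemma norm_le_enorm v : `|v| <= enorm v.
Proof.
have := sqdist_ge 0 v; rewrite -dotRB !subr0 -sqr_enorm.
by rewrite ler_pXn2r ?nnegrE ?enorm_ge0.
Qed.

Lemma enorm_ltP v (r : R) : 0 <= r -> (enorm v < r) = (dotR v v < r ^+ 2).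
Proof. by move=> r0; rewrite -sqr_enorm ltr_pXn2r ?nnegrE ?enorm_ge0. Qed.

Lemma enorm_leP v (r : R) : 0 <= r -> (enorm v <= r) = (dotR v v <= r ^+ 2).
Proof. by move=> r0; rewrite -sqr_enorm ler_pXn2r ?nnegrE ?enorm_ge0. Qed.

Lemma open_eball a (r : R) : open (eball a r).
Proof.
have [r0|r0] := leP 0 r; last first.
  suff -> : eball a r = set0 by exact: open0.
  apply/seteqP; split => x //=; rewrite /eball /= ltNge.
  by have := enorm_ge0 (x - a) => h1 /negP[]; apply: le_trans (ltW r0) h1.
have -> : eball a r = sqdist a @^-1` [set t | t < r ^+ 2].
  by apply/seteqP; split => x /=; rewrite /eball /= enorm_ltP // dotRB.
by apply: open_comp; [move=> x _; exact: continuous_sqdist|exact: open_lt].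
Qed.

Lemma compact_ecball a (r : R) : compact (ecball a r).
Proof.
apply: bounded_closed_compact.
  exists (r + `|a|); split; first exact: num_real.
  move=> M rM y /=; rewrite /ecball /= => yr.
  have := ler_normD (y - a) a; rewrite subrK; have := norm_le_enorm (y - a); lra.
have [r0|r0] := leP 0 r; last first.
  suff -> : ecball a r = set0 by exact: closed0.
  apply/seteqP; split => x //=; rewrite /ecball /= leNgt.
  by have := enorm_ge0 (x - a) => h1 /negP[]; apply: lt_le_trans r0 h1.
have -> : ecball a r = sqdist a @^-1` [set t | t <= r ^+ 2].
  by apply/seteqP; split => x /=; rewrite /ecball /= enorm_leP // dotRB.
by apply: closed_comp; [move=> x _; exact: continuous_sqdist|exact: closed_le].
Qed.

Lemma lap_sqdist (s : R) a x : lap s (sqdist a) x = 2 * d%:R * s ^+ 2.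
Proof.
rewrite /lap (eq_bigr (fun=> 2 * s ^+ 2)); last first.
  by move=> i _; rewrite -scaleNr !sqdistD; ring.
rewrite sumr_const card_ord -mulr_natr; ring.
Qed.

(** Weak maximum principle for [g - h + eta * (|x - a|^2 - r^2)], with Euclidean norms: the
    quadratic term vanishes on the sphere and makes the second differences positive. *)
Lemma harmonic_superharmonic h D : (0 < d)%N -> open D -> harmonic_on h D ->
  superharmonic_on h D.
Proof.
move=> d0 oD hD; split.
  move=> x Dx c cx; have [/continuous_atP hc _ _ _] := hD _ Dx.
  have [|r r0 Hr] := hc (h x - c); first by rewrite subr_gt0.
  apply/near_ballP; exists r => // y /Hr; have := ler_norm (h x - h y); rewrite distrC; lra.
move=> a r r0 aD g gc gh gs y yr.
have hw := harmonic_wharm oD hD.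
have gw := harmonic_wharm (@open_eball a r) gh.
apply/ler_addgt0Pr => eps e0.
pose eta := eps / r ^+ 2.
have eta0 : 0 < eta by rewrite divr_gt0 // exprn_gt0.
have er : eta * r ^+ 2 = eps by rewrite /eta divfK // gt_eqF // exprn_gt0.
pose w x := g x - h x + eta * (sqdist a x - r ^+ 2).
suff : w y <= 0.
  have : 0 <= eta * sqdist a y by rewrite mulr_ge0 ?(ltW eta0) // -dotRB dotR_ge0.
  rewrite /w; lra.
apply: (@weak_max _ _ (ecball a r)); first exact: compact_ecball.
- change {within ecball a r, continuous ((g - h) + (fun x => eta * (sqdist a x - r ^+ 2)) : V -> R)}.
  move=> x; apply: continuousD; last first.
    apply: within_continuous => {}x _; apply: continuousM; first exact: cst_continuous.
    by apply: continuous_forB; [exact: continuous_sqdist|exact: cst_continuous].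
  apply: continuousB; first exact: gc.
  by apply: within_continuous => {}x /aD Dx; have [] := hD _ Dx.
- move=> x xr; have [xlt|xge] := ltP (enorm (x - a)) r; last first.
    have xer : enorm (x - a) = r by apply/le_anti; rewrite xge andbT.
    left; rewrite /w -dotRB -sqr_enorm xer subrr mulr0 addr0 subr_le0; exact: gs.
  right; split.
    have [q q0 Hq] := (openP _).1 (@open_eball a r) x xlt.
    by exists q => // z /Hq; rewrite /eball /ecball /= => /ltW.
  have [_ gl] := gw x xlt; have [_ hl] := hw x (aD _ xr).
  have [|p p0 Hp] := gl (eta * d%:R / 2); first by rewrite divr_gt0 // mulr_gt0 // ltr0n.
  have [|q q0 Hq] := hl (eta * d%:R / 2); first by rewrite divr_gt0 // mulr_gt0 // ltr0n.
  exists (Num.min p q); first by rewrite lt_min p0.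
  move=> s /andP[s0]; rewrite lt_min => /andP[sp sq].
  have -> : lap s w x = lap s g x - lap s h x + eta * lap s (sqdist a) x.
    rewrite /lap mulr_sumr -sumrB -big_split; apply: eq_bigr => i _ /=; rewrite /w; ring.
  rewrite lap_sqdist.
  have := Hp s; have := Hq s; rewrite (ltW s0) sp sq => /(_ isT) h1 /(_ isT) h2.
  have := ler_norm (- lap s g x); rewrite normrN; have := ler_norm (lap s h x).
  have dp : 0 < d%:R :> R by rewrite ltr0n.
  have : 0 < eta * d%:R * s ^+ 2 by apply: mulr_gt0; [exact: mulr_gt0|exact: exprn_gt0].
  lra.
- by rewrite /ecball /=; exact: ltW.
Qed.

Lemma seq_min (T : eqType) (v : T -> R) (s : seq T) : s != [::] ->
  exists2 x : T, x \in s & forall y : T, y \in s -> v x <= v y.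
Proof.
elim: s => // a s IH _; have [->|/IH[x xs xmin]] := eqVneq s [::].
  by exists a; rewrite ?inE // => y; rewrite !inE => /eqP ->.
have [ax|xa] := leP (v a) (v x).
  exists a; rewrite ?inE ?eqxx // => y; rewrite inE => /orP[/eqP -> //|/xmin].
  exact: le_trans.
exists x; first by rewrite inE xs orbT.
by move=> y; rewrite inE => /orP[/eqP ->|/xmin //]; exact: ltW.
Qed.

(** Otherwise the interiors of the sets [v x < v], for [x] in [K], would cover [K]; among the
    indices of a finite subcover, one with least value lies in none of the sets. *)
Lemma lsc_min K (v : V -> R) : compact K -> K !=set0 -> lsc_on v K ->
  exists2 a, K a & forall x, K x -> v a <= v x.
Proof.
move=> cK [x0 Kx0] vK; apply: contrapT => noa.
have H a : K a -> exists2 x, K x & v x < v a.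
  move=> Ka; apply: contrapT => nox; apply: noa; exists a => // x Kx.
  by rewrite leNgt; apply/negP => xa; apply: nox; exists x.
pose U x := (fun y => v x < v y) : set V.
move: cK; rewrite compact_cover => cK.
have [||F FK KF] := cK V K (fun x => (U x)°).
- by move=> x _; exact: open_interior.
- move=> a Ka; have [x Kx xa] := H _ Ka; exists x => //.
  exact: vK.
have : finmap.enum_fset F != [::].
  have [x xF _] := KF _ Kx0; apply/eqP => E.
  by have : x \in finmap.enum_fset F by []; rewrite E.
move=> /(seq_min v)[x xF xmin].
have Kx : K x by have := FK x xF; rewrite inE.
have [y yF /interior_subset] := KF _ Kx.
by rewrite /U ltNge xmin.
Qed.

(* At a point [a] of the set where the minimum [m] is attained, chosen farthest
   from the origin, the affine function [m + eta (<x - a, a> + r^2 / 4)] lies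
   below [w + s k] on a small sphere but exceeds [m] at [a]. *)
Lemma minimum_principle D w k (s : R) : open D ->
  (exists M : R, forall x, D x -> enorm x <= M) ->
  harmonic_on w D -> superharmonic_on k D -> 0 < s ->
  (forall y, bdry D y -> forall c : R, c < 0 ->
     \forall x \near within D (nbhs y), c < w x + s * k x) ->
  forall x, D x -> 0 <= w x + s * k x.
Proof.
move=> oD [M DM] wD [kl kD] s0 bd x1 Dx1.
pose v x := w x + s * k x; rewrite -/(v x1) leNgt; apply/negP => vx1.
have vl : lsc_on v D.
  move=> x Dx c cx; have [/continuous_atP wc _ _ _] := wD _ Dx.
  pose eps := (v x - c) / 2.
  have eps0 : 0 < eps by rewrite divr_gt0 // subr_gt0.
  have [p p0 Hp] := wc _ eps0.
  have /near_ballP[q q0 Hq] : \forall y \near x, k x - eps / s < k y.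
    by apply: kl => //; rewrite gtrBl divr_gt0.
  apply/near_ballP; exists (Num.min p q); first by rewrite lt_min p0.
  move=> y; rewrite lt_min => /andP[/Hp h1 /Hq h2].
  rewrite -(ltr_pM2l s0) mulrBr [s * (eps / s)]mulrC divfK ?gt_eqF // in h2.
  have := ler_norm (w x - w y); rewrite distrC /v; rewrite /eps /v in h1 h2 *; lra.
(* The boundary condition keeps limit points of a strictly negative sublevel set off the boundary,
   and lower semicontinuity keeps them in the set. *)
have subl c : c < 0 -> compact [set x | D x /\ v x <= c].
  move=> c0; apply: bounded_closed_compact.
    exists M; split; first exact: num_real.
    move=> B MB x [/DM xM _] /=; apply: le_trans (norm_le_enorm x) _; lra.
  move=> y cly; have clDy : closure D y by apply: closure_subset cly => x [].
  have [Dy|nDy] := pselect (D y).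
    split => //; rewrite leNgt; apply/negP => /(vl _ Dy) vy.
    have [z [[_ zc] cz]] := cly _ vy; lra.
  have by_ : bdry D y.
    by split => // /interior_subset.
  have [z [[Dz zc]]] := cly _ (bd y by_ c c0).
  by move=> /(_ Dz); rewrite -/(v z); lra.
have [m m0 [a0 [[Da0 va0] vmin]]] : exists2 m : R, m < 0 & exists a, (D a /\ v a = m) /\ forall x, D x -> m <= v x.
  have [||a [Da va] amin] := @lsc_min [set x | D x /\ v x <= v x1] v (subl _ vx1).
  - by exists x1.
  - by move=> x [Dx _]; exact: vl.
  exists (v a); first lra.
  exists a; split => // x Dx; have [xx1|xx1] := leP (v x) (v x1); first exact: amin.
  lra.
pose K := [set x | D x /\ v x <= m].
have [|a] := @EVT_max_rV R d (sqdist 0) K _ (subl _ m0) (within_continuous (fun x _ => @continuous_sqdist R d 0 x)).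
  by exists a0; split => //; rewrite va0.
rewrite inE => -[Da vam] amax.
have va : v a = m by apply/le_anti; rewrite vam vmin.
have [r r0 rD] := (openP _).1 oD _ Da.
have ballD : ecball a r `<=` D.
  by move=> x xr; apply: rD; apply: le_trans (norm_le_enorm _) xr.
(* The constant [r ^+ 2 / 4] is positive, so that [p a > 0], yet small enough for [vT]: on the
   sphere, [p x >= 0] gives [|x|^2 >= |a|^2 + r ^+ 2 / 2] for the Euclidean norm, against the choice
   of [a] as farthest point. *)
pose p x := dotR a (x - a) + r ^+ 2 / 4.
have pE x : p x = (r ^+ 2 / 4 - dotR a a) + dotR a x.
  rewrite /p addrC -addrA; congr (_ + _); rewrite addrC /dotR -sumrB; apply: eq_bigr => i _.
  by rewrite !mxE; ring.
have pc x : {for x, continuous p}.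
  have -> : p = fun x => (r ^+ 2 / 4 - dotR a a) + dotR a x by apply/funext.
  have [] := @harmonic_affine (r ^+ 2 / 4 - dotR a a) a setT x I; by [].
pose T := [set x | esphere a r x /\ 0 <= p x].
have TD : T `<=` D by move=> x [xr _]; apply: ballD; rewrite /ecball /= xr.
have vT x : T x -> m < v x.
  move=> Tx; rewrite lt_neqAle vmin ?andbT; last exact: TD.
  apply/eqP => vx; have Kx : x \in K by rewrite inE; split; [exact: TD|rewrite -vx].
  have [xr px] := Tx.
  have := amax _ Kx; have : sqdist a x = r ^+ 2 by rewrite -dotRB -sqr_enorm xr.
  have E : sqdist 0 x = sqdist 0 a + 2 * dotR a (x - a) + sqdist a x.
    rewrite /sqdist /dotR mulr_sumr -!big_split; apply: eq_bigr => i _ /=.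
    by rewrite !mxE; ring.
  rewrite E /p in px *; have : 0 < r ^+ 2 by rewrite exprn_gt0.
  lra.
have cT : compact T.
  have -> : T = ecball a r `&` (sqdist a @^-1` [set t | r ^+ 2 <= t] `&` p @^-1` [set t | 0 <= t]).
    apply/seteqP; split => x /=; rewrite /T /ecball /esphere /=.
      by move=> [xr px]; rewrite -dotRB -sqr_enorm xr.
    move=> [xr [rx px]]; split => //; apply/le_anti; rewrite xr /=.
    by rewrite -dotRB -sqr_enorm ler_pXn2r ?nnegrE ?enorm_ge0 ?(ltW r0) in rx.
  apply: compact_closedI; first exact: compact_ecball.
  apply: closedI; apply: closed_comp; try exact: closed_ge.
    by move=> x _; exact: continuous_sqdist.
  by move=> x _; exact: pc.
have [del del0 Hdel] : exists2 del : R, 0 < del & forall x, T x -> m + del <= v x.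
  have [[t Tt]|noT] := pselect (T !=set0); last first.
    by exists 1 => // x Tx; exfalso; apply: noT; exists x.
  have [||b Tb bmin] := @lsc_min T v cT; first by exists t.
    by move=> x /TD Dx; exact: vl.
  exists (v b - m); first by rewrite subr_gt0 vT.
  by move=> x /bmin; lra.
pose B := \sum_(i < d) `|a ord0 i| * r + r ^+ 2 / 4.
have B0 : 0 < B.
  rewrite ltr_wpDl ?divr_gt0 ?exprn_gt0 //; apply: sumr_ge0 => i _.
  by rewrite mulr_ge0 // ltW.
have pB x : esphere a r x -> p x <= B.
  move=> xr; rewrite /p lerD2r; apply: ler_sum => i _.
  apply: le_trans (ler_norm _) _; rewrite normrM ler_wpM2l //.
  by apply: le_trans (coord_le_norm _ _) _; apply: le_trans (norm_le_enorm _) _; rewrite xr.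
pose eta := del / B.
have eta0 : 0 < eta by rewrite divr_gt0.
pose aff x := (m + eta * (r ^+ 2 / 4 - dotR a a)) + dotR (eta *: a) x.
have affE x : aff x = m + eta * p x.
  rewrite /aff pE [eta * (_ + dotR a x)]mulrDr addrA; congr (_ + _); rewrite /dotR mulr_sumr.
  by apply: eq_bigr => i _; rewrite mxE mulrA.
(* Comparison is available for [k] only, so [w] is moved to the other side: [aff <= w + s * k]
   becomes [h <= k], with [h] harmonic. *)
pose h x := s^-1 * aff x + (- s^-1) * w x.
have hD : harmonic_on h D by exact: (harmonic_comb _ _ oD (@harmonic_affine (m + eta * (r ^+ 2 / 4 - dotR a a)) (eta *: a) D) wD).
have hvE x : h x <= k x <-> aff x <= v x.
  have -> : h x = (aff x - w x) / s by rewrite /h; ring.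
  by rewrite ler_pdivrMr // /v [k x * s]mulrC; split; lra.
have ra : eball a r a by rewrite /eball /= enorm_ltP ?(ltW r0) // dotRB /sqdist big1 ?exprn_gt0 // => i _; rewrite subrr expr0n.
have := kD a r r0 ballD h _ _ _ a ra.
have -> : (h a <= k a) = (aff a <= v a) by apply/idP/idP => /hvE.
rewrite va affE /p subrr.
have -> : dotR a (0 : V) = 0 by apply: big1 => i _; rewrite mxE mulr0.
rewrite add0r => H.
have : m + eta * (r ^+ 2 / 4) <= m.
  apply: H.
  - by apply: within_continuous => x /ballD Dx; have [] := hD _ Dx.
  - by move=> x xr; apply: hD; apply: ballD; exact: ltW.
  - move=> x xr; apply/hvE; rewrite affE.
    have Dx : D x by apply: ballD; rewrite /ecball /= xr.
    have [px|px] := leP 0 (p x).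
      apply: le_trans (Hdel x _) => //; rewrite lerD2l.
      have -> : del = eta * B by rewrite /eta divfK // gt_eqF.
      by rewrite ler_wpM2l ?(ltW eta0) // pB.
    apply: le_trans (vmin _ Dx); have : eta * p x <= 0 by rewrite pmulr_rle0 // ltW.
    lra.
have : 0 < eta * (r ^+ 2 / 4) by rewrite mulr_gt0 // divr_gt0 // exprn_gt0.
lra.
Qed.

End Comparison.

(** * Taylor expansion of harmonic functions *)

Section Taylor.
Variables (R : realType) (d : nat).
Local Notation V := 'rV[R]_d.
Local Notation e i := (evec R i).
Implicit Types (i j : 'I_d) (a b x y z v p : V) (h u w f F : V -> R) (D : set V).

Definition gradient u x : V := \row_i partial i u x.

(** After subtraction of the linear part the partial derivatives are at most [L * |v|] on the cube
    of radius [|v|], and [axis_lipschitz] applies. *)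
Lemma taylor1 F x (r L : R) : 0 <= L ->
  (forall i y, `|y - x| <= r -> derivable F y (e i)) ->
  (forall i y, `|y - x| <= r -> `|partial i F y - partial i F x| <= L * `|y - x|) ->
  forall v, `|v| <= r -> `|F (x + v) - F x - dotR (gradient F x) v| <= d%:R * L * `|v| ^+ 2.
Proof.
move=> L0 dF FL v vr.
pose G y := F y - dotR (gradient F x) y.
have dotD a y z : dotR a (y + z) = dotR a y + dotR a z.
  by rewrite /dotR -big_split; apply: eq_bigr => i _; rewrite mxE mulrDr.
have dotE i (t : R) : dotR (gradient F x) (t *: e i) = partial i F x * t.
  rewrite /dotR (bigD1 i) //= big1 ?addr0; first by rewrite !mxE /= eqxx mulr1.
  by move=> j ji; rewrite !mxE /= (negbTE ji) !mulr0.
have -> : F (x + v) - F x - dotR (gradient F x) v = G (x + v) - G x.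
  by rewrite /G dotD; ring.
have E : x + v - x = v by rewrite addrAC subrr add0r.
have -> : d%:R * L * `|v| ^+ 2 = d%:R * (L * `|v|) * `|x + v - x| by rewrite E; ring.
apply: (axis_lipschitz (x0 := x) (rho := `|v|)).
- by rewrite mulr_ge0.
- move=> i y c yv ycv.
  have seg t : 0 <= t <= 1 -> `|y + (t * c) *: e i - x| <= `|v|.
    move=> /andP[t0 t1].
    have -> : y + (t * c) *: e i - x = (1 - t) *: (y - x) + t *: (y + c *: e i - x).
      by apply/rowP => j; rewrite !mxE; ring.
    rewrite (le_trans (ler_normD _ _)) // !normrZ !ger0_norm ?subr_ge0 //.
    have := ler_wpM2l t0 ycv; have t1' : 0 <= 1 - t by rewrite subr_ge0.
    have := ler_wpM2l t1' yv; lra.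
  pose g t := F (y + (t * c) *: e i) - partial i F x * (t * c).
  pose dg t := (partial i F (y + (t * c) *: e i) - partial i F x) * c.
  have -> : G (y + c *: e i) - G y = g 1 - g 0.
    by rewrite /G /g dotD dotE mul0r mul1r scale0r addr0; ring.
  have -> : L * `|v| * `|c| = L * `|v| * `|c| * (1 - 0) by rewrite subr0 mulr1.
  apply: (@MVT_le _ g dg) => // t t01; have h1 := seg _ t01.
    have d1 : is_derive (t * c) 1 (fun s => F (y + s *: e i)) (partial i F (y + (t * c) *: e i)).
      by apply: is_derive_along; apply: dF; exact: le_trans h1 vr.
    have d2 : is_derive t (1 : R) (fun t => t * c) c.
      by apply: is_derive_eq; rewrite /GRing.scale /=; ring.
    have d3 := @is_derive1_comp R (fun s => F (y + s *: e i)) (fun t => t * c) t _ _ d1 d2.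
    have d4 : is_derive t 1 (fun t => F (y + (t * c) *: e i)) (partial i F (y + (t * c) *: e i) * c) by exact: d3.
    by apply: is_derive_eq; rewrite /dg /GRing.scale /=; ring.
  rewrite /dg normrM ler_wpM2r //; apply: le_trans (FL _ _ (le_trans h1 vr)) _.
  by rewrite ler_wpM2l.
- by rewrite subrr normr0.
- by rewrite E.
Qed.

Lemma directional_derive F x v (t r L : R) : 0 <= L -> 0 < r ->
  (forall i y, `|y - (x + t *: v)| <= r -> derivable F y (e i)) ->
  (forall i y, `|y - (x + t *: v)| <= r ->
    `|partial i F y - partial i F (x + t *: v)| <= L * `|y - (x + t *: v)|) ->
  is_derive t 1 (fun s => F (x + s *: v)) (dotR (gradient F (x + t *: v)) v).
Proof.
move=> L0 r0 dF FL.
have v1 : 0 < `|v| + 1 by rewrite ltr_wpDl.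
apply: (@is_derive_of_quadratic _ _ _ _ (d%:R * L * `|v| ^+ 2) (r / (`|v| + 1))).
  by rewrite divr_gt0.
move=> s; rewrite ler_pdivlMr // => sr.
have svr : `|s *: v| <= r.
  by rewrite normrZ; apply: le_trans sr; rewrite ler_wpM2l // lerDl.
have := taylor1 L0 dF FL svr.
have -> : x + t *: v + s *: v = x + (t + s) *: v by rewrite scalerDl addrA.
have -> : dotR (gradient F (x + t *: v)) (s *: v) = dotR (gradient F (x + t *: v)) v * s.
  by rewrite /dotR mulr_suml; apply: eq_bigr => i _; rewrite !mxE; ring.
suff -> : d%:R * L * `|s *: v| ^+ 2 = d%:R * L * `|v| ^+ 2 * s ^+ 2 by [].
by rewrite normrZ exprMn -[s ^+ 2]ger0_norm ?sqr_ge0 // normrX; ring.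
Qed.

Lemma is_derive_sub_linear (g : R -> R) (t c p : R) : is_derive t 1 g c ->
  is_derive t 1 (fun s => g s - p * s) (c - p).
Proof. by move=> dg; apply: is_derive_eq; rewrite /GRing.scale /=; ring. Qed.

Lemma is_derive_sub_square (g : R -> R) (t c p : R) : is_derive t 1 g c ->
  is_derive t 1 (fun s => g s - p / 2 * s ^+ 2) (c - p * t).
Proof. by move=> dg; apply: is_derive_eq; rewrite /GRing.scale /=; field. Qed.

Definition hessian_form u x v : R :=
  \sum_(i < d) \sum_(j < d) partial j (partial i u) x * (v ord0 i * v ord0 j).

(** Along the segment from [x] to [x + v] the second derivative varies by at most
    [d ^+ 2 * L2 * |v| ^+ 3]; two mean value inequalities carry this bound over to the remainder. *)
Lemma taylor2 u D x (r L1 L2 : R) : open D -> harmonic_on u D -> 0 < r -> 0 <= L1 -> 0 <= L2 ->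
  (forall y, `|y - x| <= r -> D y) ->
  (forall i y z, `|y - x| <= r -> `|z - x| <= r ->
     `|partial i u y - partial i u z| <= L1 * `|y - z|) ->
  (forall i j y z, `|y - x| <= r -> `|z - x| <= r ->
     `|partial j (partial i u) y - partial j (partial i u) z| <= L2 * `|y - z|) ->
  forall v, `|v| <= r / 2 ->
  `|u (x + v) - u x - dotR (gradient u x) v - hessian_form u x v / 2| <= d%:R ^+ 2 * L2 * `|v| ^+ 3.
Proof.
move=> oD hu r0 L10 L20 rD uL1 uL2 v vr.
have r20 : 0 < r / 2 by rewrite divr_gt0.
have seg (t : R) : 0 <= t <= 1 -> `|x + t *: v - x| <= t * `|v| /\ `|x + t *: v - x| <= r / 2.
  move=> /andP[t0 t1]; rewrite addrAC subrr add0r normrZ ger0_norm //; split => //.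
  by apply: le_trans vr; rewrite ler_piMl.
have ball2 (t : R) y : 0 <= t <= 1 -> `|y - (x + t *: v)| <= r / 2 -> `|y - x| <= r.
  move=> /seg[_ h] yr; have := ler_normD (y - (x + t *: v)) (x + t *: v - x).
  rewrite addrA subrK; lra.
have xx (t : R) : 0 <= t <= 1 -> `|x + t *: v - x| <= r by move=> /seg[_]; lra.
pose g t := u (x + t *: v).
pose dg t := dotR (gradient u (x + t *: v)) v.
pose ddg t := hessian_form u (x + t *: v) v.
have d1 (t : R) : 0 <= t <= 1 -> is_derive t 1 g (dg t).
  move=> t01; apply: (directional_derive L10 r20).
    move=> i y yr; have [_ H _ _] := hu _ (rD _ (ball2 _ _ t01 yr)); by have [] := H i.
  by move=> i y yr; apply: uL1; [exact: ball2 yr|exact: xx].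
have d2 (t : R) : 0 <= t <= 1 -> is_derive t 1 dg (ddg t).
  move=> t01.
  have di i : is_derive t 1 (fun s => partial i u (x + s *: v)) (dotR (gradient (partial i u) (x + t *: v)) v).
    apply: (directional_derive L20 r20).
      move=> j y yr; have [_ _ H _] := hu _ (rD _ (ball2 _ _ t01 yr)); by have [] := H i j.
    by move=> j y yr; apply: uL2; [exact: ball2 yr|exact: xx].
  have di2 i : is_derive t 1 (fun s => partial i u (x + s *: v) * v ord0 i) (dotR (gradient (partial i u) (x + t *: v)) v * v ord0 i).
    by apply: is_derive_eq; rewrite /GRing.scale /=; ring.
  have -> : dg = \sum_(i < d) (fun s => partial i u (x + s *: v) * v ord0 i).
    by apply/funext => s; rewrite fct_sumE; apply: eq_bigr => i _; rewrite mxE.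
  have -> : ddg t = \sum_(i < d) (dotR (gradient (partial i u) (x + t *: v)) v * v ord0 i).
    apply: eq_bigr => i _; rewrite mulr_suml; apply: eq_bigr => j _; rewrite mxE; ring.
  exact: is_derive_sum.
have ddgL (t : R) : 0 <= t <= 1 -> `|ddg t - ddg 0| <= d%:R ^+ 2 * L2 * `|v| ^+ 3.
  move=> t01; have [h1 h2] := seg _ t01; have := t01 => /andP[t0 t1].
  have h3 : `|x + t *: v - x| <= `|v| by apply: le_trans h1 _; rewrite ler_piMl.
  rewrite /ddg /hessian_form scale0r addr0 -sumrB (le_trans (ler_norm_sum _ _ _)) //.
  have -> : d%:R ^+ 2 * L2 * `|v| ^+ 3 = \sum_(i < d) \sum_(j < d) (L2 * `|v|) * (`|v| * `|v|).
    by rewrite !sumr_const !card_ord -mulrnA -[RHS]mulr_natr natrM; ring.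
  apply: ler_sum => i _; rewrite -sumrB (le_trans (ler_norm_sum _ _ _)) //.
  apply: ler_sum => j _; rewrite -mulrBl normrM; apply: ler_pM => //.
    apply: le_trans (uL2 _ _ _ _ (xx _ t01) _) _; last by rewrite ler_wpM2l.
    by rewrite subrr normr0 ltW.
  by rewrite normrM ler_pM // coord_le_norm.
set B := d%:R ^+ 2 * L2 * `|v| ^+ 3 in ddgL *.
have dgL (t : R) : 0 <= t <= 1 -> `|dg t - dg 0 - ddg 0 * t| <= B.
  move=> t01; have := t01 => /andP[t0 t1].
  have B0 : 0 <= B by apply: le_trans (normr_ge0 _) (ddgL t t01).
  have : `|(dg t - ddg 0 * t) - (dg 0 - ddg 0 * 0)| <= B * (t - 0).
    apply: (@MVT_le _ (fun s => dg s - ddg 0 * s) (fun s => ddg s - ddg 0)) => //.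
      move=> s /andP[s0 st]; have s01 : 0 <= s <= 1 by rewrite s0 (le_trans st).
      exact: is_derive_sub_linear (d2 s s01).
    by move=> s /andP[s0 st]; apply: ddgL; rewrite s0 (le_trans st).
  rewrite mulr0 subr0 subr0 => h; have -> : dg t - dg 0 - ddg 0 * t = dg t - ddg 0 * t - dg 0 by ring.
  by apply: le_trans h _; rewrite ler_piMr.
have : `|(g 1 - dg 0 * 1 - ddg 0 / 2 * 1 ^+ 2) - (g 0 - dg 0 * 0 - ddg 0 / 2 * 0 ^+ 2)| <= B * (1 - 0).
  apply: (@MVT_le _ (fun s => g s - dg 0 * s - ddg 0 / 2 * s ^+ 2) (fun s => dg s - dg 0 - ddg 0 * s)) => //.
  by move=> s s01; exact: is_derive_sub_square (is_derive_sub_linear (dg 0) (d1 s s01)).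
have -> : (g 1 - dg 0 * 1 - ddg 0 / 2 * 1 ^+ 2) - (g 0 - dg 0 * 0 - ddg 0 / 2 * 0 ^+ 2) = 
  u (x + v) - u x - dotR (gradient u x) v - hessian_form u x v / 2.
  by rewrite /g /dg /ddg scale1r scale0r addr0; ring.
by rewrite subr0 mulr1.
Qed.

(** Three gradient estimates on shrinking cubes. The constant is chosen before [x], since the
    expansion is later used at a random point [X s w]. *)
Lemma harmonic_taylor u D (r M : R) : open D -> harmonic_on u D -> 0 < r -> 0 <= M ->
  exists2 B : R, 0 <= B & forall x, (forall y, `|y - x| <= r -> D y) ->
    (forall y, `|y - x| <= r -> `|u y| <= M) ->
    [/\ forall i, `|partial i u x| <= B, forall i j, `|partial j (partial i u) x| <= B &
      forall v, `|v| <= r / 64 ->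
      `|u (x + v) - u x - dotR (gradient u x) v - hessian_form u x v / 2| <= B * `|v| ^+ 3].
Proof.
move=> oD hu r0 M0.
have L0 := @lipc_ge0 R d.
pose M1 := lipc R d * M / r.
pose M2 := lipc R d * M1 / (r / 4).
pose L2 := lipc R d * M2 / (r / 16).
have r40 : 0 < r / 4 by rewrite divr_gt0.
have r160 : 0 < r / 16 by rewrite divr_gt0.
have M10 : 0 <= M1 by rewrite divr_ge0 ?(ltW r0) // mulr_ge0.
have M20 : 0 <= M2 by rewrite divr_ge0 ?(ltW r40) // mulr_ge0.
have L20 : 0 <= L2 by rewrite divr_ge0 ?(ltW r160) // mulr_ge0.
exists (M1 + M2 + d%:R ^+ 2 * L2); first by rewrite !addr_ge0 // mulr_ge0 // sqr_ge0.
have B3 : 0 <= d%:R ^+ 2 * L2 by rewrite mulr_ge0 ?sqr_ge0.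
move=> x rD uM.
have uw := harmonic_wharm oD hu.
have du i y : D y -> derivable u y (e i) by move=> /hu[_ H _ _]; have [] := H i.
have ddu i j y : D y -> derivable (partial i u) y (e j) by move=> /hu[_ _ H _]; have [] := H i j.
have H1 i := @wharm_partial R d u D i oD uw (du i) x r M r0 rD uM.
have rD4 y : `|y - x| <= r / 4 -> D y by move=> yr; apply: rD; lra.
have H2 i j := @wharm_partial R d (partial i u) D j oD (H1 i).2 (ddu i j) x (r / 4) M1 r40 rD4 (H1 i).1.
have E16 : r / 4 / 4 = r / 16 by field.
have rD16 y : `|y - x| <= r / 16 -> D y by move=> yr; apply: rD; lra.
have uM2 i j y : `|y - x| <= r / 16 -> `|partial j (partial i u) y| <= M2.
  by move=> yr; apply: (H2 i j).1; rewrite E16.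
have Lip1 i y z : `|y - x| <= r / 32 -> `|z - x| <= r / 32 ->
     `|partial i u y - partial i u z| <= M2 * `|y - z|.
  move=> yr zr; apply: (wharm_lipschitz r40 rD4 (H1 i).2 (H1 i).1); lra.
have Lip2 i j y z : `|y - x| <= r / 32 -> `|z - x| <= r / 32 ->
     `|partial j (partial i u) y - partial j (partial i u) z| <= L2 * `|y - z|.
  move=> yr zr; apply: (wharm_lipschitz r160 rD16 (H2 i j).2 (uM2 i j)); lra.
have x4 : `|x - x| <= r / 4 by rewrite subrr normr0 ltW.
have x16 : `|x - x| <= r / 16 by rewrite subrr normr0 ltW.
split.
- by move=> i; have : `|partial i u x| <= M1 := (H1 i).1 x x4; lra.
- by move=> i j; have := uM2 i j x x16; lra.
- move=> v vr.
  have r320 : 0 < r / 32 by rewrite divr_gt0.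
  have rD32 y : `|y - x| <= r / 32 -> D y by move=> yr; apply: rD; lra.
  have vr2 : `|v| <= r / 32 / 2 by lra.
  apply: le_trans (taylor2 oD hu r320 M20 L20 rD32 Lip1 Lip2 vr2) _.
  by rewrite ler_wpM2r ?exprn_ge0 // lerDr addr_ge0.
Qed.

End Taylor.

(** * Moments from the characteristic function *)

Section RealIntegral.
Context (R : realType) (dO : measure_display) (Omega : measurableType dO).
Variable P : probability Omega R.
Implicit Types (A B : set Omega) (f g : Omega -> R).

Definition Rintegrable A f := P.-integrable A (EFin \o f).

Lemma EFin_Rintegral A f : measurable A -> Rintegrable A f ->
  (\int[P]_(w in A) f w)%:E = (\int[P]_(w in A) (f w)%:E)%E.
Proof. by move=> mA fA; rewrite /Rintegral fineK //; exact: integrable_fin_num. Qed.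

Lemma Rintegrable_bounded A f (M : R) : measurable A -> measurable_fun A f ->
  (forall w, A w -> `|f w| <= M) -> Rintegrable A f.
Proof.
move=> mA mf fM; apply: measurable_bounded_integrable => //.
  by rewrite (le_lt_trans (probability_le1 P mA)) // ltry.
exists M; split; first exact: num_real.
by move=> x Mx w Aw /=; apply: le_trans (fM w Aw) (ltW Mx).
Qed.

Lemma Rintegrable_le A f g : measurable A -> measurable_fun A f ->
  (forall w, A w -> `|f w| <= g w) -> Rintegrable A g -> Rintegrable A f.
Proof.
move=> mA mf fg gA; apply: le_integrable gA => //; first exact/measurable_EFinP.
by move=> w Aw /=; rewrite lee_fin; apply: le_trans (fg w Aw) (ler_norm _).
Qed.

Lemma RintegrableD A f g : measurable A -> Rintegrable A f -> Rintegrable A g ->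
  Rintegrable A (fun w => f w + g w).
Proof. by move=> mA fA gA; exact: (integrableD mA fA gA). Qed.

Lemma RintegrableB A f g : measurable A -> Rintegrable A f -> Rintegrable A g ->
  Rintegrable A (fun w => f w - g w).
Proof. by move=> mA fA gA; exact: (integrableB mA fA gA). Qed.

Lemma RintegrableZ A f (c : R) : measurable A -> Rintegrable A f ->
  Rintegrable A (fun w => c * f w).
Proof. by move=> mA fA; exact: (integrableZl mA c fA). Qed.

Lemma Rintegrable_measurable A f : Rintegrable A f -> measurable_fun A f.
Proof. by move=> /integrableP[/measurable_EFinP]. Qed.

Lemma Rintegrable_sum A (I : Type) (s : seq I) (f : I -> Omega -> R) : measurable A ->
  (forall i, Rintegrable A (f i)) -> Rintegrable A (fun w => \sum_(i <- s) f i w).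
Proof.
move=> mA fA; elim: s => [|i s IH].
  apply: (@Rintegrable_bounded _ _ 0) => //.
    by under eq_fun do rewrite big_nil; exact: measurable_cst.
  by move=> w _; rewrite big_nil normr0.
rewrite (_ : (fun w => _) = (fun w => f i w + \sum_(j <- s) f j w)).
  exact: RintegrableD.
by apply/funext => w; rewrite big_cons.
Qed.

Lemma Rintegral_sum A (I : Type) (s : seq I) (f : I -> Omega -> R) : measurable A ->
  (forall i, Rintegrable A (f i)) ->
  \int[P]_(w in A) (\sum_(i <- s) f i w) = \sum_(i <- s) \int[P]_(w in A) f i w.
Proof.
move=> mA fA; elim: s => [|i s IH].
  rewrite big_nil; under eq_Rintegral do rewrite big_nil.
  by rewrite Rintegral_cst // mul0r.
rewrite big_cons -IH -RintegralD //; [|exact: fA|exact: Rintegrable_sum].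
by apply: eq_Rintegral => w _; rewrite big_cons.
Qed.

Lemma Rfatou A (f_ : nat -> Omega -> R) f (c : R) : measurable A ->
  (forall n, Rintegrable A (f_ n)) -> (forall n w, 0 <= f_ n w) ->
  (forall w, f_ n w @[n --> \oo] --> f w) ->
  (forall n, \int[P]_(w in A) f_ n w <= c) ->
  Rintegrable A f /\ \int[P]_(w in A) f w <= c.
Proof.
move=> mA fI f0 ff fc.
have f0' w : 0 <= f w.
  rewrite -(cvg_lim _ (ff w)) //; apply: limr_ge; [exact: cvgP (ff w)|exact: nearW].
have mf : measurable_fun A f.
  by apply: (@measurable_fun_cvg _ _ _ A f_) => // n; exact: Rintegrable_measurable.
have H : (\int[P]_(w in A) (f w)%:E <= c%:E)%E.
  have := @fatou _ _ _ P A mA (fun n => EFin \o f_ n).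
  have -> : (\int[P]_(w in A) limn_einf ((fun n => EFin \o f_ n)^~ w) = \int[P]_(w in A) (f w)%:E)%E.
    apply: eq_integral => w _.
    have cv : (f_ n w)%:E @[n --> \oo] --> (f w)%:E by apply: cvg_EFin; [exact: nearW|exact: ff].
    by have [-> _] := cvg_limn_einf_sup cv.
  move=> /(_ _ _)/le_trans; apply.
  - by move=> n; apply/measurable_EFinP; exact: Rintegrable_measurable.
  - by move=> n w _; rewrite lee_fin.
  rewrite limn_einf_lim; apply: lime_le; first exact: is_cvg_einfs.
  apply: nearW => n; apply: le_trans (ereal_inf_lbound _) _; first by exists n => //=.
  by rewrite /= -EFin_Rintegral // lee_fin.
have fint : Rintegrable A f.
  apply/integrableP; split; first exact/measurable_EFinP.
  under eq_integral do rewrite /= ger0_norm //.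
  exact: le_lt_trans H (ltry _).
by split=> //; rewrite -lee_fin EFin_Rintegral.
Qed.

Lemma Rdominated A (f_ : nat -> Omega -> R) f g : measurable A ->
  (forall n, measurable_fun A (f_ n)) -> Rintegrable A g ->
  (forall n w, A w -> `|f_ n w| <= g w) ->
  (forall w, A w -> f_ n w @[n --> \oo] --> f w) ->
  Rintegrable A f /\ \int[P]_(w in A) f_ n w @[n --> \oo] --> \int[P]_(w in A) f w.
Proof.
move=> mA fm gA fg ff.
have mf : measurable_fun A f by exact: (@measurable_fun_cvg _ _ _ A f_).
have fI n : Rintegrable A (f_ n) by apply: Rintegrable_le gA => // w; exact: fg.
have fint : Rintegrable A f.
  apply: Rintegrable_le gA => // w Aw.
  by apply: (cvg_norm_le (ff w Aw)) => n; exact: fg.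
split => //.
have := @dominated_cvg _ _ _ P A mA (fun n => EFin \o f_ n) (EFin \o f) (EFin \o g).
move=> /(_ _ _ _ gA _); rewrite /= => H.
have {}H : (\int[P]_(w in A) (f_ n w)%:E)%E @[n --> \oo] --> (\int[P]_(w in A) (f w)%:E)%E.
  apply: H => //.
  - by move=> n; exact/measurable_EFinP.
  - by move=> w Aw; apply: cvg_EFin; [exact: nearW|exact: ff].
rewrite -(EFin_Rintegral mA fint) in H.
exact: (fine_cvg H).
Qed.

End RealIntegral.

(** * Elementary estimates for sine and cosine *)

Section Trig.
Variable R : realType.
Implicit Types (y z t : R).

Lemma abs_MVT (g dg : R -> R) t (B : R) : (forall s : R, is_derive s 1 g (dg s)) ->
  (forall s : R, `|s| <= `|t| -> `|dg s| <= B) -> `|g t - g 0| <= B * `|t|.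
Proof.
move=> gd dB; have [t0|t0] := leP 0 t.
  rewrite [`|t|]ger0_norm // -{2}[t]subr0; apply: (@MVT_le _ g dg) => // s /andP[s0 st].
  by apply: dB; rewrite !ger0_norm.
rewrite distrC [`|t|]ltr0_norm // -[- t]sub0r; apply: (@MVT_le _ g dg) => //; first exact: ltW.
by move=> s /andP[st s0]; apply: dB; rewrite !ler0_norm // ?lerN2 // ltW.
Qed.

Lemma abs_sin_le t : `|sin t| <= `|t|.
Proof.
have := @abs_MVT sin cos t 1 (@is_derive_sin R); rewrite sin0 subr0 mul1r; apply.
by move=> s _; exact: cos_max.
Qed.

Lemma cos_double t : 2 - 2 * cos t = (2 * sin (t / 2)) ^+ 2.
Proof.
rewrite {1}[t]splitr cosD -!expr2.
have := cos2Dsin2 (t / 2) => h; have -> : cos (t / 2) ^+ 2 = 1 - sin (t / 2) ^+ 2 by lra.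
by ring.
Qed.

Lemma one_sub_cos_le t : `|cos t - 1| <= t ^+ 2 / 2.
Proof.
have := cos_double t; rewrite exprMn => h.
have h1 : sin (t / 2) ^+ 2 <= (t / 2) ^+ 2.
  rewrite -[leLHS]ger0_norm ?sqr_ge0 // -[leRHS]ger0_norm ?sqr_ge0 // !normrX.
  by rewrite ler_pXn2r ?nnegrE // abs_sin_le.
rewrite expr_div_n in h1.
have h2 := cos_le1 t; rewrite ler0_norm ?subr_le0 //.
lra.
Qed.

Lemma sin_sub_le t : `|sin t - t| <= `|t| ^+ 3 / 2.
Proof.
have -> : `|t| ^+ 3 / 2 = `|t| ^+ 2 / 2 * `|t| by rewrite !exprS expr0; ring.
have := @abs_MVT (fun s => sin s - 1 * s) (fun s => cos s - 1) t (`|t| ^+ 2 / 2).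
rewrite sin0 mul1r mulr0 subr0 subr0; apply.
  by move=> s; exact: is_derive_sub_linear (is_derive_sin s).
move=> s st; apply: le_trans (one_sub_cos_le s) _.
rewrite ler_pM2r ?invr_gt0 // -[s ^+ 2]ger0_norm ?sqr_ge0 // normrX.
by rewrite ler_pXn2r ?nnegrE.
Qed.

Lemma cvg_of_bound (u : nat -> R) (l C : R) :
  (forall n, `|u n - l| <= C / n.+1%:R) -> u n @[n --> \oo] --> l.
Proof.
move=> uC; apply/cvg_seqP => eps e0.
have C1 : 0 < `|C| + 1 by rewrite ltr_wpDl.
have [|N] := ltr_add_invr (y := 0) (x := eps / (`|C| + 1)); first by rewrite divr_gt0.
rewrite add0r ltr_pdivlMr // => hN; exists N => n Nn.
apply: le_lt_trans (uC n) _; apply: le_lt_trans hN.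
rewrite [leRHS]mulrC; apply: (@le_trans _ _ ((`|C| + 1) / n.+1%:R)).
  by rewrite ler_wpM2r ?invr_ge0 //; have := ler_norm C; lra.
by rewrite ler_wpM2l ?(ltW C1) // lef_pV2 ?posrE // ler_nat.
Qed.

Lemma cvg_scaled_sin z (c : R) : 1 <= c ->
  c * n.+1%:R * sin (z / (c * n.+1%:R)) @[n --> \oo] --> z.
Proof.
move=> c1; apply: (@cvg_of_bound _ _ (`|z| ^+ 3)) => n.
have k1 : 1 <= n.+1%:R :> R by rewrite ler1n.
set k := n.+1%:R in k1 *; pose q := c * k.
have q1 : 1 <= q by rewrite /q; nra.
have kq : k <= q by rewrite /q; nra.
rewrite -/q; clearbody q; have q0 : 0 < q by lra.
have -> : q * sin (z / q) - z = q * (sin (z / q) - z / q) by field; rewrite gt_eqF.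
rewrite normrM gtr0_norm //; apply: le_trans (ler_wpM2l (ltW q0) (sin_sub_le _)) _.
rewrite normrM normfV (gtr0_norm q0) expr_div_n.
have z3 : 0 <= `|z| ^+ 3 by rewrite exprn_ge0.
have -> : q * (`|z| ^+ 3 / q ^+ 3 / 2) = `|z| ^+ 3 * (2 * q ^+ 2)^-1.
  by field; rewrite gt_eqF.
rewrite ler_wpM2l // lef_pV2 ?posrE ?mulr_gt0 ?exprn_gt0 //.
nra.
Qed.

End Trig.

(** * Moments of a variable with Gaussian characteristic function on an event *)

Section Moments.
Context (R : realType) (dO : measure_display) (Omega : measurableType dO).
Variables (P : probability Omega R) (Z : Omega -> R) (A : set Omega) (v : R).
Hypotheses (mZ : measurable_fun setT Z) (mA : measurable A) (v0 : 0 <= v).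
Hypothesis cosZ : forall s : R,
  \int[P]_(w in A) cos (s * Z w) = expR (- (s ^+ 2 * v) / 2) * fine (P A).
Hypothesis sinZ : forall s : R, \int[P]_(w in A) sin (s * Z w) = 0.

Let p := fine (P A).
Let p0 : 0 <= p. Proof. exact/fine_ge0/measure_ge0. Qed.

Let mZA (s : R) : measurable_fun A (fun w => s * Z w).
Proof. by apply: measurable_funM; [exact: measurable_cst|exact: measurable_funTS]. Qed.

Let mcos (s : R) : measurable_fun A (fun w => cos (s * Z w)).
Proof. by apply: (measurableT_comp (continuous_measurable_fun (@continuous_cos R))); exact: mZA. Qed.

Let msin (s : R) : measurable_fun A (fun w => sin (s * Z w)).
Proof. by apply: (measurableT_comp (continuous_measurable_fun (@continuous_sin R))); exact: mZA. Qed.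

Let icos (s : R) : Rintegrable P A (fun w => cos (s * Z w)).
Proof. by apply: (@Rintegrable_bounded _ _ _ _ _ _ 1) => // w _; exact: cos_max. Qed.

Let icst (c : R) : Rintegrable P A (fun=> c).
Proof. by apply: (@Rintegrable_bounded _ _ _ _ _ _ `|c|) => //; exact: measurable_cst. Qed.

Let k n : R := n.+1%:R.
Let k_gt0 n : 0 < k n. Proof. by []. Qed.
Let k_ge1 n : 1 <= k n. Proof. by rewrite /k ler1n. Qed.

(** By the double angle formula this is [(2 * k * sin (Z / (2 * k))) ^+ 2], a bounded substitute for
    [Z ^+ 2] whose integral involves only a cosine. *)
Let f2 n w := k n ^+ 2 * (2 - 2 * cos ((k n)^-1 * Z w)).

Let f2E n w : f2 n w = (2 * k n * sin (Z w / (2 * k n))) ^+ 2.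
Proof.
rewrite /f2 cos_double -exprMn; congr (_ ^+ 2).
have -> : (k n)^-1 * Z w / 2 = Z w / (2 * k n) by field; rewrite gt_eqF.
ring.
Qed.

Let f2_ge0 n w : 0 <= f2 n w. Proof. by rewrite f2E sqr_ge0. Qed.

Let f2_cvg w : f2 n w @[n --> \oo] --> Z w ^+ 2.
Proof.
under eq_fun do rewrite f2E expr2; rewrite expr2.
by apply: cvgM; apply: cvg_scaled_sin; rewrite ler1n.
Qed.

Let iBcos (a c s : R) : Rintegrable P A (fun w => a - c * cos (s * Z w)).
Proof. by apply: RintegrableB => //; exact: RintegrableZ. Qed.

Let f2_int n : Rintegrable P A (f2 n).
Proof. exact: RintegrableZ. Qed.

Let f2_le n w : f2 n w <= Z w ^+ 2.
Proof.
have q0 : 0 < 2 * k n by rewrite mulr_gt0.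
rewrite f2E -[leLHS]ger0_norm ?sqr_ge0 // -[leRHS]ger0_norm ?sqr_ge0 // !normrX.
rewrite ler_pXn2r ?nnegrE // normrM (gtr0_norm q0) -ler_pdivlMl //.
by rewrite (le_trans (abs_sin_le _)) // normrM normfV (gtr0_norm q0) mulrC.
Qed.

Let x_ n := expR (- (((k n)^-1) ^+ 2 * v) / 2).
Let a_ n := v / (2 * k n ^+ 2).

Let x_E n : x_ n = expR (- a_ n).
Proof. by rewrite /x_ /a_; congr expR; field; rewrite gt_eqF. Qed.

Let a_ge0 n : 0 <= a_ n. Proof. by rewrite divr_ge0 // mulr_ge0 // exprn_ge0. Qed.

(** The two estimates of [1 - x_ n] come from [expR t >= 1 + t] at [- a_ n] and at [a_ n]; they
    bound the second moment from above and from below. *)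
Let x_bounds n : [/\ 0 < x_ n, x_ n <= 1, 1 - x_ n <= a_ n & a_ n <= (1 - x_ n) * (1 + a_ n)].
Proof.
have h1 := expR_ge1Dx (- a_ n); have h2 := expR_ge1Dx (a_ n); have h3 := expR_gt0 (- a_ n).
have E : expR (- a_ n) * expR (a_ n) = 1 by rewrite -expRD addNr expR0.
have a0 := a_ge0 n; rewrite x_E; split; nra.
Qed.

Let cosZc (c s : R) :
  \int[P]_(w in A) (c * cos (s * Z w)) = c * (expR (- (s ^+ 2 * v) / 2) * p).
Proof. by rewrite RintegralZl ?cosZ //; exact: icos. Qed.

Let BcosZ (a c s : R) :
  \int[P]_(w in A) (a - c * cos (s * Z w)) = a * p - c * (expR (- (s ^+ 2 * v) / 2) * p).
Proof.
have i1 := icst a; have i2 : Rintegrable P A (fun w => c * cos (s * Z w)) by exact: RintegrableZ.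
by rewrite (RintegralB mA i1 i2) Rintegral_cst // cosZc.
Qed.

Let f2_Rint n : \int[P]_(w in A) f2 n w = 2 * k n ^+ 2 * (1 - x_ n) * p.
Proof.
rewrite (RintegralZl _ mA (iBcos 2 2 _)) BcosZ -/(x_ n); ring.
Qed.

(* [f2 n] is bounded by [Z ^+ 2] and tends to it, and its integral is computed
   from the characteristic function. *)
Lemma second_moment : Rintegrable P A (fun w => Z w ^+ 2) /\
  \int[P]_(w in A) Z w ^+ 2 = v * p.
Proof.
have [|iZ leZ] := @Rfatou _ _ _ P A f2 (fun w => Z w ^+ 2) (v * p) mA f2_int f2_ge0 f2_cvg.
  move=> n; rewrite f2_Rint ler_wpM2r //; have [_ _ h _] := x_bounds n.
  have : 2 * k n ^+ 2 * (1 - x_ n) <= 2 * k n ^+ 2 * a_ n by rewrite ler_wpM2l // mulr_ge0 // exprn_ge0.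
  by have -> : 2 * k n ^+ 2 * a_ n = v by rewrite /a_; field; rewrite gt_eqF.
split => //; apply/le_anti; rewrite leZ /=.
have H n : v * p <= (\int[P]_(w in A) Z w ^+ 2) * (1 + a_ n).
  have h : 2 * k n ^+ 2 * (1 - x_ n) * p <= \int[P]_(w in A) Z w ^+ 2.
    by rewrite -f2_Rint; apply: (le_Rintegral mA (f2_int n) iZ) => w _; exact: f2_le.
  have [_ _ _ h2] := x_bounds n.
  have a1 : 0 <= 1 + a_ n by rewrite addr_ge0.
  apply: le_trans (ler_wpM2r a1 h).
  have -> : 2 * k n ^+ 2 * (1 - x_ n) * p * (1 + a_ n) = 2 * k n ^+ 2 * p * ((1 - x_ n) * (1 + a_ n)) by ring.
  apply: (@le_trans _ _ (2 * k n ^+ 2 * p * a_ n)).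
    by rewrite le_eqVlt; apply/orP; left; apply/eqP; rewrite /a_; field; rewrite gt_eqF.
  by rewrite ler_wpM2l // !mulr_ge0 // exprn_ge0.
set I := \int[P]_(w in A) Z w ^+ 2 in H *.
have cv : I * (1 + a_ n) @[n --> \oo] --> I * (1 + 0).
  apply: cvgM; first exact: cvg_cst.
  apply: cvgD; first exact: cvg_cst.
  apply: (@cvg_of_bound _ _ _ v) => n; rewrite subr0 (ger0_norm (a_ge0 n)) /a_ ler_wpM2l //.
  rewrite lef_pV2 ?posrE ?mulr_gt0 ?exprn_gt0 //; have := k_ge1 n; rewrite /k; nra.
rewrite addr0 mulr1 in cv.
rewrite -(cvg_lim _ cv) //; apply: limr_ge; first by apply/cvg_ex; exists I.
exact: nearW.
Qed.

(** [n * sin (Z / n)] has integral 0 and tends to [Z], dominated by [1 + Z ^+ 2], which is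
    integrable by the second moment. *)
Lemma first_moment : Rintegrable P A Z /\ \int[P]_(w in A) Z w = 0.
Proof.
have [iZ2 _] := second_moment.
have iZ1 : Rintegrable P A (fun w => 1 + Z w ^+ 2) by exact: RintegrableD.
have [|||iZ cv] := @Rdominated _ _ _ P A (fun n w => n.+1%:R * sin (Z w / n.+1%:R)) Z _ mA _ iZ1.
- move=> n; apply: measurable_funM; first exact: measurable_cst.
  under eq_fun do rewrite mulrC; exact: msin.
- move=> n w _; rewrite normrM gtr0_norm // -ler_pdivlMl //.
  rewrite (le_trans (abs_sin_le _)) // normrM normfV (gtr0_norm (ltr0Sn R n)) mulrC ler_wpM2l ?invr_ge0 //.
  have := sqr_ge0 (`|Z w| - 1); rewrite -[Z w ^+ 2]ger0_norm ?sqr_ge0 // normrX; nra.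
- move=> w _; have := @cvg_scaled_sin R (Z w) 1 (lexx 1).
  by under eq_fun do rewrite !mul1r.
split => //; apply: cvg_unique cv _ => //.
have -> : (fun n => \int[P]_(w in A) (n.+1%:R * sin (Z w / n.+1%:R))) = (fun=> 0).
  apply/funext => n; rewrite RintegralZl //.
    by under eq_Rintegral do rewrite mulrC; rewrite sinZ mulr0.
  apply: (@Rintegrable_bounded _ _ _ _ _ _ 1) => //; last by move=> w _; exact: sin_max.
  by under eq_fun do rewrite mulrC; exact: msin.
exact: cvg_cst.
Qed.

(** [f2 ^+ 2] is a combination of cosines of [Z / k] and [2 * Z / k]. With [x = x_ n] its mean
    contains [3 - 4 * x + x ^+ 4 = (1 - x) ^+ 2 * (x ^+ 2 + 2 * x + 3)], which is at most
    [6 * a_ n ^+ 2]. Fatou's lemma gives an upper bound, enough for a Taylor remainder. *)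
Lemma fourth_moment : Rintegrable P A (fun w => Z w ^+ 4) /\
  \int[P]_(w in A) Z w ^+ 4 <= 3 * v ^+ 2 * p.
Proof.
pose f4 n w := f2 n w ^+ 2.
have f4E n w : f4 n w = 2 * k n ^+ 4 * (3 - 4 * cos ((k n)^-1 * Z w) + cos ((2 * (k n)^-1) * Z w)).
  rewrite /f4 /f2; set t := (k n)^-1 * Z w.
  have -> : cos (2 * (k n)^-1 * Z w) = 2 * cos t ^+ 2 - 1.
    have -> : 2 * (k n)^-1 * Z w = t + t by rewrite /t; ring.
    rewrite cosD -!expr2; have := cos2Dsin2 t; lra.
  by ring.
have i1 n : Rintegrable P A (fun w => 3 - 4 * cos ((k n)^-1 * Z w)).
  by apply: RintegrableB => //; exact: RintegrableZ.
apply: (@Rfatou _ _ _ P A f4) => //.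
- move=> n; rewrite (_ : f4 n = fun w => 2 * k n ^+ 4 * (3 - 4 * cos ((k n)^-1 * Z w) + cos ((2 * (k n)^-1) * Z w))).
    by apply: RintegrableZ => //; exact: RintegrableD.
  by apply/funext => w; rewrite f4E.
- by move=> n w; exact: sqr_ge0.
- move=> w; have -> : Z w ^+ 4 = Z w ^+ 2 * Z w ^+ 2 by ring.
  by under eq_fun do rewrite /f4 expr2; apply: cvgM; exact: f2_cvg.
- move=> n; under eq_Rintegral do rewrite f4E.
  rewrite (RintegralZl _ mA (RintegrableD mA (i1 n) (icos _))).
  rewrite (RintegralD mA (i1 n) (icos _)) BcosZ cosZ -/p -/(x_ n).
  have -> : expR (- ((2 * (k n)^-1) ^+ 2 * v) / 2) = x_ n ^+ 4.
    by rewrite /x_ -expRM_natl; congr expR; rewrite -mulr_natl; field; rewrite gt_eqF.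
  have [x0 x1 h _] := x_bounds n.
  have h0 : 0 <= 1 - x_ n by rewrite subr_ge0.
  have -> : 2 * k n ^+ 4 * (3 * p - 4 * (x_ n * p) + x_ n ^+ 4 * p) =
    2 * k n ^+ 4 * p * ((1 - x_ n) ^+ 2 * (x_ n ^+ 2 + 2 * x_ n + 3)) by ring.
  have -> : 3 * v ^+ 2 * p = 2 * k n ^+ 4 * p * (a_ n ^+ 2 * 6).
    by rewrite /a_; field; rewrite gt_eqF.
  rewrite ler_wpM2l ?mulr_ge0 ?exprn_ge0 //; apply: ler_pM => //.
  - by rewrite sqr_ge0.
  - by rewrite !addr_ge0 ?sqr_ge0 // mulr_ge0 // ltW.
  - by rewrite ler_pXn2r ?nnegrE.
  - nra.
Qed.

End Moments.

(** * Brownian increments *)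

Section SigmaAlgebra.
Variables (T : Type) (S : set (set T)).
Hypothesis hS : sigma_algebra setT S.
Implicit Types (A B : set T).

Lemma salg_set0 : S set0. Proof. by case: hS. Qed.

Lemma salg_setC A : S A -> S (~` A).
Proof. by case: hS => _ h _ /h; rewrite setTD. Qed.

Lemma salg_setT : S setT.
Proof. by rewrite -setC0; apply: salg_setC; exact: salg_set0. Qed.

Lemma salg_bigcup (F : nat -> set T) : (forall n, S (F n)) -> S (\bigcup_n F n).
Proof. by move=> SF; case: hS => _ _; apply. Qed.

Lemma salg_setU A B : S A -> S B -> S (A `|` B).
Proof.
move=> SA SB; have -> : A `|` B = \bigcup_n (if n == 0%N then A else B).
  apply/seteqP; split => x.
    by move=> [Ax|Bx]; [exists 0%N|exists 1%N].
  by move=> [n _]; case: ifP => _ h; [left|right].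
by apply: salg_bigcup => n; case: ifP.
Qed.

Lemma salg_setI A B : S A -> S B -> S (A `&` B).
Proof.
move=> SA SB; rewrite -[A `&` B]setCK setCI; apply: salg_setC.
by apply: salg_setU; exact: salg_setC.
Qed.

Lemma salg_setD A B : S A -> S B -> S (A `\` B).
Proof. by move=> SA SB; rewrite setDE; apply: salg_setI => //; exact: salg_setC. Qed.

Lemma salg_bigcup_count (I : countType) (F : I -> set T) :
  (forall i, S (F i)) -> S (\bigcup_i F i).
Proof.
move=> SF; have -> : \bigcup_i F i = \bigcup_n (if unpickle n is Some i then F i else set0).
  apply/seteqP; split => x.
    by move=> [i _ Fi]; exists (pickle i) => //; rewrite pickleK.
  by move=> [n _]; case: unpickle => [i Fi|//]; exists i.
by apply: salg_bigcup => n; case: unpickle => // ; exact: salg_set0.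
Qed.

Lemma salg_forall (I : finType) (F : I -> set T) :
  (forall i, S (F i)) -> S [set x | forall i, F i x].
Proof.
move=> SF; have -> : [set x | forall i, F i x] = ~` \bigcup_i ~` F i.
  apply/seteqP; split => x /=; first by move=> h [i _]; apply; exact: h.
  by move=> h i; apply: contrapT => nF; apply: h; exists i.
by apply: salg_setC; apply: salg_bigcup_count => i; exact: salg_setC.
Qed.

End SigmaAlgebra.

Lemma salg_generated (T : Type) (G : set (set T)) : sigma_algebra setT <<s G >>.
Proof. exact: smallest_sigma_algebra. Qed.

Lemma salg_measurable (dO : measure_display) (T : measurableType dO) :
  sigma_algebra setT (@measurable dO T).
Proof.
split; first exact: measurable0.
  by move=> A mA; exact: measurableD.
by move=> F mF; exact: bigcupT_measurable.
Qed.

Lemma salg_preimage (T U : Type) (f : T -> U) (S : set (set T)) :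
  sigma_algebra setT S -> sigma_algebra setT [set B | S (f @^-1` B)].
Proof.
move=> hS; split => /=.
- by rewrite preimage_set0; exact: salg_set0.
- by move=> A SA; rewrite setTD preimage_setC; exact: salg_setC.
- by move=> F SF; rewrite preimage_bigcup; exact: salg_bigcup.
Qed.

Lemma salg_preimageI (T U : Type) (f : T -> U) (G : set T) (S : set (set T)) :
  sigma_algebra setT S -> S G -> sigma_algebra setT [set B | S (G `&` f @^-1` B)].
Proof.
move=> hS SG; split => /=.
- by rewrite preimage_set0 setI0; exact: salg_set0.
- move=> A SA; have -> : G `&` f @^-1` (setT `\` A) = G `\` (G `&` f @^-1` A).
    apply/seteqP; split => x /= [Gx h]; split => //; first by move=> [_]; case: h.
    by split => // Ax; apply: h.
  exact: salg_setD.
- move=> F SF; rewrite preimage_bigcup setI_bigcupr; exact: salg_bigcup.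
Qed.

Lemma Rintegrable_norm (R : realType) (dO : measure_display) (Omega : measurableType dO)
  (P : probability Omega R) (A : set Omega) (f : Omega -> R) :
  Rintegrable P A f -> Rintegrable P A (fun w => `|f w|).
Proof. by move=> /integrable_abse. Qed.

(** * Integrals against functions of the past *)

Section Orthogonality.
Context (R : realType) (dO : measure_display) (Omega : measurableType dO).
Variables (P : probability Omega R) (S : set (set Omega)).
Hypotheses (hS : sigma_algebra setT S) (Sm : S `<=` measurable).

(** The sum counts the integers [j >= 0] below [y], so it is the ceiling of [y]. It serves for the
    staircases here and later for the layers of a Borel function. *)
Lemma count_lt (y : R) (N : nat) : 0 <= y -> y <= N%:R ->
  y <= \sum_(j < N) ((j%:R < y)%R : nat)%:R < y + 1.
Proof.
move=> y0 yN.
have H n : let c := \sum_(j < n) ((j%:R < y)%R : nat)%:R in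
    [/\ c = n%:R \/ y <= c, c < y + 1 & c <= n%:R :> R].
  elim: n => [|n]; first by rewrite big_ord0; split; [left| lra|].
  move=> /= [h1 h2 h3]; rewrite big_ord_recr /= -natr1; case: ltP => ny /=.
    have cn : \sum_(j < n) ((j%:R < y)%R : nat)%:R = n%:R :> R.
      by case: h1 => // ?; lra.
    by rewrite cn; split; [left| lra|].
  rewrite addr0; split => //; [right; case: h1 => [->//|//] | lra].
by have [[->|h1] h2 _] := H N; apply/andP; split.
Qed.

(** The levels start at [- M] with spacing [k^-1], and [2 * M * k <= N] makes them reach [M]. *)
Lemma staircase_bound (M k y : R) (N : nat) : 0 < k -> 2 * M * k <= N%:R ->
  - M <= y -> y <= M ->
  `|y - (- M + k^-1 * \sum_(j < N) ((- M + j%:R / k < y)%R : nat)%:R)| <= k^-1.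
Proof.
move=> k0 kN y1 y2.
have c0 : 0 <= (y + M) * k by rewrite mulr_ge0 // ?(ltW k0) //; lra.
have cN : (y + M) * k <= N%:R.
  by apply: (@le_trans _ _ (2 * M * k)) => //; rewrite ler_pM2r //; lra.
have /andP[h1 h2] := count_lt c0 cN.
rewrite (eq_bigr (fun j : 'I_N => ((j%:R < (y + M) * k)%R : nat)%:R)); last first.
  by move=> j _; rewrite -ltr_pdivrMr //; congr ((_ : bool) : nat)%:R; apply/idP/idP => h; lra.
set c := \sum_(j < N) _ in h1 h2 *.
have -> : y - (- M + k^-1 * c) = ((y + M) * k - c) * k^-1 by field; rewrite gt_eqF.
rewrite normrM [`|k^-1|]gtr0_norm ?invr_gt0 // ler_piMl ?invr_ge0 ?(ltW k0) //.
by rewrite ler_norml; lra.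
Qed.

Lemma measurable_fun_gt (f : Omega -> R) :
  (forall c : R, measurable [set w | c < f w]) -> measurable_fun setT f.
Proof.
move=> mf mT; apply: (measurability _ (RGenOInfty.measurableE R)) => //.
by move=> /= _ [_ [a ->] <-]; rewrite preimage_itvoy setTI; exact: mf.
Qed.

Lemma Rintegral_indic_mul (E : set Omega) (Z : Omega -> R) :
  \int[P]_w (\1_E w * Z w) = \int[P]_(w in E) Z w.
Proof.
rewrite [RHS]Rintegral_mkcond; congr Rintegral; apply/funext => w.
by rewrite patch_indic /= mulrC.
Qed.

(* [Y] is uniformly approximated by staircases over its superlevel sets. *)
Lemma Rintegral_mul_eq0 (Y Z : Omega -> R) (M : R) : Rintegrable P setT Z ->
  (forall A, S A -> \int[P]_(w in A) Z w = 0) ->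
  (forall w, `|Y w| <= M) -> (forall c : R, S [set w | c < Y w]) ->
  Rintegrable P setT (fun w => Y w * Z w) /\ \int[P]_w (Y w * Z w) = 0.
Proof.
move=> iZ Z0 YM SY.
have mT := @measurableT _ Omega.
have mY : measurable_fun setT Y by apply: measurable_fun_gt => c; apply: Sm.
have mZ := Rintegrable_measurable iZ.
have iaZ := Rintegrable_norm iZ.
have iYZ : Rintegrable P setT (fun w => Y w * Z w).
  apply: (@Rintegrable_le _ _ _ P setT _ (fun w => M * `|Z w|)) => //.
  - exact: measurable_funM.
  - by move=> w _; rewrite normrM ler_wpM2r.
  - exact: RintegrableZ.
split => //.
have key n : `|\int[P]_w (Y w * Z w)| <= (\int[P]_w `|Z w|) / n.+1%:R.
  pose k : R := n.+1%:R; have k0 : 0 < k by [].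
  pose N := (Num.truncn (2 * M * k)).+1.
  pose E (j : 'I_N) := [set w | - M + j%:R / k < Y w].
  pose Yn w := - M + k^-1 * \sum_(j < N) \1_(E j) w.
  have dYn w : `|Y w - Yn w| <= k^-1.
    have /andP[yl yu] : - M <= Y w <= M by rewrite -ler_norml.
    have := staircase_bound k0 (ltW (truncnS_gt _)) yl yu; rewrite -/N.
    rewrite /Yn (eq_bigr (fun j : 'I_N => \1_(E j) w)) // => j _.
    rewrite indicE; congr ((_ : bool) : nat)%:R.
    by apply/idP/idP; rewrite inE.
  have mE j : measurable (E j) by apply: Sm; exact: SY.
  have iE j : Rintegrable P setT (fun w => \1_(E j) w * Z w).
    apply: (@Rintegrable_le _ _ _ P setT _ (fun w => `|Z w|)) => //.
      by apply: measurable_funM => //; exact: measurable_indic.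
    move=> w _; rewrite normrM indicE; case: (_ \in _); rewrite ?normr1 ?normr0 ?mul1r ?mul0r //.
  have iYn : Rintegrable P setT (fun w => - M * Z w + k^-1 * \sum_(j < N) \1_(E j) w * Z w).
    by apply: RintegrableD => //; apply: RintegrableZ => //; exact: Rintegrable_sum.
  have E0 : \int[P]_w (- M * Z w + k^-1 * \sum_(j < N) \1_(E j) w * Z w) = 0.
    rewrite (RintegralD mT (RintegrableZ (- M) mT iZ) (RintegrableZ k^-1 mT (Rintegrable_sum _ mT iE))).
    rewrite (RintegralZl _ mT iZ) (RintegralZl _ mT (Rintegrable_sum _ mT iE)).
    rewrite (Rintegral_sum _ mT iE) (Z0 _ (salg_setT hS)) mulr0 add0r big1 ?mulr0 // => j _.
    by rewrite Rintegral_indic_mul Z0 //; exact: SY.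
  have E1 : \int[P]_w (Y w * Z w) = \int[P]_w (Y w * Z w - (- M * Z w + k^-1 * \sum_(j < N) \1_(E j) w * Z w)).
    by rewrite (RintegralB mT iYZ iYn) E0 subr0.
  have iD := RintegrableB mT iYZ iYn.
  rewrite E1 (le_trans (le_normr_Rintegral mT iD)) //.
  rewrite mulrC -(RintegralZl _ mT iaZ); apply: (le_Rintegral mT) => //.
  - exact: (Rintegrable_norm iD).
  - exact: RintegrableZ.
  - move=> w _; have -> : Y w * Z w - (- M * Z w + k^-1 * \sum_(j < N) \1_(E j) w * Z w) = (Y w - Yn w) * Z w.
      by rewrite /Yn -mulr_suml; ring.
    by rewrite normrM ler_wpM2r.
have cv : (fun=> \int[P]_w (Y w * Z w)) @ \oo --> (0 : R).
  by apply: (@cvg_of_bound _ _ _ (\int[P]_w `|Z w|)) => n; rewrite subr0.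
by apply: cvg_unique (cvg_cst _) cv.
Qed.

End Orthogonality.

(** * Borel sets and the natural filtration *)

Section Filtration.
Context (R : realType) (d : nat) (dO : measure_display) (Omega : measurableType dO).
Local Notation V := 'rV[R]_d.
Implicit Types (X : R -> Omega -> V) (s t : R).

(** Measurability of the process is given coordinate by coordinate, whereas Borel sets are generated
    by open sets; a countable family of rational boxes links the two. Boxes not inside [O] are
    replaced by the empty set, so that the index type stays fixed. *)
Lemma open_bigcup_boxes (O : set V) : open O ->
  let box (b : 'rV[rat]_d * nat) :=
    [set y : V | forall i, `](ratr (b.1 ord0 i) - b.2.+1%:R^-1),
                             (ratr (b.1 ord0 i) + b.2.+1%:R^-1)[%classic (y ord0 i)] in
  O = \bigcup_b (if `[< box b `<=` O >] then box b else set0).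
Proof.
move=> /openP oO box; apply/seteqP; split => [y Oy|y [b _]]; last first.
  by case: asboolP => // h /h.
have [r r0 H] := oO y Oy.
have [n] := ltr_add_invr (y := 0) (x := r / 2) (divr_gt0 r0 (ltr0Sn _ _)).
rewrite add0r; set e := n.+1%:R^-1 => hn; have e0 : 0 < e by rewrite invr_gt0.
have Q i : exists q : rat, (ratr q : R) \in `]y ord0 i - e, y ord0 i + e[.
  by apply: rat_in_itvoo; lra.
have /choice[q hq] := Q; exists (\row_i q i, n) => //=.
have by_ : box (\row_i q i, n) y.
  move=> i /=; rewrite mxE -/e; have := hq i; rewrite !in_itv /= => /andP[? ?].
  by apply/andP; split; lra.
rewrite asboolT // => z bz; apply: H; apply: norm_le_coord; first exact: ltW.
move=> i; rewrite !mxE ler_norml; have := bz i; have := by_ i => /=; rewrite mxE -/e !in_itv /=.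
by move=> /andP[? ?] /andP[? ?]; apply/andP; split; lra.
Qed.

Lemma salg_borel_preimage (S : set (set Omega)) (Y : Omega -> V) (B : set V) :
  sigma_algebra setT S ->
  (forall i (C : set R), measurable C -> S ((fun w => Y w ord0 i) @^-1` C)) ->
  borelRd B -> S (Y @^-1` B).
Proof.
move=> hS SY; apply: (@smallest_sub _ _ _ [set B | S (Y @^-1` B)]); first exact: salg_preimage.
move=> O /open_bigcup_boxes -> /=; rewrite preimage_bigcup.
apply: (salg_bigcup_count hS) => b; case: asboolP => _; last first.
  by rewrite preimage_set0; exact: salg_set0.
apply: (salg_forall hS) => i.
exact: (SY i `](ratr (b.1 ord0 i) - b.2.+1%:R^-1), (ratr (b.1 ord0 i) + b.2.+1%:R^-1)[%classic).
Qed.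

Lemma nat_filtration_salg X s : sigma_algebra setT (nat_filtration X s).
Proof. exact: salg_generated. Qed.

Lemma nat_filtration_mono X s t : s <= t -> nat_filtration X s `<=` nat_filtration X t.
Proof.
move=> st; apply: sub_sigma_algebra2 => _ [r [i [B [/andP[r0 rs] [mB ->]]]]].
by exists r, i, B; rewrite r0 (le_trans rs st).
Qed.

Lemma nat_filtration_measurable X s : (forall t i, measurable_fun setT (fun w => X t w ord0 i)) ->
  nat_filtration X s `<=` measurable.
Proof.
move=> mX; apply: smallest_sub; first exact: salg_measurable.
move=> _ [r [i [B [_ [mB ->]]]]]; rewrite -[_ @^-1` _]setTI; exact: mX.
Qed.

Lemma nat_filtration_borel X s (B : set V) : 0 <= s -> borelRd B ->
  nat_filtration X s (X s @^-1` B).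
Proof.
move=> s0; apply: salg_borel_preimage; first exact: nat_filtration_salg.
by move=> i C mC; apply: sub_gen_smallest; exists s, i, C; rewrite s0 lexx.
Qed.

Lemma open_borelRd (O : set V) : open O -> borelRd O.
Proof. by move=> oO; exact: sub_gen_smallest. Qed.

Lemma closed_borelRd (K : set V) : closed K -> borelRd K.
Proof.
move=> cK; rewrite -[K]setCK; apply: (salg_setC (salg_generated _)).
by apply: open_borelRd; exact: closed_openC.
Qed.

End Filtration.

(** * Moments of Brownian increments on events of the past *)

Section Increments.
Context (R : realType) (d : nat) (dO : measure_display) (Omega : measurableType dO).
Local Notation V := 'rV[R]_d.
Variables (P : probability Omega R) (X : R -> Omega -> V) (x : V).
Hypothesis hB : is_brownian P X x.
Variables (s t : R).
Hypotheses (s0 : 0 <= s) (st : s < t).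

Let mX : forall t i, measurable_fun setT (fun w => X t w ord0 i).
Proof. by case: hB. Qed.

Let inc (i : 'I_d) w := X t w ord0 i - X s w ord0 i.

Lemma nat_filtrationW : nat_filtration X s `<=` measurable.
Proof. exact: nat_filtration_measurable. Qed.

Let mdot (u : V) : measurable_fun setT (fun w => dotR u (X t w - X s w)).
Proof.
apply: measurable_sum => i; apply: measurable_funM; first exact: measurable_cst.
rewrite (_ : (fun w => _) = inc i); first exact: measurable_funB.
by apply/funext => w; rewrite !mxE.
Qed.

Let dotZ (a : R) (u v : V) : dotR (a *: u) v = a * dotR u v.
Proof. by rewrite /dotR mulr_sumr; apply: eq_bigr => i _; rewrite mxE mulrA. Qed.

Lemma increment_cos A (u : V) (a : R) : nat_filtration X s A ->
  \int[P]_(w in A) cos (a * dotR u (X t w - X s w)) =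
  expR (- (a ^+ 2 * (dotR u u * (t - s))) / 2) * fine (P A).
Proof.
move=> FA; have mA := nat_filtrationW FA.
case: hB => _ _ _ /(_ s t s0 st A FA (a *: u))[h _].
rewrite /Rintegral; under eq_integral do rewrite -dotZ.
have pf : P A \is a fin_num by exact: fin_num_measure.
rewrite h fineM //=; congr (expR _ * _).
rewrite dotZ; congr (- _ / 2); rewrite mulrA; congr (_ * _).
rewrite expr2 -mulrA; congr (_ * _); rewrite /dotR mulr_sumr.
by apply: eq_bigr => i _; rewrite mxE mulrCA.
Qed.

Lemma increment_sin A (u : V) (a : R) : nat_filtration X s A ->
  \int[P]_(w in A) sin (a * dotR u (X t w - X s w)) = 0.
Proof.
move=> FA; case: hB => _ _ _ /(_ s t s0 st A FA (a *: u))[_ h].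
by rewrite /Rintegral; under eq_integral do rewrite -dotZ; rewrite h.
Qed.

Let dv (u : V) : 0 <= dotR u u * (t - s).
Proof. by rewrite mulr_ge0 ?dotR_ge0 // subr_ge0 ltW. Qed.

Lemma dot_evec (i : 'I_d) (v : V) : dotR (evec R i) v = v ord0 i.
Proof.
rewrite /dotR (bigD1 i) //= evecE eqxx mul1r big1 ?addr0 // => j ji.
by rewrite evecE eq_sym (negbTE ji) mul0r.
Qed.

Let dot_inc (i : 'I_d) : (fun w => dotR (evec R i) (X t w - X s w)) = inc i.
Proof. by apply/funext => w; rewrite dot_evec !mxE. Qed.

Lemma increment_first A i : nat_filtration X s A ->
  Rintegrable P A (inc i) /\ \int[P]_(w in A) inc i w = 0.
Proof.
move=> FA; have mA := nat_filtrationW FA.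
have := @first_moment _ _ _ P _ A _ (mdot (evec R i)) mA (dv (evec R i)).
rewrite dot_inc; apply => a; [have := increment_cos (evec R i) a FA|have := increment_sin (evec R i) a FA].
all: by under eq_Rintegral do rewrite dot_evec !mxE.
Qed.

Lemma increment_fourth A i : nat_filtration X s A ->
  Rintegrable P A (fun w => inc i w ^+ 4) /\
  \int[P]_(w in A) inc i w ^+ 4 <= 3 * (t - s) ^+ 2 * fine (P A).
Proof.
move=> FA; have mA := nat_filtrationW FA.
have := @fourth_moment _ _ _ P _ A _ (mdot (evec R i)) mA (dv (evec R i)).
have E : (fun w => dotR (evec R i) (X t w - X s w) ^+ 4) = (fun w => inc i w ^+ 4).
  by apply/funext => w; rewrite dot_evec !mxE.
rewrite E dot_evec evecE eqxx mul1r; apply => a.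
by have := increment_cos (evec R i) a FA; rewrite dot_evec evecE eqxx mul1r.
Qed.

Lemma increment_second A (u : V) : nat_filtration X s A ->
  Rintegrable P A (fun w => dotR u (X t w - X s w) ^+ 2) /\
  \int[P]_(w in A) dotR u (X t w - X s w) ^+ 2 = dotR u u * (t - s) * fine (P A).
Proof.
move=> FA; apply: second_moment => //; first exact: nat_filtrationW.
by move=> a; exact: increment_cos.
Qed.

Lemma increment_sqr A i : nat_filtration X s A ->
  Rintegrable P A (fun w => inc i w ^+ 2) /\
  \int[P]_(w in A) inc i w ^+ 2 = (t - s) * fine (P A).
Proof.
move=> FA; have [h1 h2] := increment_second (evec R i) FA.
have E : (fun w => dotR (evec R i) (X t w - X s w) ^+ 2) = (fun w => inc i w ^+ 2).
  by apply/funext => w; rewrite dot_evec !mxE.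
by move: h1 h2; rewrite E dot_evec evecE eqxx mul1r.
Qed.

(** Polarization, [2 * a * b = (a + b) ^+ 2 - a ^+ 2 - b ^+ 2], with the second moment in the
    direction [evec R i + evec R j], whose squared length is 2 for [i != j]. *)
Lemma increment_mixed A i j : nat_filtration X s A ->
  Rintegrable P A (fun w => inc i w * inc j w) /\
  \int[P]_(w in A) (inc i w * inc j w) = (i == j)%:R * (t - s) * fine (P A).
Proof.
move=> FA; have mA := nat_filtrationW FA.
have [i1 e1] := increment_sqr i FA; have [i2 e2] := increment_sqr j FA.
case: eqVneq => [<-|ij].
  by rewrite mul1r -e1; have E : (fun w => inc i w * inc i w) = (fun w => inc i w ^+ 2) by []; rewrite E.
pose u := evec R i + evec R j.
have uE v : dotR u v = v ord0 i + v ord0 j.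
  rewrite -!dot_evec /dotR -big_split /=; apply: eq_bigr => k _.
  by rewrite mxE mulrDl.
have uu : dotR u u = 2.
  by rewrite uE !mxE !eqxx /= (negbTE ij) eq_sym (negbTE ij) /= addr0 add0r.
have [i3 e3] := increment_second u FA; rewrite uu in e3.
have E : (fun w => dotR u (X t w - X s w) ^+ 2) = (fun w => (inc i w + inc j w) ^+ 2).
  by apply/funext => w; rewrite uE !mxE.
rewrite E in i3 e3.
have E2 : (fun w => inc i w * inc j w) =
    (fun w => 2^-1 * ((inc i w + inc j w) ^+ 2 - inc i w ^+ 2 - inc j w ^+ 2)).
  by apply/funext => w; field.
have i4 := RintegrableB mA i3 i1; have i5 := RintegrableB mA i4 i2.
rewrite E2; split; first exact: RintegrableZ.
rewrite (RintegralZl _ mA i5) (RintegralB mA i4 i2) (RintegralB mA i3 i1) e1 e2 e3 mulr0n.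
have : (2 : R) != 0 by []. by move=> ?; field.
Qed.

End Increments.

(** * Taylor remainder in terms of second and fourth powers *)

Section Remainder.
Context (R : realType) (d : nat).
Local Notation V := 'rV[R]_d.

Lemma norm_sum_pow (v : V) (k : nat) : (0 < k)%N ->
  `|v| ^+ k <= \sum_i `|v ord0 i| ^+ k.
Proof.
move=> k0; set S := \sum_i _.
have S0 : 0 <= S by apply: sumr_ge0 => i _; rewrite exprn_ge0.
have vS : `|v| <= S `^ k%:R^-1.
  apply: norm_le_coord; first exact: powR_ge0.
  move=> i; have -> : `|v ord0 i| = (`|v ord0 i| ^+ k) `^ k%:R^-1.
    by rewrite -powR_mulrn // -powRrM mulfV ?powRr1 // pnatr_eq0 -lt0n.
  rewrite ge0_ler_powR ?nnegrE ?invr_ge0 ?exprn_ge0 //.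
  by rewrite /S (bigD1 i) //= lerDl sumr_ge0 // => j _; rewrite exprn_ge0.
apply: (@le_trans _ _ ((S `^ k%:R^-1) ^+ k)); first by rewrite ler_pXn2r ?nnegrE ?powR_ge0.
by rewrite -powR_mulrn ?powR_ge0 // -powRrM mulVf ?powRr1 // pnatr_eq0 -lt0n.
Qed.

(** Valid for every [v], also when [x + v] is outside [D]. For [|v| <= r / 64] the cubic remainder
    is split by [B * n ^+ 3 <= eta * n ^+ 2 + B ^+ 2 / eta * n ^+ 4], where [n = |v|]; otherwise all
    terms on the left are dominated by a multiple of [n ^+ 4]. Second and fourth moments of an
    increment are of first and second order in time, so the part without the small factor [eta] is
    of second order. *)
Lemma taylor_bound (u Phi : V -> R) (D K : set V) (r M : R) :
  open D -> harmonic_on u D -> 0 < r -> 0 <= M ->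
  (forall x, K x -> forall y, `|y - x| <= r -> D y) ->
  (forall y, D y -> Phi y = u y) -> (forall y, `|Phi y| <= M) ->
  exists2 B : R, 0 <= B & forall eta : R, 0 < eta -> exists2 C : R, 0 <= C &
  forall x, K x -> [/\ forall i, `|partial i u x| <= B,
    forall i j, `|partial j (partial i u) x| <= B &
    forall v : V, `|Phi (x + v) - Phi x - \sum_i partial i u x * v ord0 i -
      2^-1 * \sum_i \sum_j partial j (partial i u) x * (v ord0 i * v ord0 j)| <=
      \sum_i (eta * v ord0 i ^+ 2 + C * v ord0 i ^+ 4)].
Proof.
move=> oD uD r0 M0 KD Pu PM.
have [B B0 HB] := harmonic_taylor oD uD r0 M0.
exists B => // eta eta0.
(* For [|v| > r / 64] one has [q * |v| >= 1], so that lower powers of [|v|] can be raised to the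
   fourth; the last three summands of [C] come from this. *)
pose q := (r / 64)^-1; have q0 : 0 < q by rewrite invr_gt0; lra.
have qr : r / 64 * q = 1 by rewrite mulfV // gt_eqF //; lra.
have dd : 0 <= d%:R :> R by [].
pose C := B ^+ 2 / eta + (2 * M * q ^+ 4 + d%:R * B * q ^+ 3 + (d%:R ^+ 2 * B * q ^+ 2)).
have qk k : 0 <= q ^+ k by rewrite exprn_ge0 // ltW.
have C1 : 0 <= B ^+ 2 / eta by rewrite divr_ge0 ?sqr_ge0 // ltW.
have C2 : 0 <= 2 * M * q ^+ 4 by exact: mulr_ge0 (mulr_ge0 (ler0n R 2) M0) (qk 4%N).
have C3 : 0 <= d%:R * B * q ^+ 3 by exact: mulr_ge0 (mulr_ge0 dd B0) (qk 3%N).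
have C4 : 0 <= d%:R ^+ 2 * B * q ^+ 2 by exact: mulr_ge0 (mulr_ge0 (sqr_ge0 _) B0) (qk 2%N).
exists C; first by rewrite /C !addr_ge0.
move=> x Kx.
have xD y : `|y - x| <= r -> D y by exact: KD.
have [|h1 h2 h3] := HB x xD; first by move=> y /xD Dy; rewrite -Pu.
split => // v.
have Dx : D x by apply: xD; rewrite subrr normr0 ltW.
set n := `|v|.
have n0 : 0 <= n by exact: normr_ge0.
have key : eta * n ^+ 2 + C * n ^+ 4 <= \sum_i (eta * v ord0 i ^+ 2 + C * v ord0 i ^+ 4).
  rewrite big_split /= -!mulr_sumr; apply: lerD; apply: ler_wpM2l.
  - exact: ltW.
  - rewrite (le_trans (norm_sum_pow v (isT : 0 < 2)%N)) // ler_sum // => i _.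
    by rewrite -normrX ger0_norm // sqr_ge0.
  - by rewrite /C !addr_ge0.
  - rewrite (le_trans (norm_sum_pow v (isT : 0 < 4)%N)) // ler_sum // => i _.
    by rewrite -normrX ger0_norm // (_ : 4 = 2 * 2)%N // exprM sqr_ge0.
apply: le_trans key.
have [nr|nr] := leP n (r / 64).
  have := h3 v nr; rewrite /hessian_form /dotR.
  have Dv : D (x + v) by apply: xD; rewrite addrC addKr; apply: le_trans nr _; lra.
  rewrite !Pu // [_ / 2]mulrC (eq_bigr (fun i => partial i u x * v ord0 i)); last first.
    by move=> i _; rewrite mxE.
  rewrite -/n => h; apply: le_trans h _.
  have h : eta * n ^+ 2 + B ^+ 2 / eta * n ^+ 4 - B * n ^+ 3 =
      n ^+ 2 / eta * ((eta - B * n / 2) ^+ 2 + 3 / 4 * (B * n) ^+ 2) by field; rewrite gt_eqF.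
  have h0 : 0 <= n ^+ 2 / eta * ((eta - B * n / 2) ^+ 2 + 3 / 4 * (B * n) ^+ 2).
    rewrite mulr_ge0 ?divr_ge0 ?sqr_ge0 ?(ltW eta0) // addr_ge0 ?sqr_ge0 //.
    by rewrite mulr_ge0 ?sqr_ge0 //; lra.
  rewrite -h in h0.
  have n4 : 0 <= n ^+ 4 by rewrite exprn_ge0.
  rewrite /C mulrDl; set z := (_ + _ + _) * n ^+ 4.
  have z0 : 0 <= z by rewrite /z mulr_ge0 // !addr_ge0.
  lra.
have vi i : `|v ord0 i| <= n by exact: coord_le_norm.
have g1 : `|\sum_i partial i u x * v ord0 i| <= d%:R * B * n.
  apply: le_trans (ler_norm_sum _ _ _) _.
  rewrite -mulrA -[d in leRHS]card_ord -sum1_card natr_sum mulr_suml ler_sum // => i _.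
  by rewrite mul1r normrM ler_pM.
have g2 : `|\sum_i \sum_j partial j (partial i u) x * (v ord0 i * v ord0 j)| <= d%:R ^+ 2 * B * n ^+ 2.
  apply: le_trans (ler_norm_sum _ _ _) _.
  rewrite expr2 -!mulrA -[d in X in X * _]card_ord -sum1_card natr_sum mulr_suml ler_sum // => i _.
  rewrite mul1r; apply: le_trans (ler_norm_sum _ _ _) _.
  rewrite -[d in leRHS]card_ord -sum1_card natr_sum mulr_suml ler_sum // => j _.
  by rewrite mul1r !normrM ler_pM // ?mulr_ge0 // expr2 ler_pM.
have g3 := PM (x + v); have g4 := PM x.
have qn : 1 <= q * n by rewrite -qr mulrC ler_pM2l // ltW.
have p3 : 1 <= (q * n) ^+ 3 by rewrite expr_ge1 // (le_trans ler01).
have p2 : 1 <= (q * n) ^+ 2 by rewrite expr_ge1 // (le_trans ler01).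
have p4 : 1 <= (q * n) ^+ 4 by rewrite expr_ge1 // (le_trans ler01).
have m1 : 2 * M <= 2 * M * q ^+ 4 * n ^+ 4.
  by rewrite -mulrA -exprMn ler_peMr // mulr_ge0.
have m2 : d%:R * B * n <= d%:R * B * q ^+ 3 * n ^+ 4.
  have -> : d%:R * B * q ^+ 3 * n ^+ 4 = d%:R * B * n * (q * n) ^+ 3 by ring.
  by rewrite ler_peMr // !mulr_ge0.
have m3 : d%:R ^+ 2 * B * n ^+ 2 <= d%:R ^+ 2 * B * q ^+ 2 * n ^+ 4.
  have -> : d%:R ^+ 2 * B * q ^+ 2 * n ^+ 4 = d%:R ^+ 2 * B * n ^+ 2 * (q * n) ^+ 2 by ring.
  by rewrite ler_peMr // !mulr_ge0 ?sqr_ge0.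
have e2 : 0 <= eta * n ^+ 2 by rewrite mulr_ge0 ?sqr_ge0 // ltW.
have c1 : 0 <= B ^+ 2 / eta * n ^+ 4 by rewrite mulr_ge0 // exprn_ge0.
rewrite /C !mulrDl.
move: g1 g2 g3 g4; rewrite !ler_norml => /andP[a1 a2] /andP[b1 b2] /andP[a3 a4] /andP[b3 b4].
have n2 : 0 <= d%:R ^+ 2 * B * n ^+ 2 by rewrite !mulr_ge0 ?sqr_ge0.
by apply/andP; split; lra.
Qed.

End Remainder.

(** * Mean increment over one time step *)

Section OneStep.
Context (R : realType) (d : nat) (dO : measure_display) (Omega : measurableType dO).
Local Notation V := 'rV[R]_d.
Variables (P : probability Omega R) (X : R -> Omega -> V) (x0 : V).
Hypothesis hB : is_brownian P X x0.

(** Partial derivatives of [u] are continuous on [D] only, so the superlevel sets of [g] are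
    controlled on the event [A] alone; multiplication by the indicator extends [g] to the whole
    sample space. *)
Lemma salg_mask (S : set (set Omega)) (A : set Omega) (g : Omega -> R) (c : R) :
  sigma_algebra setT S -> S A -> S (A `&` [set w | c < g w]) ->
  S [set w | c < \1_A w * g w].
Proof.
move=> hS SA SAg.
have -> : [set w | c < \1_A w * g w] =
    (A `&` [set w | c < g w]) `|` (~` A `&` (if c < 0 then setT else set0)).
  apply/seteqP; split => w /=; rewrite indicE.
    have [Aw|Aw] := boolP (w \in A); rewrite ?mul1r ?mul0r.
      by move=> h; left; split => //; rewrite inE in Aw.
    by move=> ->; right; split => // /mem_set; exact/negP.
  case=> [[Aw h]|[Aw]]; first by rewrite mem_set // mul1r.
  by case: ifP => //; rewrite memNset // mul0r.
apply: (salg_setU hS) => //; apply: (salg_setI hS); first exact: salg_setC.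
by case: ifP => _; [exact: salg_setT|exact: salg_set0].
Qed.

Lemma measurable_coord_process t i : measurable_fun setT (fun w => X t w ord0 i).
Proof. by case: hB. Qed.

Lemma open_superlevel (Phi : V -> R) (c : R) : continuous Phi -> open [set y | c < Phi y].
Proof.
move=> cP; apply: (@open_comp _ _ Phi [set z | c < z]) => [y _|]; first exact: cP.
exact: open_gt.
Qed.

Lemma measurable_process (t : R) (B : set V) : borelRd B -> measurable (X t @^-1` B).
Proof.
apply: salg_borel_preimage; first exact: salg_measurable.
by move=> i C mC; rewrite -[_ @^-1` _]setTI; exact: measurable_coord_process.
Qed.

Lemma measurable_comp_process (Phi : V -> R) (t : R) : continuous Phi ->
  measurable_fun setT (fun w => Phi (X t w)).
Proof.
move=> cP; apply: measurable_fun_gt => c; apply: (@measurable_process t [set y | c < Phi y]).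
by apply: open_borelRd; exact: open_superlevel.
Qed.

Lemma open_gt_partial (D : set V) (g : V -> R) (c : R) : open D ->
  (forall y, D y -> {for y, continuous g}) -> open (D `&` [set y | c < g y]).
Proof.
move=> oD cg; rewrite openE => y [Dy cy]; apply: filterI; first exact: open_near.
by have := cg y Dy => /(_ [set z | c < z]); apply; exact: lt_nbhsr.
Qed.

(* Taylor's formula at [X s]: the first-order terms and the centered
   second-order terms are orthogonal to the past, the means of the second-order
   terms add up to the Laplacian, and the remainder is controlled by second and
   fourth moments of the increments. *)
Lemma one_step (u Phi : V -> R) (D K : set V) (r M : R) :
  open D -> harmonic_on u D -> 0 < r -> 0 <= M -> borelRd K ->
  (forall x, K x -> forall y, `|y - x| <= r -> D y) -> continuous Phi ->
  (forall y, D y -> Phi y = u y) -> (forall y, `|Phi y| <= M) ->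
  forall eta : R, 0 < eta -> exists2 C : R, 0 <= C & forall (s t : R) A, 0 <= s -> s < t ->
    nat_filtration X s A -> A `<=` X s @^-1` K ->
    `|\int[P]_(w in A) (Phi (X t w) - Phi (X s w))| <= eta * (t - s) + C * (t - s) ^+ 2.
Proof.
move=> oD uD r0 M0 bK KD cP Pu PM eta eta0.
have [B B0 HB] := taylor_bound oD uD r0 M0 KD Pu PM.
have dd : 0 < d.+1%:R :> R by [].
have [|C C0 HC] := HB (eta / d.+1%:R); first by rewrite divr_gt0.
exists (d%:R * (3 * C)); first by rewrite !mulr_ge0.
move=> s t A s0 st FA AK.
have mT := @measurableT _ Omega.
have hS := nat_filtration_salg X s.
have Sm : nat_filtration X s `<=` measurable by apply: nat_filtration_measurable; exact: measurable_coord_process.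
have mA : measurable A by exact: Sm.
have KD' y : K y -> D y by move=> /KD; apply; rewrite subrr normr0 ltW.
pose inc (i : 'I_d) w := X t w ord0 i - X s w ord0 i.
have incE i w : inc i w = (X t w - X s w) ord0 i by rewrite !mxE.
pose mask (g : V -> R) w := \1_A w * g (X s w).
have mask_ok g : (forall y, D y -> {for y, continuous g}) -> (forall y, K y -> `|g y| <= B) ->
    (forall w, `|mask g w| <= B) /\ (forall c : R, nat_filtration X s [set w | c < mask g w]).
  move=> cg gB; split=> [w|c].
    rewrite /mask indicE; have [Aw|_] := boolP (w \in A); rewrite ?mul1r ?mul0r ?normr0 //.
    by apply: gB; apply: AK; rewrite inE in Aw.
  apply: (@salg_mask _ A (fun w => g (X s w)) c hS FA).
  rewrite (_ : _ `&` _ = A `&` X s @^-1` (D `&` [set y | c < g y])).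
    apply: (salg_setI hS) => //; apply: nat_filtration_borel => //.
    by apply: open_borelRd; exact: open_gt_partial.
  by apply/seteqP; split => w /= [Aw h]; split => //; [split => //; exact/KD'/AK|case: h].
pose Y i := mask (partial i u).
pose Y2 i j := mask (partial j (partial i u)).
pose W i j w := inc i w * inc j w - (i == j)%:R * (t - s).
have iW i j A' : nat_filtration X s A' -> Rintegrable P A' (W i j) /\ \int[P]_(w in A') W i j w = 0.
  move=> FA'; have [h1 h2] := increment_mixed hB s0 st i j FA'; have mA' := Sm _ FA'.
  have ic : Rintegrable P A' (fun=> (i == j)%:R * (t - s)).
    by apply: (@Rintegrable_bounded _ _ _ _ _ _ `|(i == j)%:R * (t - s)|) => //; exact: measurable_cst.
  split; first exact: RintegrableB.
  by rewrite (RintegralB mA' h1 ic) h2 Rintegral_cst // subrr.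
have FT := salg_setT hS.
have YI i : Rintegrable P setT (fun w => Y i w * inc i w) /\ \int[P]_w (Y i w * inc i w) = 0.
  have [|y Ky|b1 b2] := mask_ok (partial i u).
  - by move=> y /uD[_ h _ _]; have [] := h i.
  - by have [h _ _] := HC y Ky.
  apply: (Rintegral_mul_eq0 hS Sm) b1 b2; first by have [] := increment_first hB s0 st i FT.
  by move=> A' FA'; have [] := increment_first hB s0 st i FA'.
have Y2I i j : Rintegrable P setT (fun w => Y2 i j w * W i j w) /\ \int[P]_w (Y2 i j w * W i j w) = 0.
  have [|y Ky|b1 b2] := mask_ok (partial j (partial i u)).
  - by move=> y /uD[_ _ h _]; have [] := h i j.
  - by have [_ h _] := HC y Ky.
  apply: (Rintegral_mul_eq0 hS Sm) b1 b2; first by have [] := iW i j _ FT.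
  by move=> A' /(iW i j)[].
pose G1 w := \sum_i Y i w * inc i w.
pose G2 w := \sum_i \sum_j Y2 i j w * W i j w.
have iG1 : Rintegrable P setT G1 by apply: Rintegrable_sum => // i; have [] := YI i.
have iG2' i : Rintegrable P setT (fun w => \sum_j Y2 i j w * W i j w).
  by apply: Rintegrable_sum => // j; have [] := Y2I i j.
have iG2 : Rintegrable P setT G2 by exact: Rintegrable_sum.
have eG1 : \int[P]_w G1 w = 0.
  rewrite (Rintegral_sum _ mT); last by move=> i; have [] := YI i.
  by rewrite big1 // => i _; have [] := YI i.
have eG2 : \int[P]_w G2 w = 0.
  rewrite (Rintegral_sum _ mT) // big1 // => i _; rewrite (Rintegral_sum _ mT).
    by rewrite big1 // => j _; have [] := Y2I i j.
  by move=> j; have [] := Y2I i j.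
have ihG2 := RintegrableZ 2^-1 mT iG2.
have iG := RintegrableD mT iG1 ihG2.
have eG : \int[P]_w (G1 w + 2^-1 * G2 w) = 0.
  by rewrite (RintegralD mT iG1 ihG2) (RintegralZl _ mT iG2) eG1 eG2 mulr0 addr0.
pose F w := \1_A w * (Phi (X t w) - Phi (X s w)).
have iF : Rintegrable P setT F.
  apply: (@Rintegrable_bounded _ _ _ _ _ _ (2 * M)) => //.
    apply: measurable_funM; first exact: measurable_indic.
    by apply: measurable_funB; exact: measurable_comp_process.
  move=> w _; rewrite /F indicE; case: (_ \in _); rewrite ?mul1r ?mul0r ?normr0 ?mulr_ge0 //.
  by rewrite (le_trans (ler_normB _ _)) // mulr2n mulrDl mul1r lerD.
pose e := eta / d.+1%:R; have e0 : 0 < e by rewrite divr_gt0.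
pose Q w := \sum_i (e * inc i w ^+ 2 + C * inc i w ^+ 4).
have iQ1 i := increment_sqr hB s0 st i FT.
have iQ2 i := increment_fourth hB s0 st i FT.
have iQi i : Rintegrable P setT (fun w => e * inc i w ^+ 2 + C * inc i w ^+ 4).
  by apply: RintegrableD => //; apply: RintegrableZ => //; [have [] := iQ1 i|have [] := iQ2 i].
have iQ : Rintegrable P setT Q by exact: Rintegrable_sum.
have eQ : \int[P]_w Q w <= eta * (t - s) + d%:R * (3 * C) * (t - s) ^+ 2.
  rewrite (Rintegral_sum _ mT) //.
  apply: (@le_trans _ _ (\sum_(i < d) (e * (t - s) + 3 * C * (t - s) ^+ 2))).
    apply: ler_sum => i _; have [i1 e1] := iQ1 i; have [i2 e2] := iQ2 i.
    rewrite (RintegralD mT (RintegrableZ _ mT i1) (RintegrableZ _ mT i2)).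
    rewrite (RintegralZl _ mT i1) (RintegralZl _ mT i2) e1 probability_setT mulr1 lerD2l.
    move: e2; rewrite probability_setT mulr1 => e2; apply: le_trans (ler_wpM2l C0 e2) _.
    by rewrite le_eqVlt; apply/orP; left; apply/eqP; ring.
  rewrite sumr_const card_ord -[leLHS]mulr_natl mulrDr; apply: lerD; last first.
    by rewrite le_eqVlt; apply/orP; left; apply/eqP; ring.
  rewrite mulrA ler_wpM2r ?subr_ge0 ?(ltW st) // /e mulrCA ler_piMr ?(ltW eta0) //.
  by rewrite ler_pdivrMr // mul1r ler_nat.
have FGQ w : `|F w - (G1 w + 2^-1 * G2 w)| <= Q w.
  have Q0 : 0 <= Q w.
    apply: sumr_ge0 => i _; rewrite addr_ge0 // mulr_ge0 ?sqr_ge0 ?(ltW e0) //.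
    by rewrite (_ : 4 = 2 * 2)%N // exprM sqr_ge0.
  have [Aw|Aw] := boolP (w \in A); last first.
    have z g : mask g w = 0 by rewrite /mask indicE (negbTE Aw) mul0r.
    rewrite /F indicE (negbTE Aw) mul0r /G1 /G2 big1 ?big1 ?mulr0 ?addr0 ?subrr ?normr0 //.
      by move=> i _; rewrite big1 // => j _; rewrite /Y2 z mul0r.
    by move=> i _; rewrite /Y z mul0r.
  have z g : mask g w = g (X s w) by rewrite /mask indicE Aw mul1r.
  have Kw : K (X s w) by apply: AK; rewrite inE in Aw.
  have [_ _ /(_ (X t w - X s w))] := HC _ Kw.
  rewrite [X s w + _]addrC subrK.
  have <- : G1 w = \sum_i partial i u (X s w) * (X t w - X s w) ord0 i by apply: eq_bigr => i _; rewrite /Y z incE.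
  have <- : Q w = \sum_i (e * (X t w - X s w) ord0 i ^+ 2 + C * (X t w - X s w) ord0 i ^+ 4) by apply: eq_bigr => i _; rewrite incE.
  (* The centering terms in [W] add up to [t - s] times the Laplacian of [u] at [X s w], which is
     0. *)
  have <- : G2 w = \sum_i \sum_j partial j (partial i u) (X s w) *
      ((X t w - X s w) ord0 i * (X t w - X s w) ord0 j).
    rewrite /G2 (eq_bigr (fun i => \sum_j partial j (partial i u) (X s w) *
        ((X t w - X s w) ord0 i * (X t w - X s w) ord0 j) - partial i (partial i u) (X s w) * (t - s))).
      rewrite sumrB -mulr_suml; have [_ _ _ ->] := uD _ (KD' _ Kw).
      by rewrite mul0r subr0.
    move=> i _; rewrite /W /Y2; under eq_bigr do rewrite z mulrBr.
    rewrite sumrB; congr (_ - _); first by apply: eq_bigr => j _; rewrite !incE.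
    rewrite (bigD1 i) //= eqxx mul1r big1 ?addr0 // => j ji.
    by rewrite eq_sym (negbTE ji) mul0r mulr0.
  rewrite /F indicE Aw mul1r => h; apply: le_trans h; rewrite le_eqVlt; apply/orP; left.
  by apply/eqP; congr (`| _ |); ring.
have iFG := RintegrableB mT iF iG.
have -> : \int[P]_(w in A) (Phi (X t w) - Phi (X s w)) = \int[P]_w (F w - (G1 w + 2^-1 * G2 w)).
  by rewrite (RintegralB mT iF iG) eG subr0 /F Rintegral_indic_mul.
apply: le_trans (le_normr_Rintegral mT iFG) _; apply: le_trans eQ.
by apply: (le_Rintegral mT (Rintegrable_norm iFG) iQ) => w _; exact: FGQ.
Qed.

End OneStep.

(** * Exit times along a path *)

Section InnerRadius.
Context (R : realType) (d : nat).
Local Notation V := 'rV[R]_d.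
Implicit Types (O : set V) (x y : V).

Let radii O x := [set e : R | 0 <= e <= 1 /\ forall y, `|y - x| < e -> O y].

(* [min 1 (distance to the complement of O)], also when [O] is everything *)
Definition inrad O x : R := sup (radii O x).

Let radii_sup O x : has_sup (radii O x).
Proof.
split; first by exists 0; split => [|y]; rewrite ?lexx ?ler01 // ltNge normr_ge0.
by exists 1 => e [/andP[]].
Qed.

Lemma inrad_ge O x e : 0 <= e -> e <= 1 -> (forall y, `|y - x| < e -> O y) -> e <= inrad O x.
Proof. by move=> e0 e1 h; apply: (ub_le_sup (proj2 (radii_sup O x))); split => //; rewrite e0. Qed.

Lemma inrad_le O x b : (forall e, 0 <= e -> e <= 1 -> (forall y, `|y - x| < e -> O y) -> e <= b) ->
  inrad O x <= b.
Proof.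
move=> h; apply: ge_sup; first by case: (radii_sup O x).
by move=> e [/andP[e0 e1] H]; exact: h.
Qed.

Lemma inrad_ge0 O x : 0 <= inrad O x.
Proof. by apply: inrad_ge => // y; rewrite ltNge normr_ge0. Qed.

Lemma inrad_le1 O x : inrad O x <= 1. Proof. exact: inrad_le. Qed.

Lemma inrad_ball O x y : `|y - x| < inrad O x -> O y.
Proof.
move=> h; have e0 : 0 < inrad O x - `|y - x| by rewrite subr_gt0.
have [e [_ H]] := sup_adherent e0 (radii_sup O x).
by rewrite -/(inrad O x) subKr; exact: H.
Qed.

Lemma inrad_lipschitz O x y : `|inrad O x - inrad O y| <= `|x - y|.
Proof.
have H a b : inrad O a <= inrad O b + `|a - b|.
  apply: inrad_le => e e0 e1 h; have [eab|eab] := leP e `|a - b|.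
    by rewrite (le_trans eab) // lerDr inrad_ge0.
  rewrite -lerBlDr; apply: inrad_ge; [by rewrite subr_ge0 ltW| |].
    by rewrite lerBlDr (le_trans e1) // lerDl.
  move=> z zb; apply: h; rewrite -(subrKA b) (le_lt_trans (ler_normD _ _)) //.
  by rewrite [X in _ + X]distrC; lra.
have h1 := H x y; have h2 := H y x; rewrite distrC in h2.
by rewrite ler_norml; apply/andP; split; lra.
Qed.

Lemma continuous_inrad O : continuous (inrad O).
Proof.
move=> x; apply/continuous_atP => e e0; exists e => // y yx.
exact: le_lt_trans (inrad_lipschitz _ _ _) yx.
Qed.

Lemma inrad_gt0 O x : open O -> (0 < inrad O x) <-> O x.
Proof.
move=> /openP oO; split=> [r0|/oO[r r0 H]]; first by apply: (@inrad_ball _ x); rewrite subrr normr0.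
apply: (@lt_le_trans _ _ (Num.min r 1)); first by rewrite lt_min r0 ltr01.
apply: inrad_ge; first by rewrite le_min ler01 ltW.
  by rewrite ge_min lexx orbT.
by move=> y; rewrite lt_min => /andP[yr _]; apply: H; exact: ltW.
Qed.

End InnerRadius.

(** * Exit of a continuous path from a closed set *)

Section Paths.
Context (R : realType) (d : nat).
Local Notation V := 'rV[R]_d.
Variable g : R -> V.
Hypothesis cg : {within [set t : R | 0 <= t], continuous g}.

Lemma path_near (s e : R) : 0 <= s -> 0 < e ->
  exists2 r : R, 0 < r & forall t, 0 <= t -> `|t - s| < r -> `|g t - g s| < e.
Proof.
move=> s0 e0; move/subspace_continuousP: cg => /(_ s s0) /cvgrPdist_lt/(_ e e0).
rewrite near_withinE => /(@nbhs_normP _ R)[r /= r0 H]; exists r => // t t0 ts.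
by rewrite distrC; apply: H => //=; rewrite distrC.
Qed.

Lemma path_near_open (O : set V) (s : R) : open O -> 0 <= s -> O (g s) ->
  exists2 r : R, 0 < r & forall t, 0 <= t -> `|t - s| < r -> O (g t).
Proof.
move=> /openP oO s0 /oO[e e0 H]; have [r r0 Hr] := path_near s0 e0.
by exists r => // t t0 ts; apply: H; exact/ltW/Hr.
Qed.

(** The alternative [t = T] caps the time at [T] and keeps the set nonempty. *)
Definition hit (K : set V) (T : R) : R :=
  inf [set t | (0 <= t <= T /\ ~ K (g t)) \/ t = T].

Section Hit.
Variables (K : set V) (T : R).
Hypothesis T0 : 0 <= T.

Let hitset := [set t | (0 <= t <= T /\ ~ K (g t)) \/ t = T].

Let hitset_inf : has_inf hitset.
Proof.
split; first by exists T; right.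
by exists 0 => t [[/andP[]]|->].
Qed.

Lemma hit_ge b : (forall t, 0 <= t -> t < b -> t <= T -> K (g t)) -> b <= T -> b <= hit K T.
Proof.
move=> Kb bT; apply: lb_le_inf; first by case: hitset_inf.
move=> t [[/andP[t0 tT] nK]|->//]; rewrite leNgt; apply/negP => tb; exact/nK/Kb.
Qed.

Lemma hit_le t : 0 <= t -> t <= T -> ~ K (g t) -> hit K T <= t.
Proof.
move=> t0 tT nK; apply: ge_inf; first by case: hitset_inf.
by left; rewrite t0.
Qed.

Lemma hit_leT : hit K T <= T.
Proof. by apply: ge_inf; [case: hitset_inf|right]. Qed.

Lemma hit_ge0 : 0 <= hit K T.
Proof. by apply: hit_ge => // t t0; rewrite ltNge t0. Qed.

Lemma hit_adherent e : 0 < e ->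
  exists2 t, t < hit K T + e & (0 <= t <= T /\ ~ K (g t)) \/ t = T.
Proof. by move=> e0; have [t ht te] := inf_adherent e0 hitset_inf; exists t. Qed.

End Hit.

(* Index of the first grid time [j * del], [j < k], at which the path is outside
   [K], and [k] if there is none. *)
Fixpoint gstop (K : set V) (del : R) (k : nat) : nat :=
  if k is k'.+1 then
    if `[< forall j, (j <= k')%N -> K (g (j%:R * del)) >] then k else gstop K del k'
  else 0%N.

Lemma gstop_spec K del k : [/\ (gstop K del k <= k)%N,
  forall j, (j < gstop K del k)%N -> K (g (j%:R * del)) &
  (gstop K del k < k)%N -> ~ K (g ((gstop K del k)%:R * del))].
Proof.
elim: k => [//|k [h1 h2 h3]] /=; case: asboolP => [H|H].
  by split; rewrite ?ltnn // => j; rewrite ltnS => /H.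
split => //; first exact: leqW.
move=> _; move: h1; rewrite leq_eqVlt => /orP[/eqP E|]; last exact: h3.
rewrite E => Kk; apply: H => j; rewrite leq_eqVlt => /orP[/eqP ->//|jk].
by apply: h2; rewrite E.
Qed.

(** The grid time is [T] or a time outside [K], so it is never before [hit]. Conversely, the
    complement of [K] being open, a path that is outside [K] at time [s] is outside already at the
    last grid time before [s], if the mesh is fine. *)
Lemma gstop_cvg K T : closed K -> 0 < T ->
  (gstop K (T / n.+1%:R) n.+1)%:R * (T / n.+1%:R) @[n --> \oo] --> hit K T.
Proof.
move=> cK T0; have T0' := ltW T0.
pose del n : R := T / n.+1%:R.
have del0 n : 0 < del n by rewrite divr_gt0.
pose tn n : R := (gstop K (del n) n.+1)%:R * del n.
have delT n : n.+1%:R * del n = T by rewrite /del mulrC divfK.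
have lo n : hit K T <= tn n.
  have [h1 h2 h3] := gstop_spec K (del n) n.+1; rewrite /tn.
  move: h1; rewrite leq_eqVlt => /orP[/eqP ->|h]; first by rewrite delT; exact: hit_leT.
  apply: hit_le => //; last exact: h3.
    by rewrite mulr_ge0 // ltW.
  by rewrite -(delT n) ler_wpM2r ?ler_nat ?(ltW (del0 _)) // ltnW.
apply/cvg_seqP => e e0.
have [s se Hs] := hit_adherent K T0' e0.
have up N : (forall n, (N <= n)%N -> tn n <= s) ->
    exists N, forall n, (N <= n)%N -> `|tn n - hit K T| < e.
  by move=> h; exists N => n /h hn; rewrite ger0_norm ?subr_ge0 ?lo //; lra.
case: Hs => [[/andP[s0 sT] nK]|sT]; last first.
  apply: (up 0%N) => n _; rewrite sT -(delT n) ler_wpM2r ?(ltW (del0 _)) // ler_nat.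
  by have [] := gstop_spec K (del n) n.+1.
have [r r0 Hr] := path_near_open (closed_openC cK) s0 nK.
have [N] := ltr_add_invr (y := 0) (x := r / T) (divr_gt0 r0 T0).
rewrite add0r ltr_pdivlMr // mulrC => hN.
apply: (up N) => n Nn.
pose j := Num.truncn (s / del n).
have /andP[j1 j2] : j%:R <= s / del n < j.+1%:R by apply: truncn_itv; rewrite divr_ge0 // ltW.
rewrite ler_pdivlMr // in j1; rewrite ltr_pdivrMr // -natr1 mulrDl mul1r in j2.
have dr : del n < r.
  apply: le_lt_trans hN; rewrite /del ler_wpM2l // lef_pV2 ?posrE // ler_nat.
  by rewrite ltnS.
have nKj : ~ K (g (j%:R * del n)).
  by apply: Hr; [rewrite mulr_ge0 // ltW|rewrite distrC ger0_norm ?subr_ge0 //; lra].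
have [_ h2 _] := gstop_spec K (del n) n.+1.
apply: le_trans j1; rewrite /tn ler_wpM2r ?(ltW (del0 _)) // ler_nat leqNgt.
by apply/negP => /h2.
Qed.

End Paths.

(** * Exit of a continuous path from an open set *)

Section Exit.
Context (R : realType) (d : nat).
Local Notation V := 'rV[R]_d.
Variables (g : R -> V) (D : set V).
Hypothesis cg : {within [set t : R | 0 <= t], continuous g}.
Hypotheses (oD : open D) (g0 : D (g 0)) (gout : exists q : nat, ~ D (g q%:R)).

Let E := [set t : R | 0 < t /\ ~ D (g t)].
Let tau := inf E.

Let E_inf : has_inf E.
Proof.
split; last by exists 0 => t [/ltW].
have [q nD] := gout; exists q%:R; split => //; rewrite ltr0n lt0n; apply/eqP => q0.
by apply: nD; rewrite q0.
Qed.

Lemma exit_ge0 : 0 <= tau.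
Proof. by apply: lb_le_inf; [case: E_inf|move=> t [/ltW]]. Qed.

Lemma exit_before t : 0 <= t -> t < tau -> D (g t).
Proof.
rewrite le_eqVlt => /orP[/eqP <- //|t0] tt; apply: contrapT => nD.
have : tau <= t by apply: ge_inf; [case: E_inf|].
by rewrite leNgt tt.
Qed.

Lemma exit_notin : ~ D (g tau).
Proof.
move=> Dt; have [r r0 H] := path_near_open cg oD exit_ge0 Dt.
have [t [t0 nD] te] := inf_adherent r0 E_inf.
have tt : tau <= t by apply: ge_inf; [case: E_inf|].
by apply: nD; apply: H; [exact: ltW|rewrite ger0_norm ?subr_ge0 //; rewrite -/tau in te; lra].
Qed.

Lemma exit_gt0 : 0 < tau.
Proof.
rewrite lt_neqAle exit_ge0 andbT; apply/eqP => t0; apply: exit_notin; by rewrite -t0.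
Qed.

Lemma exit_bdry : bdry D (g tau).
Proof.
split; last by rewrite (interior_id _).1 //; exact: exit_notin.
move=> B /near_ballP[e e0 HB]; have [r r0 Hr] := path_near cg exit_ge0 e0.
pose t := Num.max 0 (tau - r / 2).
have t0 : 0 <= t by rewrite le_max lexx.
have tt : t < tau by rewrite gt_max exit_gt0 /=; lra.
have tr : tau - r / 2 <= t by rewrite le_max lexx orbT.
exists (g t); split; first exact: exit_before.
by apply: HB; apply: Hr => //; rewrite distrC gtr0_norm ?subr_gt0 //; lra.
Qed.

(** On [[0, tau - e / 2]] the inner radius along the path has a positive minimum, so for large [n]
    the path stays in the [n]-th inner set until then; at time [tau] it is outside [D], hence
    outside every inner set. The horizon [n.+1] eventually exceeds [tau]. *)
Lemma hit_exit_cvg :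
  hit g [set x | n.+1%:R^-1 <= inrad D x] n.+1%:R @[n --> \oo] --> tau.
Proof.
apply/cvg_seqP => e e0.
have [m m0 Hm] : exists2 m : R, 0 < m & forall t, 0 <= t -> t <= tau - e / 2 -> m <= inrad D (g t).
  have [b0|b0] := ltP (tau - e / 2) 0.
    by exists 1 => // t t0 tb; have := lt_le_trans (le_lt_trans tb b0) t0; rewrite ltxx.
  have [|c] := @EVT_min R (fun t => inrad D (g t)) 0 (tau - e / 2) b0.
    apply/subspace_continuousP => s; rewrite /= in_itv /= => /andP[s0 sb].
    apply/cvgrPdist_lt => q q0; have [r r0 Hr] := path_near cg s0 q0.
    rewrite near_withinE; apply/(@nbhs_normP _ R); exists r => //= t ts; rewrite in_itv /= => /andP[t0 _].
    rewrite distrC (le_lt_trans (inrad_lipschitz _ _ _)) //; apply: Hr => //.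
    by rewrite distrC.
  rewrite in_itv /= => /andP[c0 cb] Hc; exists (inrad D (g c)).
    by apply/(inrad_gt0 _ oD); apply: exit_before => //; apply: le_lt_trans cb _; lra.
  by move=> t t0 tb; apply: Hc; rewrite in_itv /= t0.
have [N1] := ltr_add_invr (y := 0) (x := m) m0; rewrite add0r => hN1.
pose N2 := Num.truncn tau.
have hN2 : tau < N2.+1%:R by exact: truncnS_gt.
exists (maxn N1 N2) => n; rewrite geq_max => /andP[n1 n2].
have n1' : n.+1%:R^-1 <= m.
  by apply: le_trans (ltW hN1); rewrite lef_pV2 ?posrE // ler_nat ltnS.
have n2' : tau <= n.+1%:R by apply: le_trans (ltW hN2) _; rewrite ler_nat ltnS.
have nn0 : 0 <= n.+1%:R :> R by [].
have up : hit g [set x | n.+1%:R^-1 <= inrad D x] n.+1%:R <= tau.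
  apply: hit_le => //; first exact: exit_ge0.
  move=> /= h; apply: exit_notin; apply/(inrad_gt0 _ oD); apply: lt_le_trans h.
  by rewrite invr_gt0.
have lo : tau - e / 2 <= hit g [set x | n.+1%:R^-1 <= inrad D x] n.+1%:R.
  apply: hit_ge => //; last by lra.
  by move=> t t0 tb _ /=; apply: le_trans n1' (Hm _ t0 (ltW tb)).
by rewrite ltr_norml; apply/andP; split; lra.
Qed.

End Exit.

(** * The exit law of Brownian motion *)

Section FullMeasure.
Context (R : realType) (dO : measure_display) (Omega : measurableType dO).
Variable P : probability Omega R.

Lemma Rintegral_full (A : set Omega) (f : Omega -> R) : measurable A -> P A = 1%E ->
  Rintegrable P setT f -> \int[P]_w f w = \int[P]_(w in A) f w.
Proof.
move=> mA PA If; have mC : measurable (~` A) by exact: measurableC.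
have PC : P (~` A) = 0 by rewrite probability_setC // PA subee.
congr fine; rewrite (negligible_integral mC measurableT If PC).
by congr integral; rewrite setTD setCK.
Qed.

Lemma Rintegral_ge (A : set Omega) (f : Omega -> R) (c : R) : measurable A ->
  Rintegrable P A f -> (forall w, A w -> c <= f w) -> c * fine (P A) <= \int[P]_(w in A) f w.
Proof.
move=> mA If cf; rewrite -Rintegral_cst //; apply: (le_Rintegral mA) => //.
by apply: (@Rintegrable_bounded _ _ _ _ _ _ `|c|) => //; exact: measurable_cst.
Qed.

End FullMeasure.

Lemma path_cvg (R : realType) (d : nat) (g : R -> 'rV[R]_d) (Phi : 'rV[R]_d -> R)
    (t_ : nat -> R) (t : R) :
  {within [set t : R | 0 <= t], continuous g} -> continuous Phi ->
  (forall n, 0 <= t_ n) -> 0 <= t -> t_ n @[n --> \oo] --> t ->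
  Phi (g (t_ n)) @[n --> \oo] --> Phi (g t).
Proof.
move=> cg cP tn0 t0 /cvg_seqP tt; apply/cvg_seqP => e e0.
have /continuous_atP/(_ e e0)[r r0 Hr] := cP (g t).
have [q q0 Hq] := path_near cg t0 r0; have [N HN] := tt q q0.
by exists N => n /HN h; apply: Hr; exact: Hq.
Qed.

(** * Exit law of continuous data by stopping on a grid *)

Section ExitLaw.
Context (R : realType) (d : nat) (dO : measure_display) (Omega : measurableType dO).
Local Notation V := 'rV[R]_d.
Variables (P : probability Omega R) (X : R -> Omega -> V) (x0 : V) (D : set V).
Hypothesis hB : is_brownian P X x0.
Hypothesis d0 : (0 < d)%N.
Hypotheses (oD : open D) (Dx0 : D x0).
Variable M : R.
Hypothesis DM : forall x, D x -> `|x| <= M.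

Let cX w : {within [set t : R | 0 <= t], continuous (X^~ w)}.
Proof. by case: hB. Qed.

Let start : P (X 0 @^-1` [set x0]) = 1%E.
Proof. by case: hB. Qed.

Let mstart : measurable (X 0 @^-1` [set x0]).
Proof.
apply: (measurable_process hB); apply: closed_borelRd.
by apply: accessible_closed_set1; exact: hausdorff_accessible.
Qed.

(** Points of [D] have norm at most [M], so a coordinate of an increment between two points of [D],
    times [frq], is at most 1 in absolute value. *)
Let frq : R := (2 * (`|M| + 1))^-1.

Let frq_gt0 : 0 < frq.
Proof. by rewrite invr_gt0 mulr_gt0 // ltr_wpDl. Qed.

(* As long as the path stays in [D] its increments are bounded by [2M], so
   that [1 + cos (frq * increment) >= 3/2], while the mean of this quantity given
   the past is close to [1] over long time steps. *)
Lemma increment_decay (s t : R) (A B : set Omega) : 0 <= s -> s < t -> 6 / frq ^+ 2 <= t - s ->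
  nat_filtration X s A -> measurable B -> B `<=` A ->
  (forall w, B w -> D (X s w) /\ D (X t w)) -> fine (P B) <= 5 / 6 * fine (P A).
Proof.
move=> s0 st ts FA mB BA BD.
have mA : measurable A by exact: nat_filtration_measurable (measurable_coord_process hB) _ FA.
pose i0 : 'I_d := Ordinal d0.
pose u := evec R i0.
have uu : dotR u u = 1 by rewrite dot_evec evecE eqxx.
pose f w := 1 + cos (frq * dotR u (X t w - X s w)).
have mf A' : measurable_fun A' f.
  apply: measurable_funD; first exact: measurable_cst.
  apply: (measurableT_comp (continuous_measurable_fun (@continuous_cos R))).
  apply: measurable_funM; first exact: measurable_cst.
  rewrite (_ : (fun w => _) = (fun w => X t w ord0 i0 - X s w ord0 i0)); last first.
    by apply/funext => w; rewrite dot_evec !mxE.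
  by apply: measurable_funTS; apply: measurable_funB; exact: (measurable_coord_process hB).
have fint A' : measurable A' -> Rintegrable P A' f.
  move=> mA'; apply: (@Rintegrable_bounded _ _ _ _ _ _ 2) => // w _.
  by apply: le_trans (ler_normD _ _) _; rewrite normr1 (_ : 2 = 1 + 1) // lerD2l cos_max.
(* A time step of at least [6 / frq ^+ 2] makes the Gaussian factor at most [1 / (1 + 3)]. With the
   lower bound [3 / 2] on [B] this gives the ratio [(5 / 4) / (3 / 2) = 5 / 6]. *)
have eA : \int[P]_(w in A) f w <= 5 / 4 * fine (P A).
  have i1 : Rintegrable P A (fun=> 1).
    by apply: (@Rintegrable_bounded _ _ _ _ _ _ 1) => // w _; rewrite normr1.
  have i2 : Rintegrable P A (fun w => cos (frq * dotR u (X t w - X s w))).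
    have := RintegrableB mA (fint A mA) i1; congr (Rintegrable _ _ _).
    by apply/funext => w; rewrite /f addrC addKr.
  rewrite (RintegralD mA i1 i2) Rintegral_cst // (increment_cos hB s0 st u frq FA) uu !mul1r.
  have p0 : 0 <= fine (P A) by exact/fine_ge0/measure_ge0.
  have f2 : 0 < frq ^+ 2 by rewrite exprn_gt0.
  have y6 : 6 <= frq ^+ 2 * (t - s) by rewrite -ler_pdivrMl // mulrC.
  set y := frq ^+ 2 * (t - s) in y6 *.
  have h1 := expR_ge1Dx (y / 2); have h2 := expR_gt0 (- y / 2).
  have E : expR (- y / 2) * expR (y / 2) = 1 by rewrite -expRD mulNr addNr expR0.
  have h3 : expR (- y / 2) <= 1 / 4 by nra.
  rewrite (_ : 5 / 4 * _ = fine (P A) + 1 / 4 * fine (P A)); last by field.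
  by rewrite lerD2l ler_wpM2r.
have eB : 3 / 2 * fine (P B) <= \int[P]_(w in B) f w.
  apply: Rintegral_ge => // [|w Bw]; first exact: fint.
  have [D1 D2] := BD w Bw.
  rewrite /f dot_evec; set y := frq * _.
  have y1 : `|y| <= 1.
    rewrite normrM gtr0_norm // -ler_pdivlMl // mulr1 invrK.
    rewrite (le_trans (coord_le_norm _ _)) // (le_trans (ler_normB _ _)) //.
    have := DM D1; have := DM D2; have := ler_norm M; lra.
  have := one_sub_cos_le y; rewrite ler_norml => /andP[h _].
  have : y ^+ 2 <= 1 by rewrite -[y ^+ 2]ger0_norm ?sqr_ge0 // normrX expr_le1.
  lra.
have BfA : \int[P]_(w in B) f w <= \int[P]_(w in A) f w.
  have mD : measurable (A `\` B) by exact: measurableD.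
  have E : A = B `|` (A `\` B) by rewrite setDUK.
  rewrite [in leRHS]E Rintegral_setU //; [|by rewrite -E; exact: fint|by apply/eqP/seteqP; split => w //= -[Bw [_ /(_ Bw)]]].
  rewrite lerDl; apply: Rintegral_ge0 => w _; have := cos_geN1 (frq * dotR u (X t w - X s w)).
  by rewrite /f; lra.
lra.
Qed.

Let mXD (t : R) : measurable (X t @^-1` D).
Proof. by apply: (measurable_process hB); exact: open_borelRd. Qed.

Let measurable_stay : measurable [set w | forall q : nat, D (X q%:R w)].
Proof.
rewrite (_ : mkset _ = \bigcap_(q : nat) (X q%:R @^-1` D)); first exact: bigcapT_measurable.
by apply/seteqP; split => w /= h => [q _|q]; exact: h.
Qed.

(** By [increment_decay] the probability of being in [D] at all the times [0, m, ..., n * m] is at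
    most [(5 / 6) ^+ n], for an integer [m] that is a long enough time step. *)
Lemma stay_null : P [set w | forall q : nat, D (X q%:R w)] = 0.
Proof.
set S := [set w | _].
have mS : measurable S by exact: measurable_stay.
pose m := (Num.truncn (6 / frq ^+ 2)).+1.
have m6 : 6 / frq ^+ 2 <= m%:R by apply/ltW; exact: truncnS_gt.
pose A n := [set w | forall j : 'I_n.+1, D (X (j * m)%:R w)].
have FA n : nat_filtration X (n * m)%:R (A n).
  apply: (salg_forall (nat_filtration_salg _ _)) => j.
  apply: (@nat_filtration_mono _ _ _ _ X (j * m)%:R); last first.
    by apply: nat_filtration_borel; [|exact: open_borelRd].
  by rewrite ler_nat leq_mul2r -ltnS ltn_ord orbT.
have mA n : measurable (A n) by exact: nat_filtration_measurable (measurable_coord_process hB) _ (FA n).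
have dec n : fine (P (A n)) <= (5 / 6) ^+ n.
  elim: n => [|n IH].
    by rewrite expr0 -lee_fin fineK ?fin_num_measure // probability_le1.
  rewrite exprS; apply: (@le_trans _ _ (5 / 6 * fine (P (A n)))); last by rewrite ler_wpM2l // divr_ge0.
  apply: (@increment_decay (n * m)%:R (n.+1 * m)%:R) => //.
  - by rewrite ltr_nat mulSn -{1}[(n * m)%N]add0n ltn_add2r.
  - by rewrite mulSn natrD addrK.
  - by move=> w Aw j; have := Aw (widen_ord (leqnSn _) j).
  - move=> w Aw; split; last by have := Aw ord_max.
    by have := Aw (widen_ord (leqnSn _) ord_max).
have le n : fine (P S) <= (5 / 6) ^+ n.
  apply: le_trans (dec n); apply: fine_le; rewrite ?fin_num_measure //.
  by apply: le_measure; rewrite ?inE // => w Sw j; exact: Sw.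
have z : fine (P S) <= 0.
  have cv : (5 / 6 : R) ^+ n @[n --> \oo] --> (0 : R).
    by apply: cvg_expr; rewrite ger0_norm ?divr_ge0 //; lra.
  rewrite -(cvg_lim _ cv) //; apply: limr_ge; first by apply/cvg_ex; exists 0.
  exact: nearW.
have : fine (P S) = 0 by apply/le_anti; rewrite z fine_ge0 // measure_ge0.
by move=> e; rewrite -[P S]fineK ?fin_num_measure // e.
Qed.

(** Only integer times are inspected, so that the event is measurable by countable operations. It
    asks for [X 0] in [D] rather than [X 0 = x0], so that one event serves for all starting points
    in [D]. *)
Definition exits : set Omega := X 0 @^-1` D `&` ~` [set w | forall q : nat, D (X q%:R w)].

Lemma measurable_exits : measurable exits.
Proof. by apply: measurableI => //; exact: measurableC. Qed.

Lemma exits_full : P exits = 1%E.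
Proof.
have mE := measurable_exits.
have mC : measurable (~` exits) by exact: measurableC.
have z : P (~` exits) = 0.
  apply/eqP; rewrite eq_le measure_ge0 andbT.
  have mS := measurable_stay.
  have m1 : measurable (~` (X 0 @^-1` [set x0])) by exact: measurableC.
  apply: (@le_trans _ _ (P (~` (X 0 @^-1` [set x0]) `|` [set w | forall q : nat, D (X q%:R w)]))).
    apply: le_measure; rewrite ?inE //; first exact: measurableU.
    move=> w /= nE; have [h|h] := pselect (X 0 w = x0); last by left.
    by right; apply: contrapT => nS; apply: nE; split => //=; rewrite h.
  apply: le_trans (measureU2 _ m1 mS) _.
  have z1 : P (~` (X 0 @^-1` [set x0])) = 0 by rewrite probability_setC // start subee.
  rewrite le_eqVlt; apply/orP; left; apply/eqP; transitivity (0 + 0 : \bar R)%E; last exact: adde0.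
  by congr (_ + _)%E; [exact: z1|exact: stay_null].
by have := probability_setC P mC; rewrite setCK z sube0.
Qed.

Lemma exits_path w : exits w -> D (X 0 w) /\ exists q : nat, ~ D (X q%:R w).
Proof.
move=> [h1 h2]; split => //; apply: contrapT => nq; apply: h2 => q.
by apply: contrapT => nD; apply: nq; exists q.
Qed.

Section Stopped.
Variables (Phi : V -> R) (B : R).
Hypotheses (cPhi : continuous Phi) (PhiB : forall y, `|Phi y| <= B).

Let stopped K (del : R) k w := Phi (X ((gstop (X^~ w) K del k)%:R * del) w).

Let survive (K : set V) (del : R) k := [set w | forall j : 'I_k.+1, K (X (j%:R * del) w)].

Let survive_filtration K del k : 0 <= del -> borelRd K ->
  nat_filtration X (k%:R * del) (survive K del k).
Proof.
move=> del0 bK; apply: (salg_forall (nat_filtration_salg _ _)) => j.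
apply: (@nat_filtration_mono _ _ _ _ X (j%:R * del)); last first.
  by apply: nat_filtration_borel => //; rewrite mulr_ge0.
by rewrite ler_wpM2r // ler_nat -ltnS ltn_ord.
Qed.

Let measurable_survive K del k : 0 <= del -> borelRd K -> measurable (survive K del k).
Proof.
move=> del0 bK; apply: (nat_filtration_measurable (measurable_coord_process hB)).
exact: survive_filtration.
Qed.

(** The telescoping: the stopped value changes at step [k] only on the event that the path was in
    [K] at all grid times up to [k], an event of the past of [k * del]. *)
Let stoppedS K del k w : stopped K del k.+1 w =
  stopped K del k w + \1_(survive K del k) w * (Phi (X (k.+1%:R * del) w) - Phi (X (k%:R * del) w)).
Proof.
rewrite /stopped /= indicE; case: asboolP => H.
  have sv : survive K del k w by move=> j; apply: H; rewrite -ltnS.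
  rewrite mem_set // mul1r; suff -> : gstop (X^~ w) K del k = k by rewrite addrC subrK.
  have [h1 _ h3] := gstop_spec (X^~ w) K del k.
  apply/eqP; move: h1; rewrite leq_eqVlt => /orP[//|lt]; exfalso.
  by apply: (h3 lt); apply: H; exact: ltnW.
rewrite memNset ?mul0r ?addr0 // => sv; apply: H => j jk.
by have := sv (Ordinal (n := k.+1) jk).
Qed.

Let measurable_stopped K del k : 0 <= del -> borelRd K -> measurable_fun setT (stopped K del k).
Proof.
move=> del0 bK; elim: k => [|k IH]; first exact: (@measurable_comp_process _ _ _ _ _ _ _ hB Phi (0%:R * del) cPhi).
rewrite (_ : stopped K del k.+1 = fun w => stopped K del k w +
  \1_(survive K del k) w * (Phi (X (k.+1%:R * del) w) - Phi (X (k%:R * del) w))); last first.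
  by apply/funext => w; exact: stoppedS.
apply: measurable_funD => //; apply: measurable_funM.
  by apply: measurable_indic; exact: measurable_survive.
by apply: measurable_funB; exact: (measurable_comp_process hB).
Qed.

Let at_hit K T w := Phi (X (hit (X^~ w) K T) w).

Let stopped_cvg K T w : closed K -> 0 < T ->
  stopped K (T / n.+1%:R) n.+1 w @[n --> \oo] --> at_hit K T w.
Proof.
move=> cK T0; apply: (@path_cvg R d (X^~ w) Phi) => //.
- by move=> n; rewrite mulr_ge0 // divr_ge0 // ltW.
- exact/hit_ge0/ltW.
- exact: gstop_cvg.
Qed.

Let iconst : Rintegrable P setT (fun=> B).
Proof. by apply: (@Rintegrable_bounded _ _ _ _ _ _ `|B|) => //; exact: measurable_cst. Qed.

Let at_hit_integral K T : closed K -> 0 < T -> Rintegrable P setT (at_hit K T) /\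
  \int[P]_w stopped K (T / n.+1%:R) n.+1 w @[n --> \oo] --> \int[P]_w at_hit K T w.
Proof.
move=> cK T0; apply: (Rdominated (g := fun=> B)) => //.
- by move=> n; apply: measurable_stopped; [rewrite divr_ge0 // ltW|exact: closed_borelRd].
- by move=> n w _; exact: PhiB.
- by move=> w _; exact: stopped_cvg.
Qed.

Definition inner (n : nat) : set V := [set x | n.+1%:R^-1 <= inrad D x].

Lemma closed_inner n : closed (inner n).
Proof.
apply: (@closed_comp _ _ (inrad D) [set z | n.+1%:R^-1 <= z]) => [y _|]; first exact: continuous_inrad.
exact: closed_ge.
Qed.

Let exit_val w := Phi (X (exit_time D X w) w).

Let at_hit_cvg w : exits w -> at_hit (inner n) n.+1%:R w @[n --> \oo] --> exit_val w.
Proof.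
move=> /exits_path[D0 Dq]; apply: (@path_cvg R d (X^~ w) Phi) => //.
- by move=> n; exact: hit_ge0.
- exact: (exit_ge0 (g := X^~ w)).
- exact: (hit_exit_cvg (g := X^~ w)).
Qed.

Lemma exit_integral : Rintegrable P exits exit_val /\
  \int[P]_(w in exits) at_hit (inner n) n.+1%:R w @[n --> \oo] --> \int[P]_(w in exits) exit_val w.
Proof.
apply: (Rdominated (g := fun=> B)) => //; first exact: measurable_exits.
- move=> n; apply: measurable_funTS; apply: (@Rintegrable_measurable _ _ _ P).
  by have [] := at_hit_integral (@closed_inner n) (ltr0Sn R n).
- by apply: (@Rintegrable_bounded _ _ _ _ _ _ `|B|) => //; exact: measurable_exits.
- by move=> n w _; exact: PhiB.
Qed.

Lemma start_integral : \int[P]_w Phi (X 0 w) = Phi x0.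
Proof.
rewrite (Rintegral_full mstart start); last first.
  by apply: (@Rintegrable_bounded _ _ _ _ _ _ B) => //; exact: (measurable_comp_process hB).
transitivity (\int[P]_(w in X 0 @^-1` [set x0]) Phi x0).
  by apply: eq_Rintegral => w; rewrite inE /= => ->.
have p1 : fine (P (X 0 @^-1` [set x0])) = 1 by rewrite start.
transitivity (Phi x0 * 1); last exact: mulr1.
by rewrite Rintegral_cst //; congr (_ * _); exact: p1.
Qed.

Variable u : V -> R.
Hypotheses (uD : harmonic_on u D) (Phiu : forall y, D y -> Phi y = u y).

(** With [N] grid steps of length [T / N] the accumulated error is at most
    [eta * T + C * T ^+ 2 / N]; first [N] tends to infinity for fixed [eta], then [eta] tends to
    0. *)
Let at_hit_mean n : \int[P]_w at_hit (inner n) n.+1%:R w = Phi x0.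
Proof.
set K := inner n; set T : R := n.+1%:R; have T0 : 0 < T by [].
have cK : closed K by exact: closed_inner.
have bK : borelRd K by exact: closed_borelRd.
(* Half of the inner radius guaranteed on [K], so that closed cubes of radius [r] stay in [D]. *)
pose r : R := n.+1%:R^-1 / 2; have r0 : 0 < r by rewrite divr_gt0 // invr_gt0.
have KD x : K x -> forall y, `|y - x| <= r -> D y.
  move=> Kx y yx; apply: (@inrad_ball _ _ D x); apply: lt_le_trans Kx.
  apply: le_lt_trans yx _; have : 0 < n.+1%:R^-1 :> R by rewrite invr_gt0.
  rewrite /r; move: (n.+1%:R^-1 : R) => z z0; lra.
have B0 : 0 <= B by exact: le_trans (normr_ge0 _) (PhiB x0).
have os := one_step hB oD uD r0 B0 bK KD cPhi Phiu PhiB.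
have step (eta C del : R) : 0 < del -> (forall (s t : R) A, 0 <= s -> s < t ->
    nat_filtration X s A -> A `<=` X s @^-1` K ->
    `|\int[P]_(w in A) (Phi (X t w) - Phi (X s w))| <= eta * (t - s) + C * (t - s) ^+ 2) ->
    forall k, `|\int[P]_w stopped K del k w - Phi x0| <= k%:R * (eta * del + C * del ^+ 2).
  move=> del0 H; elim=> [|k IH].
    rewrite mul0r /stopped /=; under eq_Rintegral do rewrite mul0r.
    by rewrite start_integral subrr normr0.
  have mT := @measurableT _ Omega.
  have i1 : Rintegrable P setT (stopped K del k).
    apply: (@Rintegrable_bounded _ _ _ _ _ _ B) => //.
      by apply: measurable_stopped => //; exact: ltW.
    by move=> w _; exact: PhiB.
  have msv := measurable_survive k (ltW del0) bK.
  have i2 : Rintegrable P setT (fun w => \1_(survive K del k) w *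
      (Phi (X (k.+1%:R * del) w) - Phi (X (k%:R * del) w))).
    apply: (@Rintegrable_bounded _ _ _ _ _ _ (B + B)) => //.
      apply: measurable_funM; first exact: measurable_indic.
      by apply: measurable_funB; exact: (measurable_comp_process hB).
    move=> w _; rewrite indicE; case: (_ \in _); rewrite ?mul1r ?mul0r ?normr0 ?addr_ge0 //.
    by rewrite (le_trans (ler_normB _ _)) // lerD.
  rewrite [X in `|X - _|](_ : _ = \int[P]_w stopped K del k w +
      \int[P]_(w in survive K del k) (Phi (X (k.+1%:R * del) w) - Phi (X (k%:R * del) w))); last first.
    rewrite -[X in _ + X]Rintegral_indic_mul; apply: etrans (RintegralD mT i1 i2).
    by apply: eq_Rintegral => w _; exact: stoppedS.
  have -> : k.+1%:R * (eta * del + C * del ^+ 2) =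
      k%:R * (eta * del + C * del ^+ 2) + (eta * del + C * del ^+ 2).
    by rewrite -natr1 mulrDl mul1r.
  rewrite addrAC; apply: le_trans (ler_normD _ _) _; apply: (lerD IH).
  have := H (k%:R * del) (k.+1%:R * del) (survive K del k).
  have -> : k.+1%:R * del - k%:R * del = del by rewrite -natr1 mulrDl mul1r addrC addKr.
  apply.
  - by rewrite mulr_ge0 // ltW.
  - by rewrite ltr_pM2r // ltr_nat.
  - exact: survive_filtration (ltW del0) bK.
  - by move=> w sv; have := sv ord_max.
have [_ cv] := at_hit_integral cK T0.
have le eta : 0 < eta -> `|\int[P]_w at_hit K T w - Phi x0| <= eta * T.
  move=> eta0; have [C C0 HC] := os eta eta0.
  have cv1 : `|\int[P]_w stopped K (T / n.+1%:R) n.+1 w - Phi x0| @[n --> \oo] -->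
      `|\int[P]_w at_hit K T w - Phi x0|.
    by apply: cvg_norm; apply: cvgB => //; exact: cvg_cst.
  have cv2 : eta * T + C * T ^+ 2 / n.+1%:R @[n --> \oo] --> eta * T.
    apply: (@cvg_of_bound _ _ _ (C * T ^+ 2)) => k; rewrite addrC addKr ger0_norm //.
    by rewrite divr_ge0 // mulr_ge0 // sqr_ge0.
  rewrite -(cvg_lim _ cv1) // -(cvg_lim _ cv2) //; apply: ler_lim.
  - by apply/cvg_ex; exists (`|\int[P]_w at_hit K T w - Phi x0|).
  - by apply/cvg_ex; exists (eta * T).
  apply: nearW => k; have k0 : 0 < k.+1%:R :> R by [].
  apply: le_trans (step eta C (T / k.+1%:R) (divr_gt0 T0 k0) HC k.+1) _.
  by rewrite le_eqVlt; apply/orP; left; apply/eqP; field; rewrite gt_eqF.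
apply/eqP; rewrite -subr_eq0 -normr_le0 leNgt; apply/negP => h.
have := le (`|\int[P]_w at_hit K T w - Phi x0| / (2 * T)).
rewrite divr_gt0 ?mulr_gt0 // => /(_ isT).
rewrite invfM mulrA mulrVK ?unitfE ?gt_eqF //; lra.
Qed.

Lemma exit_mean : \int[P]_(w in exits) Phi (X (exit_time D X w) w) = Phi x0.
Proof.
have [_ cv] := exit_integral; apply: cvg_unique cv _ => //.
rewrite (_ : (fun n => _) = fun=> Phi x0); first exact: cvg_cst.
apply/funext => n; rewrite -(at_hit_mean n) [RHS](Rintegral_full measurable_exits exits_full) //.
by have [] := at_hit_integral (@closed_inner n) (ltr0Sn R n).
Qed.

End Stopped.

End ExitLaw.

(** * Integrals of arbitrary functions and null sets *)

Section NullIntegral.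
Import HBNNSimple.
Context (R : realType) (dO : measure_display) (Omega : measurableType dO).
Variables (mu : {measure set Omega -> \bar R}) (G : set Omega).
Hypotheses (mG : measurable G) (nG : mu (~` G) = 0%E).
Local Open Scope ereal_scope.

Lemma sintegral_proj (h : {nnsfun Omega >-> R}) :
  sintegral mu (proj_nnsfun h mG) = sintegral mu h.
Proof.
have mC : measurable (~` G) by exact: measurableC.
have ms (k : {nnsfun Omega >-> R}) : measurable_fun setT (fun x => (k x)%:E).
  by apply/measurable_EFinP; exact: measurable_funP.
rewrite -!integralT_nnsfun.
rewrite (ge0_negligible_integral mC measurableT (ms _) _ nG); last by move=> x _; rewrite lee_fin.
rewrite [RHS](ge0_negligible_integral mC measurableT (ms _) _ nG); last by move=> x _; rewrite lee_fin.
apply: eq_integral => x; rewrite inE => -[_ /= /contrapT Gx].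
by rewrite mindicE mem_set // mulr1.
Qed.

Lemma nnintegral_eq_on (a b : Omega -> \bar R) :
  (forall x, G x -> a x = b x) -> (forall x, 0 <= b x) ->
  ereal_sup [set sintegral mu h | h in [set h : {nnsfun Omega >-> R} | forall x, (h x)%:E <= a x]] <=
  ereal_sup [set sintegral mu h | h in [set h : {nnsfun Omega >-> R} | forall x, (h x)%:E <= b x]].
Proof.
move=> ab b0; apply: ge_ereal_sup => _ [h ha <-].
apply: ereal_sup_ubound; exists (proj_nnsfun h mG); last exact: sintegral_proj.
move=> x /=; rewrite mindicE; have [Gx|nGx] := boolP (x \in G).
  by rewrite mulr1 -ab ?ha //; rewrite inE in Gx.
by rewrite mulr0 b0.
Qed.

(** [F] is arbitrary: [f] is Borel on [bdry D] only, and nothing is known of its value at the exit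
    position for paths outside [exits]. The integrals of the positive and negative parts are suprema
    over simple functions, each of which can be cut off outside [G] without changing its
    integral. *)
Lemma integral_full (F : Omega -> \bar R) :
  \int[mu]_w F w = \int[mu]_(w in G) F w.
Proof.
have E x : G x -> (F \_ setT) x = (F \_ G) x by move=> Gx; rewrite /patch !mem_set.
have E' x : G x -> (F \_ G) x = (F \_ setT) x by move=> Gx; rewrite E.
rewrite /integral; congr (_ - _); apply/le_anti/andP; split; apply: nnintegral_eq_on => x //.
- by move=> Gx; rewrite !funeposE E.
- by move=> Gx; rewrite !funeposE E'.
- by move=> Gx; rewrite !funenegE E.
- by move=> Gx; rewrite !funenegE E'.
Qed.

End NullIntegral.

(** * Measurability of the exit position *)

Section BorelExit.
Context (R : realType) (d : nat) (dO : measure_display) (Omega : measurableType dO).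
Local Notation V := 'rV[R]_d.
Variables (P : probability Omega R) (X : R -> Omega -> V) (x0 : V) (D : set V).
Hypothesis hB : is_brownian P X x0.
Hypothesis oD : open D.

Lemma exits_bdry w : exits X D w -> bdry D (X (exit_time D X w) w).
Proof.
move=> /exits_path[h1 h2]; case: hB => _ cX _ _.
exact: (@exit_bdry _ _ (X^~ w) D (cX w)).
Qed.

(** For open [O] the function [inrad O] is bounded, continuous and positive exactly on [O]; its
    value at the exit position is measurable by [exit_integral], as an iterated limit of grid
    values. *)
Lemma measurable_exit_position (B : set V) : borelRd B ->
  measurable (exits X D `&` (fun w => X (exit_time D X w) w) @^-1` B).
Proof.
have mE := measurable_exits hB oD.
apply: (@smallest_sub _ _ _ [set B | measurable (exits X D `&` (fun w => X (exit_time D X w) w) @^-1` B)]).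
  by apply: salg_preimageI => //; exact: salg_measurable.
move=> O oO /=.
have [|iO _] := exit_integral hB oD (Phi := inrad O) (B := 1) (@continuous_inrad _ _ O).
  by move=> y; rewrite ger0_norm ?inrad_ge0 ?inrad_le1.
have := Rintegrable_measurable iO mE (measurable_itv `](0 : R), +oo[).
congr measurable; apply/seteqP; split => w /= [Ew]; rewrite in_itv /= andbT => h; split => //.
  exact/(inrad_gt0 _ oO).
exact/(inrad_gt0 _ oO).
Qed.

End BorelExit.

(** * Brownian representation of Dirichlet solutions *)

Section DirichletExit.
Context (R : realType) (d : nat).
Local Notation V := 'rV[R]_d.
Variables (D : set V) (phi h : V -> R).
Hypotheses (oD : open D) (cphi : continuous phi) (hh : harmonic_on h D).
Hypothesis hphi : forall y, bdry D y -> h x @[x --> within D (nbhs y)] --> phi y.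
Variable M : R.
Hypothesis DM : forall x, D x -> `|x| <= M.

Let clamp (c t : R) := Num.max (- c) (Num.min c t).

Let clampB c t : 0 <= c -> `|clamp c t| <= c.
Proof.
move=> c0; rewrite ler_norml /clamp le_max lexx /= ge_max ge_min lexx /= andbT.
by rewrite -subr_ge0 opprK addr_ge0.
Qed.

Let clamp_id c t : `|t| <= c -> clamp c t = t.
Proof.
rewrite ler_norml => /andP[h1 h2]; rewrite /clamp (min_r h2); exact: max_r.
Qed.

Let clamp_lip c t s : `|clamp c t - clamp c s| <= `|t - s|.
Proof.
rewrite /clamp /Num.max /Num.min ler_norml.
have := ler_norm (t - s); have := ler_norm (- (t - s)); rewrite normrN.
by do ![case: ifPn; rewrite -?leNgt]; move=> *; apply/andP; split; lra.
Qed.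

Lemma continuous_bounded_ball (f : V -> R) : continuous f ->
  exists2 c : R, 0 <= c & forall y, `|y| <= M -> `|f y| <= c.
Proof.
move=> cf; have [M0|M0] := leP 0 M; last first.
  by exists 0 => // y yM; have := le_lt_trans (le_trans (normr_ge0 _) yM) M0; rewrite ltxx.
have [||c _ H] := @EVT_max_rV R d (fun y => `|f y|) [set y | `|y - 0| <= M] _ (@normball_compact R d 0 M).
- by exists 0; rewrite /= subrr normr0.
- apply: within_continuous => x _; apply: (@continuous_comp _ _ _ f (fun t : R => `|t|)); first exact: cf.
  exact: norm_continuous.
exists `|f c| => // y yM; apply: H.
by rewrite inE /= subr0.
Qed.

Lemma bdry_bound y : bdry D y -> `|y| <= M.
Proof.
move=> [cy _]; rewrite leNgt; apply/negP => My.
have e0 : 0 < `|y| - M by rewrite subr_gt0.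
have : nbhs y [set z | `|z - y| < `|y| - M] by apply/near_ballP; exists (`|y| - M).
move=> /cy[z [Dz /= zy]]; have := DM Dz; have := lerB_dist y z; rewrite distrC => h1 h2.
by have := lt_le_trans zy (le_refl _); lra.
Qed.

(** [one_step] works with a bounded continuous function on the whole space. Here it is [h] in [D]
    and elsewhere [phi] truncated at its bound [c] on the ball of radius [M]; this ball contains the
    boundary, so the truncation leaves the boundary values alone. *)
Lemma dirichlet_extension : exists Phi : V -> R, [/\ continuous Phi,
  exists B, forall y, `|Phi y| <= B, forall y, D y -> Phi y = h y &
  forall y, bdry D y -> Phi y = phi y].
Proof.
have [c c0 Hc] := continuous_bounded_ball cphi.
pose Phi y := if y \in D then h y else clamp c (phi y).
have PD y : D y -> Phi y = h y by move=> Dy; rewrite /Phi mem_set.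
have PN y : ~ D y -> Phi y = clamp c (phi y) by move=> nD; rewrite /Phi memNset.
have Pb y : bdry D y -> Phi y = phi y.
  move=> by_; rewrite PN; first by apply: clamp_id; apply: Hc; exact: bdry_bound.
  by case: by_; rewrite (interior_id _).1.
have cP : continuous Phi.
  move=> y; apply/continuous_atP => e e0.
  have /continuous_atP/(_ e e0)[q q0 Hq] := @cphi y.
  have clq z : `|z - y| < q -> `|clamp c (phi z) - clamp c (phi y)| < e.
    by move=> zy; exact: le_lt_trans (clamp_lip _ _ _) (Hq _ zy).
  have [Dy|nDy] := pselect (D y).
    have [/continuous_atP/(_ e e0)[r r0 Hr] _ _ _] := hh Dy.
    have /near_ballP[p p0 Hp] := open_near oD Dy.
    exists (Num.min r p); first by rewrite lt_min r0.
    by move=> z; rewrite lt_min => /andP[zr /Hp Dz]; rewrite !PD //; exact: Hr.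
  have [cy|ncy] := pselect (closure D y).
    have by_ : bdry D y by split => //; rewrite (interior_id _).1.
    have /cvgrPdist_lt/(_ e e0) := hphi by_; rewrite near_withinE => /near_ballP[r r0 Hr].
    exists (Num.min r q); first by rewrite lt_min r0.
    move=> z; rewrite lt_min => /andP[zr zq]; have [Dz|nDz] := pselect (D z).
      by rewrite (Pb y by_) (PD z Dz) distrC; exact: Hr.
    by rewrite !PN //; exact: clq.
  have /near_ballP[r r0 Hr] : \forall z \near y, ~ D z.
    apply: contrapT => nn; apply: ncy => B By; apply: contrapT => nB; apply: nn.
    by apply: filterS By => z Bz Dz; apply: nB; exists z.
  exists (Num.min r q); first by rewrite lt_min r0.
  by move=> z; rewrite lt_min => /andP[zr zq]; rewrite !PN //; [exact: clq|exact: Hr].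
exists Phi; split => //.
have [b b0 Hb] := continuous_bounded_ball cP.
exists (b + c) => y; have [yM|yM] := leP `|y| M.
  by rewrite (le_trans (Hb y yM)) // lerDl.
rewrite PN; first by rewrite (le_trans (clampB _ c0)) // lerDr.
by move=> /DM; rewrite leNgt yM.
Qed.

Lemma exit_law (dO : measure_display) (Omega : measurableType dO)
    (P : probability Omega R) (X : R -> Omega -> V) (x0 : V) :
  is_brownian P X x0 -> (0 < d)%N -> D x0 ->
  Rintegrable P (exits X D) (fun w => phi (X (exit_time D X w) w)) /\
  \int[P]_(w in exits X D) phi (X (exit_time D X w) w) = h x0.
Proof.
move=> hB d0 Dx0.
have [Phi [cP [B PB] PD Pb]] := dirichlet_extension.
have mE := measurable_exits hB oD.
have E w : w \in exits X D -> Phi (X (exit_time D X w) w) = phi (X (exit_time D X w) w).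
  by rewrite inE => Ew; apply: Pb; exact: (exits_bdry hB).
have [iP _] := exit_integral hB oD cP PB.
split.
  by apply: eq_integrable iP => // w Ew /=; rewrite E.
rewrite -PD // -(exit_mean hB d0 oD Dx0 DM cP PB hh PD).
by apply: eq_Rintegral => w Ew; rewrite E.
Qed.

End DirichletExit.

(** * Controlled convergence *)

Section Controlled.
Context (R : realType) (d : nat).
Local Notation V := 'rV[R]_d.
Implicit Types (A D : set V) (f : V -> \bar R) (u k : V -> R) (y : V).

Lemma near_within_sub A D y (Q : V -> Prop) : A `<=` D ->
  (\forall x \near within D (nbhs y), Q x) -> \forall x \near within A (nbhs y), Q x.
Proof. by move=> AD; rewrite !near_withinE; apply: filterS => x Qx /AD. Qed.

Lemma near_within_ex A y (Q : V -> Prop) : closure A y ->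
  (\forall x \near within A (nbhs y), Q x) -> exists2 x, A x & Q x.
Proof. by move=> cA; rewrite near_withinE => /cA[x [Ax Qx]]; exists x => //; exact: Qx. Qed.

Lemma near_within_self A y : \forall x \near within A (nbhs y), A x.
Proof. by rewrite near_withinE; apply: nearW. Qed.

Lemma not_near_closure D y (Q : V -> Prop) :
  ~ (\forall x \near within D (nbhs y), Q x) -> closure (D `&` [set x | ~ Q x]) y.
Proof.
move=> nQ U Uy; apply: contrapT => nU; apply: nQ; rewrite near_withinE.
apply: filterS Uy => x Ux Dx; apply: contrapT => nQx; apply: nU; exists x; split => //.
Qed.

(** If [k <= M] along [A], the third hypothesis gives [|f y - phi_ n y| <= M / (n + 1)], and [u] is
    as close to [h_ n]. If [k] tends to infinity, [h_ n] stays bounded near [y], so that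
    [u / (1 + k)] is at most of order [1 / (n + 1)]. The hypothesis is phrased through a negation in
    order to cover points where [f] is infinite. *)
Lemma controlled_of_approx D f u k (phi_ h_ : nat -> V -> R) :
  (forall n y, bdry D y -> h_ n x @[x --> within D (nbhs y)] --> phi_ n y) ->
  (forall n x, D x -> `|u x - h_ n x| <= k x / n.+1%:R) ->
  (forall n y (c : R), bdry D y -> 0 <= c ->
     ~ (f y \is a fin_num /\ `|fine (f y) - phi_ n y| <= c) ->
     \forall x \near within D (nbhs y), c < k x / n.+1%:R) ->
  controlled_conv D f u k.
Proof.
move=> hphi uh fphi A y AD By cA; split.
- move=> [M0 kM0]; pose M := `|M0|.
  have kM : \forall x \near within A (nbhs y), k x <= M.
    by apply: filterS kM0 => x /le_trans; apply; exact: ler_norm.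
  have M0' : 0 <= M by exact: normr_ge0.
  have key n : f y \is a fin_num /\ `|fine (f y) - phi_ n y| <= M / n.+1%:R.
    apply: contrapT => nf; have := fphi n y _ By _ nf; rewrite divr_ge0 // => /(_ isT).
    move=> /(near_within_sub AD) h.
    have [x Ax [h1 h2]] := near_within_ex cA (filterI h kM).
    by move: h1; rewrite ltr_pM2r ?invr_gt0 // ltNge h2.
  have [fy _] := key 0%N; split => //.
  apply/cvgrPdist_lt => e e0.
  have [n] := ltr_add_invr (y := 0) (x := e / (3 * (M + 1))) (divr_gt0 e0 (mulr_gt0 (ltr0Sn _ _) (ltr_wpDl M0' ltr01))).
  rewrite add0r => hn.
  have Mn : M / n.+1%:R < e / 3.
    apply: (@le_lt_trans _ _ ((M + 1) / n.+1%:R)); first by rewrite ler_pM2r ?invr_gt0 // lerDl.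
    have M1 : 0 < M + 1 by lra.
    move: hn; rewrite invfM mulrA ltr_pdivlMr // mulrC; apply.
  have e3 : 0 < e / 3 by lra.
  have /cvgrPdist_lt/(_ _ e3) := hphi n y By; move=> /(near_within_sub AD) h.
  have [_ kf] := key n.
  apply: filterS (filterI (filterI h kM) (near_within_self A y)) => x [[h1 h2] Ax].
  have h3 := uh n x (AD x Ax).
  have h4 : k x / n.+1%:R <= M / n.+1%:R by rewrite ler_pM2r ?invr_gt0.
  rewrite -[fine _ - _](subrKA (phi_ n y)) -[phi_ n y - u x](subrKA (h_ n x)).
  apply: le_lt_trans (ler_normD _ _) _.
  have := ler_normD (phi_ n y - h_ n x) (h_ n x - u x); rewrite [`|h_ n x - u x|]distrC.
  move: Mn kf h3 h4 h1; generalize (M / n.+1%:R) (k x / n.+1%:R) => a b.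
  lra.
- move=> /cvgryPge kinf; apply/cvgrPdist_lt => e e0.
  have [n] := ltr_add_invr (y := 0) (x := e / 2) (divr_gt0 e0 (ltr0Sn _ _)).
  rewrite add0r => hn.
  have /cvgrPdist_lt/(_ _ ltr01) := hphi n y By; move=> /(near_within_sub AD) h.
  pose C := `|phi_ n y| + 1.
  have C0 : 0 < C by rewrite /C ltr_wpDl.
  have kT := kinf (C / (e / 2)).
  apply: filterS (filterI (filterI h kT) (near_within_self A y)) => x [[h1 h2] Ax].
  have h3 := uh n x (AD x Ax).
  have k0 : 0 < k x by apply: lt_le_trans h2; rewrite divr_gt0 // divr_gt0.
  have e2 : 0 < e / 2 by lra.
  have h2' : C <= e / 2 * k x by rewrite mulrC -ler_pdivrMr.
  have h4 : k x / n.+1%:R <= e / 2 * k x by rewrite mulrC ler_pM2r // ltW.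
  rewrite sub0r normrN normrM normfV [`|1 + k x|]gtr0_norm; last by lra.
  rewrite ltr_pdivrMr; last by lra.
  have : `|h_ n x| <= C.
    have := ler_normD (h_ n x - phi_ n y) (phi_ n y); rewrite subrK distrC /C; lra.
  have := ler_normD (u x - h_ n x) (h_ n x); rewrite subrK.
  have -> : e * (1 + k x) = e + e / 2 * k x + e / 2 * k x by field.
  move: h3 h4 h2'; generalize (k x / n.+1%:R) (e / 2 * k x) => a b.
  lra.
Qed.

(** Either some set where [k] is bounded accumulates at [y], and [u] converges along it, or [k]
    tends to infinity along all of [A]. *)
Lemma control_cases D f u k A y : controlled_conv D f u k -> (forall x, D x -> 0 <= k x) ->
  A `<=` D -> bdry D y -> closure A y ->
  exists A', [/\ A' `<=` A, closure A' y &
    (f y \is a fin_num /\ u x @[x --> within A' (nbhs y)] --> fine (f y)) \/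
    ((forall T : R, \forall x \near within A' (nbhs y), T <= k x) /\
     (forall del : R, 0 < del -> \forall x \near within A' (nbhs y), `|u x| <= del * (1 + k x)))].
Proof.
move=> cc k0 AD By cA.
have [[M cM]|nM] := pselect (exists M : R, closure (A `&` [set x | k x <= M]) y).
  exists (A `&` [set x | k x <= M]); split => //.
  left; have [|h _] := cc (A `&` [set x | k x <= M]) y _ By cM; first by move=> x [/AD].
  apply: h; exists M; apply: filterS (near_within_self _ y) => x [] //.
exists A; split => //; right.
have kT (T : R) : \forall x \near within A (nbhs y), T <= k x.
  apply: contrapT => /not_near_closure h; apply: nM; exists T.
  apply: closure_subset h => x [Ax /= nT]; split => //=; apply/ltW; rewrite ltNge; exact/negP.
split => // del del0.
have kinf : k x @[x --> within A (nbhs y)] --> +oo by apply/cvgryPge.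
have [_ /(_ kinf)/cvgrPdist_lt/(_ del del0) hh] := cc A y AD By cA.
 apply: filterS (filterI hh (near_within_self A y)) => x [h1 Ax].
have kx := k0 x (AD x Ax); move: h1; rewrite sub0r normrN normrM normfV [`|1 + k x|]gtr0_norm; last by lra.
by rewrite ltr_pdivrMr; [move/ltW|lra].
Qed.

(** If the bound failed near [y], it would fail on a set accumulating there. Two applications of
    [control_cases] thin this set out until each of the two pairs is in a pure regime, which leaves
    four cases. *)
Lemma controlled_gap D f u1 u2 k1 k2 y (c s : R) :
  controlled_conv D f u1 k1 -> controlled_conv D f u2 k2 ->
  (forall x, D x -> 0 <= k1 x) -> (forall x, D x -> 0 <= k2 x) -> bdry D y -> c < 0 -> 0 < s ->
  \forall x \near within D (nbhs y), c < u1 x - u2 x + s * (k1 x + k2 x).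
Proof.
move=> cc1 cc2 k10 k20 By c0 s0; apply: contrapT => /not_near_closure cB.
set B := D `&` _ in cB.
have BD : B `<=` D by move=> x [].
have [A1 [A1B cA1 H1]] := control_cases cc1 k10 BD By cB.
have [A2 [A2A1 cA2 H2]] := control_cases cc2 k20 (subset_trans A1B BD) By cA1.
have near1 (Q : V -> Prop) : (\forall x \near within A1 (nbhs y), Q x) ->
    \forall x \near within A2 (nbhs y), Q x by exact: near_within_sub.
have absurd (Q : V -> Prop) : (\forall x \near within A2 (nbhs y), Q x) ->
    (forall x, Q x -> 0 <= k1 x -> 0 <= k2 x -> c < u1 x - u2 x + s * (k1 x + k2 x)) -> False.
  move=> hQ HQ; have [x A2x Qx] := near_within_ex cA2 hQ.
  have [Dx] := A1B _ (A2A1 _ A2x); apply; apply: HQ => //; [exact: k10|exact: k20].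
have s2 : 0 < s / 2 by lra.
set l := fine (f y) in H1 H2.
case: H1 => [[_ /cvgrPdist_lt h1]|[h1 g1]]; case: H2 => [[_ /cvgrPdist_lt h2]|[h2 g2]].
- have c4 : 0 < - c / 4 by lra.
  apply: absurd (filterI (near1 _ (h1 _ c4)) (h2 _ c4)) _ => x [].
  rewrite !ltr_norml => /andP[a1 a2] /andP[b1 b2] p1 p2.
  have : 0 <= s * (k1 x + k2 x) by rewrite mulr_ge0 ?addr_ge0 // ltW.
  lra.
(* The threshold makes [s / 2 * k2] absorb the limit [l] of [u1], an error 1 and the constant part
   [s / 2] of the bound on [u2]. *)
- apply: absurd (filterI (filterI (near1 _ (h1 _ ltr01)) (g2 _ s2)) (h2 ((`|l| + 1 + s / 2) / (s / 2)))) _.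
  move=> x [[]]; rewrite ltr_norml ler_norml ler_pdivrMr // => /andP[a1 a2] /andP[b1 b2] b3 p1 p2.
  have := ler_norm (- l); rewrite normrN => n1.
  have : 0 <= s * k1 x by rewrite mulr_ge0 // ltW.
  lra.
- apply: absurd (filterI (filterI (h2 _ ltr01) (near1 _ (g1 _ s2))) (near1 _ (h1 ((`|l| + 1 + s / 2) / (s / 2))))) _.
  move=> x [[]]; rewrite ltr_norml ler_norml ler_pdivrMr // => /andP[a1 a2] /andP[b1 b2] b3 p1 p2.
  have n1 := ler_norm l.
  have : 0 <= s * k2 x by rewrite mulr_ge0 // ltW.
  lra.
- apply: absurd (filterI (filterI (near1 _ (g1 _ s2)) (g2 _ s2)) (near1 _ (h1 2))) _.
  move=> x [[]]; rewrite !ler_norml => /andP[a1 a2] /andP[b1 b2] b3 p1 p2.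
  have : 0 <= s * (k1 x - 2) by rewrite mulr_ge0 ?subr_ge0 // ltW.
  have : 0 <= s * k2 x by rewrite mulr_ge0 // ltW.
  lra.
Qed.

(** The minimum principle admits a single superharmonic function: [k1], being harmonic, joins the
    harmonic part, and [k2] takes that place. The resulting bound [|h1 - h2| <= s * (k1 + k2)] holds
    for all [s > 0]. *)
Lemma controlled_unique D f h1 h2 k1 k2 : open D -> (exists M : R, forall x, D x -> enorm x <= M) ->
  harmonic_on h1 D -> harmonic_on h2 D -> harmonic_on k1 D -> superharmonic_on k2 D ->
  (forall x, D x -> 0 <= k1 x) -> (forall x, D x -> 0 <= k2 x) ->
  controlled_conv D f h1 k1 -> controlled_conv D f h2 k2 -> forall x, D x -> h1 x = h2 x.
Proof.
move=> oD bD hh1 hh2 hk1 hk2 k10 k20 cc1 cc2 x Dx.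
have main (s : R) : 0 < s -> `|h1 x - h2 x| <= s * (k1 x + k2 x).
  move=> s0.
  have H (a b : R) : (forall y, bdry D y -> forall c : R, c < 0 ->
      \forall z \near within D (nbhs y), c < (a * h1 z + b * h2 z) + s * (k1 z + k2 z)) ->
      0 <= (a * h1 x + b * h2 x) + s * (k1 x + k2 x).
    move=> bd; have hw := harmonic_comb 1 s oD (harmonic_comb a b oD hh1 hh2) hk1.
    have E z : 1 * (a * h1 z + b * h2 z) + s * k1 z + s * k2 z =
        (a * h1 z + b * h2 z) + s * (k1 z + k2 z) by ring.
    rewrite -E; apply: (minimum_principle oD bD hw hk2 s0) => // y By c c0.
    by apply: filterS (bd y By c c0) => z; rewrite E.
  have p1 : 0 <= (1 * h1 x + -1 * h2 x) + s * (k1 x + k2 x).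
    apply: H => y By c c0; apply: filterS (controlled_gap cc1 cc2 k10 k20 By c0 s0) => z.
    by rewrite mul1r mulN1r.
  have p2 : 0 <= (-1 * h1 x + 1 * h2 x) + s * (k1 x + k2 x).
    apply: H => y By c c0; apply: filterS (controlled_gap cc2 cc1 k20 k10 By c0 s0) => z.
    by rewrite mul1r mulN1r [k2 z + _]addrC [- h1 z + _]addrC.
  by rewrite ler_norml; apply/andP; split; lra.
apply/eqP; rewrite -subr_eq0 -normr_le0 leNgt; apply/negP => p.
have q : 0 < k1 x + k2 x + 1 by rewrite ltr_wpDl // addr_ge0 ?k10 ?k20.
have := main (`|h1 x - h2 x| / (k1 x + k2 x + 1)); rewrite divr_gt0 // => /(_ isT).
rewrite mulrAC ler_pdivlMr //; nra.
Qed.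

End Controlled.

(** * Borel boundary data *)

Section ExitFunctional.
Context (R : realType) (d : nat) (dO : measure_display) (Omega : measurableType dO).
Local Notation V := 'rV[R]_d.
Variables (P : V -> probability Omega R) (G : set Omega) (Y : Omega -> V) (D : set V).
Hypothesis mG : measurable G.
Hypothesis PG : forall x, D x -> P x G = 1%E.
Hypothesis YB : forall w, G w -> bdry D (Y w).
Hypothesis mY : forall B, borelRd B -> measurable (G `&` Y @^-1` B).
Hypothesis oD : open D.
(** The only link between exit laws and harmonic functions in this section; Borel data are reached
    from continuous data by measure theory and Harnack's inequality. *)
Hypothesis dir : forall phi : V -> R, continuous phi -> exists h : V -> R,
  [/\ harmonic_on h D, forall y, bdry D y -> h x @[x --> within D (nbhs y)] --> phi y &
   forall x, D x -> Rintegrable (P x) G (phi \o Y) /\ \int[P x]_(w in G) phi (Y w) = h x].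
Local Notation VB := (g_sigma_algebraType (@open V)).
Local Open Scope ereal_scope.

Lemma borel_bdry : borelRd (bdry D).
Proof.
apply: (salg_setD (salg_generated _)); first by apply: closed_borelRd; exact: closed_closure.
by apply: open_borelRd; exact: open_interior.
Qed.

Lemma borel_onP (v : V -> \bar R) : borel_on (bdry D) v <-> measurable_fun (bdry D : set VB) (v : VB -> \bar R).
Proof.
split=> [h mD B mB|h B mB]; first exact: h.
by apply: h => //; exact: borel_bdry.
Qed.

Definition nnborel (v : V -> \bar R) :=
  (forall y, bdry D y -> 0 <= v y) /\ borel_on (bdry D) v.

Lemma nnborel_comp v : nnborel v ->
  measurable_fun G (v \o Y) /\ forall w, G w -> 0 <= (v \o Y) w.
Proof.
move=> [v0 bv]; split; last by move=> w Gw; apply: v0; exact: YB.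
move=> _ B mB; rewrite (_ : _ `&` _ = G `&` Y @^-1` (bdry D `&` v @^-1` B)).
  by apply: mY; exact: bv.
by apply/seteqP; split => w /= [Gw h]; split => //; [split => //; exact: YB|case: h].
Qed.

Lemma nnborelD u v : nnborel u -> nnborel v -> nnborel (fun y => u y + v y).
Proof.
move=> [u0 bu] [v0 bv]; split; first by move=> y Dy; rewrite adde_ge0 ?u0 ?v0.
by apply/borel_onP; apply: emeasurable_funD; exact/borel_onP.
Qed.

Lemma nnborelZ v (c : R) : (0 <= c)%R -> nnborel v -> nnborel (fun y => c%:E * v y).
Proof.
move=> c0 [v0 bv]; split; first by move=> y Dy; rewrite mule_ge0 ?v0.
by apply/borel_onP; apply: measurable_funeM; exact/borel_onP.
Qed.

Lemma nnborel_series (v : nat -> V -> \bar R) : (forall n, nnborel (v n)) ->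
  nnborel (fun y => \sum_(0 <= n <oo) v n y).
Proof.
move=> bv; split=> [y Dy|].
  by apply: nneseries_ge0 => n _ _; have [h _] := bv n; exact: h.
apply/borel_onP; have := @ge0_emeasurable_sum _ VB R (bdry D) v xpredT.
apply=> [n y Dy _|n _]; first by have [h _] := bv n; exact: h.
by have [_ h] := bv n; exact/borel_onP.
Qed.

Lemma borel_on_cont (phi : V -> R) : continuous phi -> borel_on (bdry D) (EFin \o phi).
Proof.
move=> cp; apply/borel_onP; apply/measurable_EFinP; apply: measurable_funTS => mT.
apply: (measurability _ (RGenOInfty.measurableE R)) => // _ [_ [a ->] <-].
by rewrite preimage_itvoy setTI; apply: open_borelRd; exact: open_superlevel.
Qed.

Lemma nnborel_abs (phi : V -> R) : continuous phi -> nnborel (fun y => `|phi y|%:E).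
Proof.
move=> cp; split => [y _|]; first by rewrite lee_fin.
apply: (@borel_on_cont (fun y => `|phi y|%R)) => y.
by apply: (@continuous_comp _ _ _ phi (fun t : R => `|t|%R)); [exact: cp|exact: norm_continuous].
Qed.

Lemma nnborel_indic (A : set V) : borelRd A -> nnborel (fun y => (\1_A y)%:E).
Proof.
move=> bA; split => [y _|]; first by rewrite lee_fin.
apply/borel_onP; apply/measurable_EFinP; apply: measurable_funTS.
exact: (@measurable_indic _ VB).
Qed.

Definition exit_expect (v : V -> \bar R) (x : V) : \bar R := \int[P x]_(w in G) v (Y w).

Lemma exit_expect_ge0 v x : nnborel v -> 0 <= exit_expect v x.
Proof. by move=> /nnborel_comp[_ h]; exact: integral_ge0. Qed.

Lemma exit_expect_le u v x : nnborel u -> nnborel v -> (forall y, bdry D y -> u y <= v y) -> exit_expect u x <= exit_expect v x.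
Proof.
move=> /nnborel_comp[mu u0] /nnborel_comp[mv _] uv; apply: ge0_le_integral => // w Gw.
by apply: uv; exact: YB.
Qed.

Lemma exit_expectD u v x : nnborel u -> nnborel v -> exit_expect (fun y => u y + v y) x = exit_expect u x + exit_expect v x.
Proof. by move=> /nnborel_comp[mu u0] /nnborel_comp[mv v0]; exact: ge0_integralD. Qed.

Lemma exit_expectZ v (c : R) x : (0 <= c)%R -> nnborel v -> exit_expect (fun y => c%:E * v y) x = c%:E * exit_expect v x.
Proof. by move=> c0 /nnborel_comp[mv v0]; apply: ge0_integralZl. Qed.

Lemma exit_expect_series (v : nat -> V -> \bar R) x : (forall n, nnborel (v n)) ->
  exit_expect (fun y => \sum_(0 <= n <oo) v n y) x = \sum_(0 <= n <oo) exit_expect (v n) x.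
Proof.
move=> bv; apply: (@integral_nneseries _ _ _ (P x) G mG (fun n w => v n (Y w))).
  by move=> n; have [] := nnborel_comp (bv n).
by move=> n w Gw; have [_ h] := nnborel_comp (bv n); exact: h.
Qed.

(** The constant is common to all nonnegative [wharm] functions, so that the inequality can be
    summed over countably many of them. *)
Definition harnack_at (y x1 : V) (K : R) := forall u : V -> R,
  wharm u D -> (forall z, D z -> 0 <= u z)%R -> (u y <= K * u x1)%R.

Variable x1 : V.
Hypothesis Dx1 : D x1.

(* Countable sums of nonnegative continuous functions have these properties. *)
Definition good (v : V -> \bar R) := [/\ nnborel v,
  forall y K, D y -> (0 <= K)%R -> harnack_at y x1 K -> exit_expect v y <= K%:E * exit_expect v x1 &
  forall y (c : R), bdry D y -> c%:E < v y -> \forall x \near within D (nbhs y), c%:E < exit_expect v x].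

(** For continuous data the expectation is the Dirichlet solution itself, a nonnegative harmonic
    function with boundary values [|phi|]. *)
Lemma good_abs (phi : V -> R) : continuous phi -> good (fun y => `|phi y|%:E).
Proof.
move=> cp.
have ca : continuous (fun y => `|phi y|%R).
  move=> y; apply: (@continuous_comp _ _ _ phi (fun t : R => `|t|%R)); first exact: cp.
  exact: norm_continuous.
have [h [hh hb hx]] := dir ca.
have E x : D x -> exit_expect (fun y => `|phi y|%:E) x = (h x)%:E.
  by move=> Dx; have [i1 <-] := hx x Dx; rewrite (EFin_Rintegral mG i1).
split; first exact: nnborel_abs.
- move=> y K Dy K0 HK; rewrite !E // -EFinM lee_fin; apply: HK; first exact: harmonic_wharm.
  by move=> z Dz; have [_ <-] := hx z Dz; apply: Rintegral_ge0 => w _ /=.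
- move=> y c By; rewrite lte_fin => cphi.
  have Hc : \forall x \near within D (nbhs y), (c < h x)%R by exact: cvgr_gt (hb y By) _ cphi.
  rewrite near_withinE in Hc; rewrite near_withinE; apply: filterS Hc => x Hc Dx.
  by rewrite E // lte_fin; exact: Hc.
Qed.

Lemma lte_split (a b : \bar R) (c : R) : 0 <= a -> 0 <= b -> c%:E < a + b ->
  exists c1 c2 : R, [/\ c = (c1 + c2)%R, c1%:E < a & c2%:E < b].
Proof.
case: a => [a| |] // a0; case: b => [b| |] // b0.
- rewrite -EFinD lte_fin => cab; exists (a - (a + b - c) / 2)%R, (b - (a + b - c) / 2)%R.
  by rewrite !lte_fin; split; lra.
- move=> _; exists (a - 1)%R, (c - (a - 1))%R; rewrite ltry lte_fin; split => //; lra.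
- move=> _; exists (c - (b - 1))%R, (b - 1)%R; rewrite ltry lte_fin; split => //; lra.
- by move=> _; exists 0%R, c; rewrite !ltry add0r.
Qed.

Lemma good0 : good (fun=> 0).
Proof.
have : good (fun y : V => `|(0 : R)%R|%:E) by apply: (@good_abs (fun=> 0%R)); exact: cst_continuous.
by rewrite normr0.
Qed.

Lemma goodD u v : good u -> good v -> good (fun y => u y + v y).
Proof.
move=> [bu Ku lu] [bv Kv lv]; split; first exact: nnborelD.
- move=> y K Dy K0 HK; rewrite !exit_expectD // ge0_muleDr ?exit_expect_ge0 //.
  by apply: leeD; [exact: Ku|exact: Kv].
- move=> y c By; case: (bu) => u0 _; case: (bv) => v0 _.
  move=> /(lte_split (u0 y By) (v0 y By))[c1 [c2 [-> /(lu y _ By) h1 /(lv y _ By) h2]]].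
  by apply: filterS2 h1 h2 => x a1 a2; rewrite exit_expectD // EFinD lteD.
Qed.

(** A number strictly below the sum at [y] is already below a partial sum; the strict inequality in
    the last property of [good] is what lets it pass to infinite sums. *)
Lemma good_series (v : nat -> V -> \bar R) : (forall n, good (v n)) ->
  good (fun y => \sum_(0 <= n <oo) v n y).
Proof.
move=> gv; have bv n : nnborel (v n) by have [] := gv n.
split; first exact: nnborel_series.
- move=> y K Dy K0 HK; rewrite !exit_expect_series // -nneseriesZl; last by move=> i _; exact: exit_expect_ge0.
  by apply: lee_nneseries => [i _ _|i _]; [exact: exit_expect_ge0|have [_ h _] := gv i; exact: h].
- move=> y c By cS.
  have gN N : good (fun y => \sum_(0 <= n < N) v n y).
    elim: N => [|N IH].
      by under eq_fun do rewrite big_geq //; exact: good0.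
    under eq_fun do rewrite big_nat_recr //=; exact: goodD.
  have v0 n : 0 <= v n y by have [h _] := bv n; exact: h.
  have [N cN] : exists N, c%:E < \sum_(0 <= n < N) v n y.
    apply: contrapT => nN; move: cS; apply/negP; rewrite -leNgt.
    apply: lime_le; first by apply: is_cvg_nneseries.
    by apply: nearW => N; rewrite leNgt; apply/negP => h; apply: nN; exists N.
  have [bN _ /(_ y c By cN)] := gN N; apply: filterS => x h; apply: lt_le_trans h _.
  apply: exit_expect_le => // [|z Bz]; first exact: nnborel_series.
  by apply: nneseries_lim_ge => n _ _; have [h _] := bv n; exact: h.
Qed.

Lemma goodZ v (c : R) : (0 <= c)%R -> good v -> good (fun y => c%:E * v y).
Proof.
rewrite le_eqVlt => /orP[/eqP <- _|c0].
  by under eq_fun do rewrite mul0e; exact: good0.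
move=> [bv Kv lv]; have c0' := ltW c0; split; first exact: nnborelZ.
- move=> y K Dy K0 HK; rewrite !exit_expectZ // muleCA; apply: lee_wpmul2l; first by rewrite lee_fin.
  exact: Kv.
- move=> y b By bv_; have : (b / c)%:E < v y by rewrite EFinM muleC lte_pdivrMl // muleC.
  move=> /(lv y _ By); apply: filterS => x h.
  by rewrite exit_expectZ //; move: h; rewrite EFinM muleC lte_pdivrMl // muleC.
Qed.


Definition approximable (f : V -> \bar R) := forall e : R, (0 < e)%R ->
  exists (phi : V -> R) (v : V -> \bar R), [/\ continuous phi, good v, exit_expect v x1 <= e%:E,
    forall y, bdry D y -> f y <= (phi y)%:E + v y &
    forall y, bdry D y -> (phi y)%:E <= f y + v y].

Lemma exit_expect0 x : exit_expect (fun=> 0) x = 0.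
Proof. exact: integral0. Qed.

Lemma exit_expect_cst (c : R) x : D x -> exit_expect (fun=> c%:E) x = c%:E.
Proof.
move=> Dx; transitivity (c%:E * 1); last exact: mule1.
by rewrite /exit_expect integral_cst //; congr (_ * _); exact: PG.
Qed.

Lemma continuous_sum_nat (N : nat) (phi : nat -> V -> R) : (forall k, continuous (phi k)) ->
  continuous (fun y => \sum_(0 <= k < N) phi k y)%R.
Proof.
move=> cp; elim: N => [|N IH] y.
  by under eq_fun do rewrite big_geq //; exact: cst_continuous.
under eq_fun do rewrite big_nat_recr //=.
by apply: continuous_forD; [exact: IH|exact: cp].
Qed.

Lemma abs_le_of_approx (p : R) (a b : \bar R) : 0 <= a -> 0 <= b ->
  a <= p%:E + b -> p%:E <= a + b -> `|p|%:E <= a + b.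
Proof.
case: a => [a| |] //; case: b => [b| |] //; rewrite -?EFinD ?lee_fin => a0 b0 h1 h2; rewrite ?leey //.
by rewrite ler_norml; apply/andP; split; lra.
Qed.


Lemma approximable_cont (phi : V -> R) : continuous phi -> approximable (EFin \o phi).
Proof.
move=> cp e e0; exists phi, (fun=> 0); split => //; first exact: good0.
- by rewrite exit_expect0 lee_fin ltW.
- by move=> y _; rewrite adde0.
- by move=> y _; rewrite adde0.
Qed.

Lemma approximable_ext f g : (forall y, bdry D y -> f y = g y) -> approximable f -> approximable g.
Proof.
move=> fg af e e0; have [phi [v [cp gv hv h1 h2]]] := af e e0.
by exists phi, v; split => // y By; rewrite -fg // ?h1 ?h2.
Qed.

(** Finitely many terms go into [phi]. The tail goes into the error, not as [f n], which need not be
    good, but as the larger [|phi_n| + v_n]; its total at [x1] is small because the series of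
    expectations converges. *)
Lemma approximable_series (f : nat -> V -> \bar R) : (forall n, nnborel (f n)) ->
  (forall n, approximable (f n)) -> \sum_(0 <= n <oo) exit_expect (f n) x1 < +oo ->
  approximable (fun y => \sum_(0 <= n <oo) f n y).
Proof.
move=> bf af Sfin e e0.
(* A quarter of [e], because a tail term uses its approximation error twice and half of [e] is
   reserved for the tail of the expectations of [f]. *)
have e4 n : (0 < e / 4 / (2 ^ n.+1)%:R)%R by rewrite !divr_gt0 // ltr0n expn_gt0.
have /choice[pv Hpv] : forall n, exists pv : (V -> R) * (V -> \bar R),
    [/\ continuous pv.1, good pv.2, exit_expect pv.2 x1 <= (e / 4 / (2 ^ n.+1)%:R)%:E,
    forall y, bdry D y -> f n y <= (pv.1 y)%:E + pv.2 y &
    forall y, bdry D y -> (pv.1 y)%:E <= f n y + pv.2 y].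
  by move=> n; have [p [v H]] := af n _ (e4 n); exists (p, v).
have f0 n y : bdry D y -> 0 <= f n y by move=> By; have [h _] := bf n; exact: h.
have v0 n y : bdry D y -> 0 <= (pv n).2 y.
  by move=> By; have [_ [[h _] _ _] _ _ _] := Hpv n; exact: h.
have bv n : nnborel (pv n).2 by have [_ []] := Hpv n.
have ba n : nnborel (fun y => `|(pv n).1 y|%:E) by apply: nnborel_abs; have [] := Hpv n.
have Hf0 n : 0 <= exit_expect (f n) x1 by exact: exit_expect_ge0.
have [N tail] : exists N, \sum_(N <= k <oo) exit_expect (f k) x1 <= (e / 2)%:E.
  have := nneseries_tail_cvg Sfin (fun k _ => Hf0 k).
  move=> /fine_cvgP[_] /cvg_seqP/(_ (e / 2)%R)[|N HN]; first by rewrite divr_gt0.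
  exists N; have := HN N (leqnn _); rewrite /= subr0.
  have T0 : 0 <= \sum_(N <= k <oo) exit_expect (f k) x1 by exact: nneseries_ge0.
  have Tfin : \sum_(N <= k <oo) exit_expect (f k) x1 \is a fin_num.
    rewrite ge0_fin_numE //; apply: le_lt_trans Sfin.
    by rewrite (@nneseries_split _ _ 0 N) // add0n leeDr // sume_ge0.
  by rewrite ger0_norm ?fine_ge0 // => /ltW; rewrite -lee_fin fineK.
pose u n y := if (n < N)%N then (pv n).2 y else `|(pv n).1 y|%:E + (pv n).2 y.
have gu n : good (u n).
  rewrite /u; case: ltnP => _; first by have [_ h _ _ _] := Hpv n.
  by have [h1 h2 _ _ _] := Hpv n; apply: goodD => //; exact: good_abs.
have bu n : nnborel (u n) by have [] := gu n.
have u0 n y : bdry D y -> 0 <= u n y by have [h _] := bu n; exact: h.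
pose phi y := (\sum_(0 <= k < N) (pv k).1 y)%R.
exists phi, (fun y => \sum_(0 <= n <oo) u n y); split.
- by apply: continuous_sum_nat => k; have [h _ _ _ _] := Hpv k.
- exact: good_series.
- rewrite exit_expect_series //.
  pose b n := if (n < N)%N then 0 else exit_expect (f n) x1.
  apply: (@le_trans _ _ (\sum_(0 <= n <oo) (b n + (e / 2 / (2 ^ n.+1)%:R)%:E))).
    apply: lee_nneseries => [n _ _|n _]; first exact: exit_expect_ge0.
    have [_ _ h _ h2] := Hpv n.
    have E : (e / 2 / (2 ^ n.+1)%:R = e / 4 / (2 ^ n.+1)%:R + e / 4 / (2 ^ n.+1)%:R)%R by field; rewrite pnatr_eq0 -lt0n expn_gt0.
    rewrite /u /b; case: ltnP => _.
      by rewrite add0e E; apply: le_trans h _; rewrite lee_fin lerDl ltW.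
    have k1 : exit_expect (fun y => `|(pv n).1 y|%:E) x1 <= exit_expect (f n) x1 + (e / 4 / (2 ^ n.+1)%:R)%:E.
      apply: (@le_trans _ _ (exit_expect (fun y => f n y + (pv n).2 y) x1)); last first.
        by rewrite exit_expectD //; apply: leeD2l.
      apply: exit_expect_le => //; first exact: nnborelD.
      move=> y By; have [_ _ _ h3 h4] := Hpv n.
      by apply: abs_le_of_approx; [exact: f0|exact: v0|exact: h3|exact: h4].
    by rewrite exit_expectD // E EFinD; apply: le_trans (leeD k1 h) _; rewrite addeA.
  apply: le_trans (epsilon_trick _ _ _) _.
  + by move=> n; rewrite /b; case: ifP.
  + by rewrite divr_ge0 // ltW.
  rewrite [leRHS](_ : _ = (e / 2)%:E + (e / 2)%:E); last by rewrite -EFinD -splitr.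
  apply: leeD => //; rewrite (@nneseries_split _ _ 0 N); last by move=> k _; rewrite /b; case: ifP.
  rewrite add0n big_nat big1; last by move=> k /andP[_ kN]; rewrite /b kN.
  rewrite add0e; apply: le_trans tail; apply: lee_nneseries => [n Nn _|n _]; rewrite /b.
    by case: ifP.
  by case: ifP.
- move=> y By.
  have up m : \sum_(0 <= k < N + m) f k y <= (phi y)%:E + \sum_(0 <= k < N + m) u k y.
    elim: m => [|m IH].
      rewrite addn0 /phi -sumEFin -big_split /= big_nat [leRHS]big_nat; apply: lee_sum => k /andP[_ kN].
      by have [_ _ _ h _] := Hpv k; rewrite /u kN; exact: h.
    rewrite addnS !big_nat_recr //= addeA; apply: leeD => //.
    have [_ _ _ h _] := Hpv (N + m)%N; rewrite /u ltnNge leq_addr /=.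
    by apply: le_trans (h y By) _; apply: leeD => //; rewrite lee_fin ler_norm.
  apply: lime_le; first by apply: is_cvg_nneseries => n _ _; exact: f0.
  exists N => // M /= NM; rewrite -(subnKC NM); apply: le_trans (up _) _.
  by apply: leeD2l; apply: nneseries_lim_ge => n _ _; exact: u0.
- move=> y By; rewrite /phi -sumEFin.
  apply: (@le_trans _ _ (\sum_(0 <= k < N) f k y + \sum_(0 <= k < N) u k y)).
    rewrite -big_split /= big_nat [leRHS]big_nat; apply: lee_sum => k /andP[_ kN].
    by have [_ _ _ _ h] := Hpv k; rewrite /u kN; exact: h.
  by apply: leeD; apply: nneseries_lim_ge => n _ _; [exact: f0|exact: u0].
Qed.

Lemma approximableZ f (c : R) : (0 <= c)%R -> nnborel f -> approximable f ->
  approximable (fun y => c%:E * f y).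
Proof.
move=> c0 [f0 _] af e e0; have c1 : (0 < c + 1)%R by rewrite ltr_wpDl.
have [|phi [v [cp gv hv h1 h2]]] := af (e / (c + 1))%R; first by rewrite divr_gt0.
have [bv _ _] := gv; have [v0 _] := bv.
exists (fun y => c * phi y)%R, (fun y => c%:E * v y); split.
- by move=> y; apply: continuousM; [exact: cst_continuous|exact: cp].
- exact: goodZ.
- rewrite exit_expectZ //; apply: le_trans (lee_wpmul2l _ hv) _; rewrite ?lee_fin //.
  by rewrite mulrCA ler_piMr ?(ltW e0) // ler_pdivrMr // mul1r lerDl.
- move=> y By; rewrite EFinM -muleDr ?fin_num_adde_defr //.
  by apply: lee_wpmul2l; rewrite ?lee_fin // h1.
- move=> y By; rewrite EFinM -ge0_muleDr ?v0 ?f0 //.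
  by apply: lee_wpmul2l; rewrite ?lee_fin // h2.
Qed.

(** The functions [min 1 (n * inrad O)] are continuous and increase to the indicator; their
    increments form a series of continuous nonnegative functions. *)
Lemma approximable_open (O : set V) : open O -> approximable (fun y => (\1_O y)%:E).
Proof.
move=> oO.
pose g (n : nat) (y : V) : R := (Num.min 1 (n%:R * inrad O y))%R.
have cg n : continuous (g n).
  move=> y; apply/continuous_atP => q q0; exists (q / n.+1%:R)%R; first by rewrite divr_gt0.
  move=> z zy; have H (a b : R) : (`|Num.min 1 a - Num.min 1 b| <= `|a - b|)%R.
    rewrite /Num.min ler_norml.
    have := ler_norm (a - b); have := ler_norm (- (a - b)); rewrite normrN.
    by do ![case: ifPn; rewrite -?leNgt]; move=> *; apply/andP; split; lra.
  apply: le_lt_trans (H _ _) _; rewrite -mulrBr normrM ger0_norm //.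
  apply: (@le_lt_trans _ _ (n.+1%:R * `|z - y|)%R); last by rewrite -ltr_pdivlMl // mulrC.
  by apply: ler_pM => //; [rewrite ler_nat|exact: inrad_lipschitz].
have gmono n y : (g n y <= g n.+1 y)%R.
  rewrite le_min /g ge_min lexx /= ge_min; apply/orP; right.
  by rewrite ler_wpM2r ?inrad_ge0 // ler_nat.
pose f n y := (g n.+1 y - g n y)%:E.
have fE n y : (g n.+1 y - g n y = `|g n.+1 y - g n y|)%R by rewrite ger0_norm // subr_ge0.
have cdf n : continuous (fun y => (g n.+1 y - g n y)%R).
  by move=> y; apply: continuous_forB; exact: cg.
have bf n : nnborel (f n).
  by have := nnborel_abs (cdf n); under eq_fun do rewrite -fE.
have E y : \sum_(0 <= n <oo) f n y = (\1_O y)%:E.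
  have PM M : \sum_(0 <= n < M) f n y = (g M y)%:E.
    rewrite /f sumEFin telescope_sumr // /g mul0r; congr EFin.
    by rewrite [X in (_ - X)%R]min_r ?subr0.
  apply/cvg_lim => //; apply: cvg_near_cst; rewrite indicE.
  have [/set_mem Oy|Oy] := boolP (y \in O); last first.
    apply: nearW => M; rewrite PM /g; congr EFin.
    have -> : inrad O y = 0%R.
      apply/le_anti; rewrite inrad_ge0 andbT leNgt; apply/negP => /(inrad_gt0 _ oO).
      by move=> Oy'; move: Oy; rewrite mem_set.
    by rewrite mulr0 min_r.
  have r0 : (0 < inrad O y)%R by exact/inrad_gt0.
  exists (Num.truncn (inrad O y)^-1).+1 => // M /= HM; rewrite PM /g; congr EFin.
  apply: min_l; rewrite -ler_pdivrMr // mul1r.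
  by apply/ltW/(lt_le_trans (truncnS_gt _)); rewrite ler_nat.
have bO : nnborel (fun y => (\1_O y)%:E) by apply: nnborel_indic; exact: open_borelRd.
apply: approximable_ext (fun y _ => E y) _; apply: approximable_series => //.
  by move=> n; exact: approximable_cont (cdf n).
rewrite -exit_expect_series //; apply: (@le_lt_trans _ _ (exit_expect (fun=> 1%:E) x1)).
  apply: exit_expect_le; first exact: nnborel_series.
    by have := nnborel_abs (@cst_continuous V R 1%R); rewrite normr1.
  by move=> y _; rewrite E lee_fin indicE; case: (_ \in _).
by rewrite exit_expect_cst // ltry.
Qed.

(** Dynkin's theorem, open sets being stable under intersection. For a complement, [1 - phi] works
    with the same error [v]; a disjoint union is a series. *)
Lemma approximable_indic (A : set V) : borelRd A -> approximable (fun y => (\1_A y)%:E).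
Proof.
apply: (@dynkin_induction _ VB (@open V) (fun A => approximable (fun y => (\1_A y)%:E))) => //.
- by move=> B C; exact: openI.
- by apply: approximable_open; exact: openT.
- by move=> O; exact: approximable_open.
- move=> S mS aS e e0; have [phi [v [cp gv hv h1 h2]]] := aS e e0.
  have [[v0 _] _ _] := gv.
  exists (fun y => 1 - phi y)%R, v; split => //.
  + by move=> y; apply: continuous_forB; [exact: cst_continuous|exact: cp].
  + move=> y By; have := h2 y By; rewrite !indicE in_setC.
    have := v0 y By; case: (v y) => [r| |] // _; last by rewrite ?addey ?leey.
    by case: (y \in S); rewrite -!EFinD !lee_fin /=; lra.
  + move=> y By; have := h1 y By; rewrite !indicE in_setC.
    have := v0 y By; case: (v y) => [r| |] // _; last by rewrite ?addey ?leey.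
    by case: (y \in S); rewrite -!EFinD !lee_fin /=; lra.
- move=> F mF tF aF.
  have bF n : nnborel (fun y : V => (\1_(F n) y)%:E) := nnborel_indic (mF n).
  apply: (@approximable_ext (fun y => \sum_(0 <= n <oo) (\1_(F n) y)%:E)).
    by move=> y _; rewrite (indic_bigcup _ tF).
  apply: approximable_series => //; rewrite -exit_expect_series //.
  apply: (@le_lt_trans _ _ (exit_expect (fun=> 1%:E) x1)); last by rewrite exit_expect_cst // ltry.
  apply: exit_expect_le; first exact: nnborel_series.
    by have := nnborel_abs (@cst_continuous V R 1%R); rewrite normr1.
  by move=> y _; rewrite -(indic_bigcup _ tF) lee_fin indicE; case: (_ \in _).
Qed.

(** The sum is [eta] times the ceiling of [t / eta], and infinite if [t] is. Thus a nonnegative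
    Borel function is, up to [eta], a countable sum of multiples of indicators. *)
Lemma layer_sum (t : \bar R) (eta : R) : 0 <= t -> (0 < eta)%R ->
  t <= \sum_(0 <= k <oo) (eta * ((k%:R * eta)%:E < t)%E%:R)%:E <= t + eta%:E.
Proof.
move=> t0 eta0.
have u0 k : 0 <= (eta * ((k%:R * eta)%:E < t)%E%:R)%:E by rewrite lee_fin mulr_ge0 // ltW.
case: t t0 u0 => [r| |] // t0 u0; last first.
  rewrite addye // leey andbT leye_eq; apply/eqP/eq_infty => c.
  pose N := (Num.truncn (c / eta)).+1.
  apply: (@le_trans _ _ (\sum_(0 <= k < N) (eta * ((k%:R * eta)%:E < +oo)%E%:R)%:E)); last first.
    exact: nneseries_lim_ge.
  under eq_bigr do rewrite ltry mulr1.
  rewrite sumEFin lee_fin sumr_const_nat subn0 -mulr_natr mulrC -ler_pdivrMr //.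
  by apply/ltW; exact: truncnS_gt.
rewrite lee_fin in t0; pose N0 := (Num.truncn (r / eta)).+1.
have PN N : (N0 <= N)%N -> exists c, [/\ \sum_(0 <= k < N) (eta * ((k%:R * eta)%:E < r%:E)%E%:R)%:E = (eta * c)%:E,
    r / eta <= c & c < r / eta + 1]%R.
  move=> N0N; exists (\sum_(j < N) ((j%:R < r / eta)%R : nat)%:R)%R.
  have /andP[h1 h2] : (r / eta <= \sum_(j < N) ((j%:R < r / eta)%R : nat)%:R < r / eta + 1)%R.
    apply: count_lt; first by rewrite divr_ge0 // ltW.
    by apply: (@le_trans _ _ N0%:R); [apply/ltW; exact: truncnS_gt|rewrite ler_nat].
  split => //; rewrite sumEFin big_mkord mulr_sumr; congr EFin; apply: eq_bigr => j _.
  by rewrite lte_fin ltr_pdivlMr.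
apply/andP; split.
  have [c [E c1 c2]] := PN N0 (leqnn _).
  apply: (@le_trans _ _ (eta * c)%:E); first by rewrite lee_fin mulrC -ler_pdivrMr.
  by rewrite -E; exact: nneseries_lim_ge.
apply: lime_le; first exact: is_cvg_nneseries.
exists N0 => // N /= /PN[c [-> c1 c2]]; rewrite -EFinD lee_fin.
have : (eta * c <= eta * (r / eta + 1))%R by rewrite ler_wpM2l // ltW.
by rewrite mulrDr mulr1 mulrCA mulfV ?mulr1 // gt_eqF.
Qed.

(** Half of [e] pays for rounding to layers, a constant error that has expectation [eta] since exit
    laws are probabilities; the other half pays for approximating the series. *)
Lemma approximable_borel f : nnborel f -> exit_expect f x1 < +oo -> approximable f.
Proof.
move=> bf Hfin e e0; have [f0 bof] := bf.
pose eta := (e / 2)%R; have eta0 : (0 < eta)%R by rewrite divr_gt0.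
pose A k := bdry D `&` [set y | (k%:R * eta)%:E < f y].
have bA k : borelRd (A k).
  have := bof `](k%:R * eta)%:E, +oo]%classic (emeasurable_itv _).
  congr borelRd; apply/seteqP; split => y /= [By]; rewrite in_itv /= => h; split => //.
    by case/andP: h.
  by rewrite h leey.
pose L k (y : V) := eta%:E * (\1_(A k) y)%:E.
have bL k : nnborel (L k) by apply: nnborelZ; [exact: ltW|exact: nnborel_indic].
have SE y : bdry D y -> f y <= \sum_(0 <= k <oo) L k y <= f y + eta%:E.
  move=> By; have := layer_sum (f0 y By) eta0.
  rewrite (@eq_eseriesr _ _ (fun k => L k y)) // => k _; rewrite /L -EFinM indicE; congr (_ * (_ : bool)%:R)%:E.
  by apply/idP/idP; rewrite inE; [move=> h; split|move=> []].
have bS : nnborel (fun y => \sum_(0 <= k <oo) L k y) by exact: nnborel_series.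
have bcst : nnborel (fun=> eta%:E).
  by have := nnborel_abs (@cst_continuous V R eta); rewrite ger0_norm // ltW.
have aS : approximable (fun y => \sum_(0 <= k <oo) L k y).
  apply: approximable_series => //.
    move=> k; apply: approximableZ; [exact: ltW|exact: nnborel_indic|exact: approximable_indic].
  rewrite -exit_expect_series //; apply: (@le_lt_trans _ _ (exit_expect (fun y => f y + eta%:E) x1)).
    apply: exit_expect_le => //; first exact: nnborelD.
    by move=> y /SE/andP[].
  by rewrite exit_expectD // exit_expect_cst // lte_add_pinfty // ltry.
have [phi [v [cp gv hv h1 h2]]] := aS eta eta0.
have [bv _ _] := gv; have [v0 _] := bv.
exists phi, (fun y => v y + eta%:E); split => //.
- apply: goodD => //; have := good_abs (@cst_continuous V R eta).
  by rewrite ger0_norm // ltW.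
- by rewrite exit_expectD // exit_expect_cst // [e]splitr EFinD leeD2r.
- move=> y By; have /andP[s1 s2] := SE y By; apply: le_trans s1 _; apply: le_trans (h1 y By) _.
  by apply: leeD2l; rewrite leeDl // lee_fin ltW.
- move=> y By; have /andP[s1 s2] := SE y By; apply: le_trans (h2 y By) _.
  by rewrite [v y + _]addeC addeA leeD2r.
Qed.


Hypothesis d0 : (0 < d)%N.
Hypothesis connD : connected D.

Lemma good_harnack x : D x -> exists (r K : R), [/\ (0 < r)%R, (0 <= K)%R &
  forall y, (`|y - x| <= r)%R -> D y /\ forall v, good v -> exit_expect v y <= K%:E * exit_expect v x1].
Proof.
move=> Dx; have [r [K [r0 K0 H]]] := harnack d0 oD connD Dx1 Dx.
exists r, K; split => // y /H[Dy Hy]; split => // v [_ hv _]; exact: hv.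
Qed.

Lemma exit_expect_cont (psi : V -> R) x : continuous psi -> (forall y, 0 <= psi y)%R -> D x ->
  nnborel (EFin \o psi) /\ exit_expect (EFin \o psi) x = (\int[P x]_(w in G) psi (Y w))%R%:E.
Proof.
move=> cp p0 Dx; split.
  by split; [move=> y _; rewrite lee_fin|exact: borel_on_cont].
by have [h [_ _ /(_ x Dx)[i1 _]]] := dir cp; rewrite (EFin_Rintegral mG i1).
Qed.

(* [phi] may be negative: adding [|phi| - phi] turns both inequalities into
   inequalities between nonnegative functions. *)
Lemma exit_expect_approx f v (phi : V -> R) x : nnborel f -> nnborel v -> continuous phi -> D x ->
  (forall y, bdry D y -> f y <= (phi y)%:E + v y) ->
  (forall y, bdry D y -> (phi y)%:E <= f y + v y) ->
  let h := (\int[P x]_(w in G) phi (Y w))%R in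
  exit_expect f x <= h%:E + exit_expect v x /\ h%:E <= exit_expect f x + exit_expect v x.
Proof.
move=> bf bv cp Dx h1 h2 h.
have ca : continuous (fun y => `|phi y|%R).
  move=> y; apply: (@continuous_comp _ _ _ phi (fun t : R => `|t|%R)); first exact: cp.
  exact: norm_continuous.
have cm : continuous (fun y => `|phi y| - phi y)%R.
  by move=> y; apply: continuous_forB; [exact: ca|exact: cp].
have [b1 e1] := exit_expect_cont ca (fun y => normr_ge0 _) Dx.
have [|b2 e2] := exit_expect_cont cm _ Dx; first by move=> y; rewrite subr_ge0 ler_norm.
have [_ [_ _ /(_ x Dx)[i1 _]]] := dir ca; have [_ [_ _ /(_ x Dx)[i2 _]]] := dir cp.
set a := (\int[P x]_(w in G) `|phi (Y w)|)%R in e1.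
have E : (\int[P x]_(w in G) (`|phi (Y w)| - phi (Y w)) = a - h)%R by exact: (RintegralB mG i1 i2).
rewrite E in e2.
have f0 y : bdry D y -> 0 <= f y by case: bf => p _; exact: p.
have v0 y : bdry D y -> 0 <= v y by case: bv => p _; exact: p.
have k1 : exit_expect f x + (a - h)%:E <= a%:E + exit_expect v x.
  rewrite -e1 -e2 -!exit_expectD //; apply: exit_expect_le; [exact: nnborelD|exact: nnborelD|].
  move=> y By /=; move: (h1 y By) (f0 y By) (v0 y By).
  case: (f y) => [s| |] //; case: (v y) => [t| |] //; rewrite -?EFinD ?lee_fin ?addey ?leey //; lra.
have k2 : a%:E <= exit_expect f x + exit_expect v x + (a - h)%:E.
  rewrite -e1 -e2 -!exit_expectD //; last exact: nnborelD.
  apply: exit_expect_le => //; first by apply: nnborelD => //; exact: nnborelD.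
  move=> y By /=; move: (h2 y By) (f0 y By) (v0 y By).
  case: (f y) => [s| |] //; case: (v y) => [t| |] //; rewrite -?EFinD ?lee_fin ?addey ?addye ?leey //; lra.
have F0 := exit_expect_ge0 x bf; have V0 := exit_expect_ge0 x bv.
move: F0 V0 k1 k2; case: (exit_expect f x) => [p| |] //; case: (exit_expect v x) => [q| |] // _ _;
  rewrite -?EFinD ?lee_fin ?addey ?addye ?leey //; move=> s1 s2; split => //; rewrite ?lee_fin ?leey //; lra.
Qed.

Section FixedBoundary.
Variable f : V -> \bar R.
Hypotheses (bf : nnborel f) (ffin : exit_expect f x1 < +oo).

Lemma approximants (eps : nat -> R) : (forall n, 0 < eps n)%R ->
  exists (phi_ h_ : nat -> V -> R) (v_ : nat -> V -> \bar R), forall n,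
    [/\ good (v_ n), exit_expect (v_ n) x1 <= (eps n)%:E, harmonic_on (h_ n) D,
      forall y, bdry D y -> h_ n x @[x --> within D (nbhs y)] --> phi_ n y &
      (forall y, bdry D y -> f y <= (phi_ n y)%:E + v_ n y /\ (phi_ n y)%:E <= f y + v_ n y) /\
      (forall x, D x -> exit_expect f x <= (h_ n x)%:E + exit_expect (v_ n) x /\ (h_ n x)%:E <= exit_expect f x + exit_expect (v_ n) x)].
Proof.
move=> eps0; have af := approximable_borel bf ffin.
have /choice[p Hp] : forall n, exists p : (V -> R) * (V -> R) * (V -> \bar R),
    [/\ good p.2, exit_expect p.2 x1 <= (eps n)%:E, harmonic_on p.1.2 D,
      forall y, bdry D y -> p.1.2 x @[x --> within D (nbhs y)] --> p.1.1 y &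
      (forall y, bdry D y -> f y <= (p.1.1 y)%:E + p.2 y /\ (p.1.1 y)%:E <= f y + p.2 y) /\
      (forall x, D x -> exit_expect f x <= (p.1.2 x)%:E + exit_expect p.2 x /\ (p.1.2 x)%:E <= exit_expect f x + exit_expect p.2 x)].
  move=> n; have [phi [v [cp gv hv h1 h2]]] := af _ (eps0 n).
  have [h [hh hb hx]] := dir cp; exists (phi, h, v); split => //=; split.
    by move=> y By; split; [exact: h1|exact: h2].
  move=> x Dx; have [_ <-] := hx x Dx; have [bv _ _] := gv; exact: exit_expect_approx.
exists (fun n => (p n).1.1), (fun n => (p n).1.2), (fun n => (p n).2) => n; exact: Hp.
Qed.

Lemma good_fin v (x : V) : good v -> exit_expect v x1 < +oo -> D x -> exit_expect v x \is a fin_num.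
Proof.
move=> gv vfin Dx; have [bv _ _] := gv; rewrite ge0_fin_numE ?exit_expect_ge0 //.
have [r [K [r0 K0 H]]] := good_harnack Dx.
have [|_ /(_ v gv) h] := H x; first by rewrite subrr normr0 ltW.
apply: le_lt_trans h _; have v1 : exit_expect v x1 \is a fin_num by rewrite ge0_fin_numE ?exit_expect_ge0.
by rewrite -(fineK v1) -EFinM ltry.
Qed.

(** Finiteness spreads from [x1] over [D]: the expectation of [f] is at most a Dirichlet solution
    plus that of a good function, which Harnack's inequality bounds. *)
Lemma exit_expect_fin x : D x -> exit_expect f x \is a fin_num.
Proof.
move=> Dx; have [phi_ [h_ [v_ H]]] := @approximants (fun=> 1%R) (fun=> ltr01).
have [gv hv _ _ [_ /(_ x Dx)[h1 _]]] := H 0%N; rewrite ge0_fin_numE ?exit_expect_ge0 //.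
apply: le_lt_trans h1 _; have vx : exit_expect (v_ 0%N) x \is a fin_num.
  by apply: good_fin => //; exact: le_lt_trans hv (ltry _).
by rewrite -(fineK vx) -EFinD ltry.
Qed.

Lemma approx_fine (h : R) v x : D x -> exit_expect v x \is a fin_num ->
  exit_expect f x <= h%:E + exit_expect v x -> h%:E <= exit_expect f x + exit_expect v x -> (`|fine (exit_expect f x) - h| <= fine (exit_expect v x))%R.
Proof.
move=> Dx vx; rewrite -(fineK vx) -(fineK (exit_expect_fin Dx)) -!EFinD !lee_fin => h1 h2.
by rewrite ler_norml; apply/andP; split; lra.
Qed.

Lemma exit_expect_harmonic : harmonic_on (fun x => fine (exit_expect f x)) D.
Proof.
have [|phi_ [h_ [v_ H]]] := @approximants (fun n => n.+1%:R^-1)%R; first by move=> n; rewrite invr_gt0.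
have gv n : good (v_ n) by have [] := H n.
have hv n : exit_expect (v_ n) x1 <= (n.+1%:R^-1)%:E by have [] := H n.
have vfin n x : D x -> exit_expect (v_ n) x \is a fin_num.
  by apply: good_fin => //; exact: le_lt_trans (hv n) (ltry _).
have bnd n x : D x -> (`|fine (exit_expect f x) - h_ n x| <= fine (exit_expect (v_ n) x))%R.
  by move=> Dx; have [_ _ _ _ [_ /(_ x Dx)[h1 h2]]] := H n; apply: approx_fine => //; exact: vfin.
have loc x : D x -> exists (r K : R), [/\ 0 < r, 0 <= K &
    forall y, `|y - x| <= r -> D y /\ forall n, `|fine (exit_expect f y) - h_ n y| <= K / n.+1%:R]%R.
  move=> Dx; have [r [K [r0 K0 HK]]] := good_harnack Dx.
  exists r, K; split => // y /HK[Dy Hy]; split => // n; apply: le_trans (bnd n y Dy) _.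
  rewrite -lee_fin fineK ?vfin //; apply: le_trans (Hy _ (gv n)) _.
  by rewrite EFinM; apply: lee_wpmul2l; rewrite ?lee_fin.
apply: (@harmonic_limit _ _ h_) => //.
- by move=> n; have [] := H n.
- move=> x Dx; have [r [K [r0 K0 HK]]] := loc x Dx.
  have [_ _ /(_ x Dx)[/continuous_atP/(_ 1%R ltr01)[q q0 Hq] _ _ _] _ _] := H 0%N.
  exists (Num.min r (q / 2))%R; first by rewrite lt_min r0 divr_gt0.
  (* Near [x] continuity bounds [h_ 0] by [|h_ 0 x| + 1]; the expectation of [f] is within [K] of
     [h_ 0], and every [h_ n] is within [K] of that expectation. *)
  exists (`|h_ 0%N x| + 1 + K + K)%R => n y; rewrite le_min => /andP[/HK[Dy Hy] yq].
  split => //; have yq' : (`|y - x| < q)%R by apply: le_lt_trans yq _; lra.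
  have b0 := Hy 0%N; have bn := Hy n; rewrite divr1 in b0.
  have c0 := Hq y yq'.
  have Kn : (K / n.+1%:R <= K)%R by rewrite ler_pdivrMr // ler_peMr // ler1n.
  have t1 := ler_normD (h_ 0%N y - h_ 0%N x)%R (h_ 0%N x); rewrite subrK in t1.
  have t2 := ler_normD (fine (exit_expect f y) - h_ 0%N y)%R (h_ 0%N y); rewrite subrK in t2.
  have t3 := ler_normB (fine (exit_expect f y)) (fine (exit_expect f y) - h_ n y)%R; rewrite subKr in t3.
  move: bn Kn; generalize (K / n.+1%:R)%R => a; lra.
- move=> x Dx; have [r [K [r0 K0 HK]]] := loc x Dx.
  have [|_ Hn] := HK x; first by rewrite subrr normr0 ltW.
  by apply: (@cvg_of_bound _ _ _ K) => n; rewrite distrC; exact: Hn.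
Qed.

End FixedBoundary.

Lemma controlled_representation (f : V -> \bar R) : nnborel f -> exit_expect f x1 < +oo ->
  [/\ forall x, D x -> exit_expect f x \is a fin_num, harmonic_on (fun x => fine (exit_expect f x)) D &
    exists g, [/\ nnborel g, forall x, D x -> exit_expect g x \is a fin_num,
      harmonic_on (fun x => fine (exit_expect g x)) D &
      controlled_conv D f (fun x => fine (exit_expect f x)) (fun x => fine (exit_expect g x))]].
Proof.
move=> bf ffin; split; [exact: exit_expect_fin|exact: exit_expect_harmonic|].
(* The factor [n.+1] in [g] cancels, so that [g] has expectation at most 1 at [x1]. *)
pose eps n : R := (1 / (2 ^ n.+1)%:R / n.+1%:R)%R.
have eps0 n : (0 < eps n)%R by rewrite divr_gt0 // divr_gt0 // ltr0n expn_gt0.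
have [phi_ [h_ [v_ H]]] := approximants bf ffin eps0.
have gv n : good (v_ n) by have [] := H n.
have bv n : nnborel (v_ n) by have [] := gv n.
have hv n : exit_expect (v_ n) x1 <= (eps n)%:E by have [] := H n.
have vfin n x : D x -> exit_expect (v_ n) x \is a fin_num.
  by apply: good_fin => //; exact: le_lt_trans (hv n) (ltry _).
pose w n y := n.+1%:R%:E * v_ n y.
have gw n : good (w n) by apply: goodZ.
have bw n : nnborel (w n) by have [] := gw n.
pose g y := \sum_(0 <= n <oo) w n y.
have bg : nnborel g by exact: nnborel_series.
have gfin : exit_expect g x1 < +oo.
  rewrite exit_expect_series //; apply: (@le_lt_trans _ _ 1%:E); last exact: ltry.
  apply: (@le_trans _ _ (\sum_(0 <= n <oo) (0 + (1 / (2 ^ n.+1)%:R)%:E))).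
    apply: lee_nneseries => [n _ _|n _]; first exact: exit_expect_ge0.
    rewrite add0e exit_expectZ //; apply: le_trans (lee_wpmul2l _ (hv n)) _; rewrite ?lee_fin //.
    by rewrite /eps mulrC divfK.
  apply: le_trans (epsilon_trick xpredT (fun=> lexx _) ler01) _.
  by rewrite eseries0 // add0e.
have gx := @exit_expect_fin g bg gfin.
exists g; split => //; first exact: exit_expect_harmonic.
have vg n x : D x -> (fine (exit_expect (v_ n) x) <= fine (exit_expect g x) / n.+1%:R)%R.
  move=> Dx; rewrite ler_pdivlMr // -lee_fin fineK ?gx // EFinM fineK ?vfin // muleC -exit_expectZ //.
  apply: (exit_expect_le x (bw n) bg) => y By.
  have w0 k : 0 <= w k y by have [h _] := bw k; exact: h.
  have := @nneseries_lim_ge _ (fun k => w k y) xpredT 0 n.+1 (fun k _ _ => w0 k).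
  by apply: le_trans; rewrite big_nat_recr //= leeDr // sume_ge0.
apply: (@controlled_of_approx _ _ D f _ _ phi_ h_).
- by move=> n; have [] := H n.
- move=> n x Dx; have [_ _ _ _ [_ /(_ x Dx)[h1 h2]]] := H n.
  by apply: le_trans (vg n x Dx); apply: approx_fine => //; exact: vfin.
- move=> n y c By c0 nf; have [_ _ _ _ [/(_ y By)[h1 h2] _]] := H n.
  (* With [v_ n y <= c] the two inequalities at [y] would make [f y] finite and within [c] of
     [phi_ n y]. *)
  have cv : c%:E < v_ n y.
    rewrite ltNge; apply/negP => vc; apply: nf.
    have f0 : 0 <= f y by case: bf => h _; exact: h.
    have ub : f y <= (phi_ n y + c)%:E by apply: le_trans h1 _; rewrite EFinD leeD2l.
    have lb : (phi_ n y)%:E <= f y + c%:E by apply: le_trans h2 _; rewrite leeD2l.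
    move: f0 ub lb; case: (f y) => [t| |] //= _; rewrite -?EFinD ?lee_fin => ub lb.
    by split => //; rewrite ler_norml; apply/andP; split; lra.
  have [_ _ /(_ y c By cv)] := gv n; rewrite !near_withinE; apply: filterS => x Hc Dx.
  apply: lt_le_trans (vg n x Dx); rewrite -lte_fin fineK ?vfin //; exact: Hc.
Qed.

End ExitFunctional.

(** * Functions that agree on the domain *)

Section EqualOn.
Context (R : realType) (d : nat).
Local Notation V := 'rV[R]_d.
Variables (D : set V).
Hypothesis oD : open D.

(** [HD] and [exit_expect] are known to agree on [D] only; since [D] is open, derivatives at its
    points do not see values outside. *)
Lemma harmonic_eq_on (h u : V -> R) : (forall x, D x -> u x = h x) ->
  harmonic_on h D -> harmonic_on u D.
Proof.
move=> uh hD.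
have P1 i y : D y -> derivable u y (evec R i) /\ partial i u y = partial i h y.
  by move=> Dy; have [_ h1 _ _] := hD y Dy; apply: (partial_eq_on oD Dy uh); have [] := h1 i.
have P2 i j y : D y -> derivable (partial i u) y (evec R j) /\
    partial j (partial i u) y = partial j (partial i h) y.
  move=> Dy; have [_ _ h2 _] := hD y Dy; have [d2 _] := h2 i j.
  exact: (partial_eq_on oD Dy (fun z Dz => (P1 i z Dz).2)).
move=> x Dx; have [hc h1 h2 h0] := hD x Dx; split.
- exact: (continuous_eq_on oD Dx uh hc).
- move=> i; split; first by have [] := P1 i x Dx.
  by apply: (continuous_eq_on oD Dx (fun z Dz => (P1 i z Dz).2)); have [] := h1 i.
- move=> i j; split; first by have [] := P2 i j x Dx.
  by apply: (continuous_eq_on oD Dx (fun z Dz => (P2 i j z Dz).2)); have [] := h2 i j.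
- by apply: etrans h0; apply: eq_bigr => i _; have [] := P2 i i x Dx.
Qed.

Lemma controlled_eq_on (f : V -> \bar R) (h u k l : V -> R) :
  (forall x, D x -> u x = h x) -> (forall x, D x -> l x = k x) ->
  controlled_conv D f h k -> controlled_conv D f u l.
Proof.
move=> uh lk cc A y AD By cA; have [c1 c2] := cc A y AD By cA.
have E (T : Type) (a b : V -> T) : (forall x, D x -> a x = b x) ->
    {near within A (nbhs y), a =1 b}.
  by move=> ab; apply: filterS (near_within_self A y) => x /AD/ab.
split=> [[M kM]|kinf].
  have [|fy hf] := c1.
    by exists M; apply: filterS (filterI kM (near_within_self A y)) => x [+ /AD Dx]; rewrite lk.
  by split => //; apply: cvg_trans hf; apply: near_eq_cvg; apply: E => x Dx; rewrite uh.
have ki : k x @[x --> within A (nbhs y)] --> +oo.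
  by apply: cvg_trans kinf; apply: near_eq_cvg; apply: E => x Dx; rewrite lk.
apply: cvg_trans (c2 ki); apply: near_eq_cvg; apply: E => x Dx /=.
by rewrite uh // lk.
Qed.

End EqualOn.

Theorem theorem2p5 (R : realType) (d : nat) (dO : measure_display)
    (Omega : measurableType dO) (P : 'rV[R]_d -> probability Omega R)
    (X : R -> Omega -> 'rV[R]_d)
    (hd : (0 < d)%N)
    (hBM : forall x, is_brownian (P x) X x)
    (D : set 'rV[R]_d) (hD : bounded_domain D) (hDir : dirichlet_solvable D)
    (f : 'rV[R]_d -> \bar R)
    (hf0 : forall y, bdry D y -> (0 <= f y)%E)
    (hfB : borel_on (bdry D) f)
    (hfin : exists x, D x /\ (HD P X D f x < +oo)%E) :
  [/\ (forall x, D x -> HD P X D f x \is a fin_num),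
      harmonic_on (fun x => fine (HD P X D f x)) D,
      (exists g : 'rV[R]_d -> \bar R,
         [/\ (forall y, bdry D y -> (0 <= g y)%E), borel_on (bdry D) g,
             (forall x, D x -> HD P X D g x \is a fin_num),
             superharmonic_on (fun x => fine (HD P X D g x)) D &
             controlled_conv D f (fun x => fine (HD P X D f x))
                                 (fun x => fine (HD P X D g x))]) &
      (forall h k : 'rV[R]_d -> R,
         harmonic_on h D -> superharmonic_on k D ->
         (forall x, D x -> 0 <= k x) -> controlled_conv D f h k ->
         forall x, D x -> h x = fine (HD P X D f x))].
Proof.
have [_ [oD [connD [M DM]]]] := hD.
have DM' x : D x -> `|x| <= M by move=> Dx; exact: le_trans (norm_le_enorm x) (DM x Dx).
pose G := exits X D; pose Y w := X (exit_time D X w) w.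
(* [G] and [Y] do not involve the starting point, so Brownian motion from 0 serves for their
   measurability, whether or not 0 lies in [D]. *)
have mG : measurable G by exact: (measurable_exits (hBM 0) oD).
have PG x : D x -> P x G = 1%E by move=> Dx; exact: (exits_full (hBM x) hd oD Dx DM').
have nG x : D x -> P x (~` G) = 0%E.
  by move=> Dx; rewrite probability_setC // (PG x Dx) subee.
have YB w : G w -> bdry D (Y w) by exact: (exits_bdry (hBM 0) oD).
have mY B : borelRd B -> measurable (G `&` Y @^-1` B) by exact: (measurable_exit_position (hBM 0) oD).
have dir phi : continuous phi -> exists h, [/\ harmonic_on h D,
    forall y, bdry D y -> h x @[x --> within D (nbhs y)] --> phi y &
    forall x, D x -> Rintegrable (P x) G (phi \o Y) /\ \int[P x]_(w in G) phi (Y w) = h x].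
  move=> cphi; have [|h [hh hb]] := hDir phi; first by apply: within_continuous => y _; exact: cphi.
  by exists h; split => // x Dx; exact: (exit_law oD cphi hh hb DM' (hBM x) hd Dx).
have HE (v : 'rV[R]_d -> \bar R) x : D x -> HD P X D v x = exit_expect P G Y v x.
  by move=> Dx; exact: (integral_full mG (nG x Dx)).
have [x1 [Dx1 fin1]] := hfin; rewrite HE // in fin1.
have [|Hfin Hharm [g [[g0 bg] gfin gharm cc]]] :=
  controlled_representation mG PG YB mY oD dir Dx1 hd connD _ fin1; first by split.
have fE x : D x -> fine (HD P X D f x) = fine (exit_expect P G Y f x) by move=> Dx; rewrite HE.
have gE x : D x -> fine (HD P X D g x) = fine (exit_expect P G Y g x) by move=> Dx; rewrite HE.
have fharm := harmonic_eq_on oD fE Hharm.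
have gharm' := harmonic_eq_on oD gE gharm.
have cc' := controlled_eq_on fE gE cc.
split => //.
- by move=> x Dx; rewrite HE //; exact: Hfin.
- exists g; split => //; last exact: harmonic_superharmonic.
  by move=> x Dx; rewrite HE //; exact: gfin.
- move=> h k hh hk k0 cck x Dx.
  apply: esym; apply: (controlled_unique oD _ fharm hh gharm' hk _ k0 cc' cck Dx).
    by exists M.
  move=> y Dy; rewrite HE //; apply/fine_ge0/integral_ge0 => w Gw.
  exact: (g0 _ (YB w Gw)).
Qed.
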